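(* Let $\mathfrak{g}$ be a split real semisimple Lie algebra, let $\varphi\colon\mathfrak{g}\to\mathfrak{g}$ be an automorphism of order $2$ with eigenspace decomposition $\mathfrak{g}=\mathfrak{g}_0\oplus\mathfrak{g}_1$ (where $\varphi$ acts as $(-1)^i$ on $\mathfrak{g}_i$), and let $G_0=R^c(\widetilde G_0^c(\mathbb{R}))$ be a group constructed from $(\mathfrak{g},\mathfrak{g}_0)$ and an isomorphism $R^c\colon\widetilde G_0^c\to G_0^c$ as described in the context. Then $G_0$ is a reductive Lie group (in the sense defined in the context).
   Context: Setting. ''Split'' means that $\mathfrak{g}$ has a Cartan subalgebra that is split over $\mathbb{R}$. Let $\mathfrak{g}^c=\mathbb{C}\otimes_{\mathbb{R}}\mathfrak{g}$ and $\mathfrak{g}^c=\mathfrak{g}_0^c\oplus\mathfrak{g}_1^c$ the induced decomposition; $\mathrm{ad}$ is the adjoint map of $\mathfrak{g}^c$. Let $G^c$ be the adjoint group of $\mathfrak{g}^c$, that is, the connected algebraic subgroup of $\mathrm{GL}(\mathfrak{g}^c)$ with Lie algebra $\mathrm{ad}(\mathfrak{g}^c)$, equivalently the identity component of $\mathrm{Aut}(\mathfrak{g}^c)$. Let $G_0^c$ be the connected algebraic subgroup of $G^c$ with Lie algebra $\mathrm{ad}(\mathfrak{g}_0^c)$; it is generated by all $\exp(\mathrm{ad}(x))$ with $x\in\mathfrak{g}_0^c$. The real structure on $G_0^c$ is the one given by a basis of $\mathfrak{g}^c$ consisting of elements of $\mathfrak{g}$: $G_0^c(\mathbb{R})$ is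 the group of elements of $G_0^c$ whose matrix with respect to such a basis has real entries. The group $G_0$. Let $\widetilde G_0^c$ be a connected algebraic subgroup of $\mathrm{GL}_k(\mathbb{C})$ for some $k$, and let $R^c\colon\widetilde G_0^c\to G_0^c$ be an isomorphism of algebraic groups, where both $\widetilde G_0^c$ and $R^c$ are defined over $\mathbb{R}$. Let $\widetilde G_0^c(\mathbb{R})$ be the group of all elements of $\widetilde G_0^c$ with real entries, and define $G_0=R^c(\widetilde G_0^c(\mathbb{R}))$. Then $(G_0^c(\mathbb{R}))^\circ\le G_0\le G_0^c(\mathbb{R})\le\mathrm{Aut}(\mathfrak{g})$, where $^\circ$ denotes the identity component in the Euclidean topology; $G_0$ is a Lie group with Lie algebra $\mathrm{ad}_{\mathfrak{g}}(\mathfrak{g}_0)\cong\mathfrak{g}_0$. Definition (reductive Lie group, in the sense of Knapp). A real Lie group $\mathcal{G}$ with Lie algebra $\mathbf{g}$ is reductive if there is a quadruple $(\mathcal{G},\mathcal{K},\eta,\mathcal{B})$, where $\mathcal{K}\le\mathcal{G}$ is a compact subgroup, $\eta$ is an involution of $\mathbf{g}$, and $\mathcal{B}$ is a nondegenerate $\mathrm{Ad}(\mathcal{G})$- and $\eta$-invariant bilinear form on $\mathbf{g}$, such that: (i) $\mathbf{g}$ is reductive (the direct sum of its semisimple derived subalgebra and its center); (ii) the $\pm1$-eigenspace decomposition of $\eta$ is $\mathbf{g}=\mathbf{k}\oplus\mathbf{p}$, where $\mathbf{k}$ is the Lie algebra of $\mathcal{K}$; (iii) $\mathbf{k}$ and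 $\mathbf{p}$ are orthogonal under $\mathcal{B}$, and $\mathcal{B}$ is negative definite on $\mathbf{k}$ and positive definite on $\mathbf{p}$; (iv) the multiplication map $\mathcal{K}\times\exp(\mathbf{p})\to\mathcal{G}$ is a surjective diffeomorphism; (v) for each $g\in\mathcal{G}$, the automorphism $\mathrm{Ad}(g)$ of the complexification $\mathbf{g}^c$ is inner, i.e. lies in $\mathrm{Int}(\mathbf{g}^c)$, the analytic subgroup of $\mathrm{Aut}(\mathbf{g}^c)$ with Lie algebra $\mathrm{ad}(\mathbf{g}^c)$, generated by all $\exp(\mathrm{ad}(x))$ with $x\in\mathbf{g}^c$. *)

(* Defs.v *)
From HB Require Import structures.
From mathcomp Require Export all_boot all_order all_algebra.
From mathcomp Require Export all_classical all_reals all_analysis.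
From mathcomp Require Export complex.
Export Order.TTheory GRing.Theory Num.Theory.
Export numFieldNormedType.Exports.
Set Implicit Arguments.
Unset Strict Implicit.
Unset Printing Implicit Defensive.
Local Open Scope classical_set_scope.
Local Open Scope ring_scope.
Local Open Scope complex_scope.

Section LieAlgebras.
Variables (F : fieldType) (V : vectType F) (br : V -> V -> V).
Implicit Types (L U W I H Z : {vspace V}).

Definition lie_bracket : Prop :=
  [/\ forall a x y z, br (a *: x + y) z = a *: br x z + br y z,
      forall a x y z, br z (a *: x + y) = a *: br z x + br z y,
      forall x, br x x = 0
    & forall x y z, br x (br y z) + br y (br z x) + br z (br x y) = 0].

(* By bilinearity, the span of all [x, y] with x in U and y in W. *)
Definition lie_prod U W : {vspace V} :=
  <<[seq br x y | x <- vbasis U, y <- vbasis W]>>%VS.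

Definition lie_ideal I L : Prop := (I <= L)%VS /\ (lie_prod L I <= I)%VS.

Definition lie_solvable L : Prop :=
  exists k, iter k (fun U => lie_prod U U) L = 0%VS.

Definition lie_nilpotent L : Prop := exists k, iter k (lie_prod L) L = 0%VS.

Definition lie_semisimple L : Prop :=
  forall I, lie_ideal I L -> lie_solvable I -> I = 0%VS.

Definition is_lie_center Z L : Prop :=
  forall x, x \in Z <-> (x \in L /\ forall y, y \in L -> br x y = 0).

Definition lie_reductive L : Prop :=
  exists Z, [/\ is_lie_center Z L,
                lie_semisimple (lie_prod L L),
                (lie_prod L L + Z)%VS = L
              & (lie_prod L L :&: Z)%VS = 0%VS].

Definition cartan_subalgebra H L : Prop :=
  [/\ (H <= L)%VS,
      (lie_prod H H <= H)%VS,
      lie_nilpotent H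
    & forall x, x \in L -> (forall y, y \in H -> br x y \in H) -> x \in H].

(* Matrix of f on the span of e, acting on column vectors. *)
Definition mx_in m (e : m.-tuple V) (f : V -> V) : 'M[F]_m :=
  \matrix_(k, j) coord e k (f (tnth e j)).

(* The Cartan subalgebra H of L is split over F if the characteristic
   polynomial of ad_L x has all its roots in F, for every x in H. *)
Definition lie_split L : Prop :=
  exists2 H, cartan_subalgebra H L &
    forall x, x \in H ->
      exists s : seq F,
        char_poly (mx_in (vbasis L) (br x)) = \prod_(a <- s) ('X - a%:P).

End LieAlgebras.

Section MatrixGroups.
Variable (F : fieldType).

Definition matrix_group n (G : set 'M[F]_n) : Prop :=
  [/\ G `<=` [set M | M \in unitmx],
      G 1%:M,
      forall M N, G M -> G N -> G (M *m N)
    & forall M, G M -> G (invmx M)].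

Definition generated_group n (S : set 'M[F]_n) : set 'M[F]_n :=
  [set M | forall H, matrix_group H -> S `<=` H -> H M].

(* The regular functions on GL_k with coefficients in A: polynomials over A
   in the matrix entries and the inverse of the determinant. *)
Inductive regular (A : set F) k : ('M[F]_k -> F) -> Prop :=
| regular_cst c : A c -> regular A (fun=> c)
| regular_entry i j : regular A (fun M => M i j)
| regular_invdet : regular A (fun M => (\det M)^-1)
| regular_add f g : regular A f -> regular A g ->
    regular A (fun M => f M + g M)
| regular_mul f g : regular A f -> regular A g ->
    regular A (fun M => f M * g M).

(* Z is a Zariski closed subset of GL_k defined by equations over A. *)
Definition zariski_closed (A : set F) k (Z : set 'M[F]_k) : Prop :=
  exists2 S : set ('M[F]_k -> F), S `<=` regular A (k := k) &
    Z = [set M | M \in unitmx /\ forall f, S f -> f M = 0].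

Definition zariski_connected k (Z : set 'M[F]_k) : Prop :=
  forall Z1 Z2 : set 'M[F]_k,
    zariski_closed setT Z1 -> zariski_closed setT Z2 ->
    Z `<=` Z1 `|` Z2 -> Z `&` Z1 `&` Z2 = set0 -> Z `<=` Z1 \/ Z `<=` Z2.

(* Defined over A, but connected in the Zariski topology over F. *)
Definition connected_algebraic_group (A : set F) k (G : set 'M[F]_k) : Prop :=
  [/\ matrix_group G, zariski_closed A G & zariski_connected G].

Definition regular_map (A : set F) k n (G : set 'M[F]_k)
    (f : 'M[F]_k -> 'M[F]_n) : Prop :=
  forall i j, exists2 h, regular A h & forall M, G M -> f M i j = h M.

(* f is an isomorphism of algebraic groups G -> H which is defined over A;
   its inverse is only required to be a morphism over F. *)
Definition algebraic_group_iso (A : set F) k n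
    (G : set 'M[F]_k) (H : set 'M[F]_n) (f : 'M[F]_k -> 'M[F]_n) : Prop :=
  [/\ regular_map A G f,
      forall M N, G M -> G N -> f (M *m N) = f M *m f N
    & exists h : 'M[F]_n -> 'M[F]_k,
        [/\ regular_map setT H h,
            forall M, G M -> H (f M) /\ h (f M) = M
          & forall N, H N -> G (h N) /\ f (h N) = N]].

End MatrixGroups.

Section RealAndComplex.
Variable (R : realType).

(* Matrix exponentials, as entrywise limits of the exponential series. *)
Definition mexp n (A : 'M[R]_n) : 'M[R]_n :=
  \matrix_(i, j) limn (series (fun k => (A ^+ k) i j / k`!%:R)).

Definition mexpC n (A : 'M[R[i]]_n) : 'M[R[i]]_n :=
  \matrix_(i, j)
    (limn (series (fun k => complex.Re ((A ^+ k) i j / k`!%:R)))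
     +i* limn (series (fun k => complex.Im ((A ^+ k) i j / k`!%:R)))).

Definition mxC n (A : 'M[R]_n) : 'M[R[i]]_n := map_mx (real_complex R) A.

Definition realC : set R[i] := range (real_complex R).

Definition real_points k (G : set 'M[R[i]]_k) : set 'M[R]_k :=
  [set M | G (mxC M)].

Section Complexification.
Variables (V : vectType R) (br : V -> V -> V) (m : nat) (e : m.-tuple V).

(* If e is a basis of L, then C (x) L is identified with C^m through e and
   its elements are the x + iy with x, y in L; this is the matrix of
   ad (x + iy), the bracket being extended C-bilinearly. *)
Definition adC (x y : V) : 'M[R[i]]_m :=
  mxC (mx_in e (br x)) + 'i *: mxC (mx_in e (br y)).

(* ad (C (x) U) for a real subspace U of L *)
Definition ad_complexified (U : {vspace V}) : set 'M[R[i]]_m :=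
  [set X | exists x y, [/\ x \in U, y \in U & X = adC x y]].

(* The group generated by all exp (ad z), z in C (x) U; for U = L this is
   Int (C (x) L). *)
Definition exp_ad_group (U : {vspace V}) : set 'M[R[i]]_m :=
  generated_group [set mexpC X | X in ad_complexified U].

End Complexification.

(* For G algebraic, this is its Lie algebra. *)
Definition complex_lie_algebra n (G : set 'M[R[i]]_n) : set 'M[R[i]]_n :=
  [set X | forall t : R[i], G (mexpC (t *: X))].

(* f is of class C^r on U (meant for U open, in finite dimension). *)
Fixpoint class_C (r : nat) (V W : normedModType R) (U : set V) (f : V -> W)
    : Prop :=
  if r is r'.+1 then
    (forall x, U x -> differentiable f x) /\
    (forall v, class_C r' U (fun x => 'D_v f x))
  else forall x, U x -> {for x, continuous f}.

(* Smoothness on an arbitrary subset A: local existence of C^oo extensions;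
   for embedded submanifolds this is the intrinsic notion. *)
Definition smooth_on (V W : normedModType R) (A : set V) (f : V -> W) : Prop :=
  forall x, A x -> exists U : set V, exists h : V -> W,
    [/\ open U, U x, forall r, class_C r U h
      & forall y, A y -> U y -> f y = h y].

Definition diffeomorphism (V W : normedModType R) (A : set V) (B : set W)
    (f : V -> W) : Prop :=
  exists h : W -> V,
    [/\ forall x, A x -> B (f x) /\ h (f x) = x,
        forall y, B y -> A (h y) /\ f (h y) = y,
        smooth_on A f
      & smooth_on B h].

(* Closed subgroups of GL_n(R): they are embedded Lie subgroups. *)
Definition closed_linear_group n (G : set 'M[R]_n) : Prop :=
  matrix_group G /\
  exists2 A : set 'M[R]_n, closed A & G = A `&` [set M | M \in unitmx].

(* L is the Lie algebra of the closed linear group G. *)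
Definition is_lie_algebra_of n (G : set 'M[R]_n) (L : {vspace 'M[R]_n})
    : Prop :=
  forall X, X \in L <-> forall t : R, G (mexp (t *: X)).

Definition commutator n (X Y : 'M[R]_n) : 'M[R]_n := X *m Y - Y *m X.

Definition Ad n (g X : 'M[R]_n) : 'M[R]_n := g *m X *m invmx g.

(* Knapp's definition, for closed linear groups G. L is the Lie algebra of G,
   eta an involution of L extended arbitrarily to a linear endomorphism of
   M_n(R), and only the values of B on L matter. *)
Definition reductive_Lie_group n (G : set 'M[R]_n) : Prop :=
  closed_linear_group G /\
  exists (L : {vspace 'M[R]_n}) (K : set 'M[R]_n) (eta : 'End('M[R]_n))
         (B : 'M[R]_n -> 'M[R]_n -> R),
  let kk := (L :&: passmx.leigenspace eta 1)%VS in
  let pp := (L :&: passmx.leigenspace eta (-1))%VS in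
  [/\ is_lie_algebra_of G L,
      [/\ K `<=` G, matrix_group K & compact K],
      [/\ forall X, X \in L -> eta X \in L,
          forall X, X \in L -> eta (eta X) = X
        & forall X Y, X \in L -> Y \in L ->
            eta (commutator X Y) = commutator (eta X) (eta Y)],
      [/\ forall a X Y Z, X \in L -> Y \in L -> Z \in L ->
            B (a *: X + Y) Z = a * B X Z + B Y Z,
          forall X Y, X \in L -> Y \in L -> B X Y = B Y X,
          forall X, X \in L -> (forall Y, Y \in L -> B X Y = 0) -> X = 0,
          forall g X Y, G g -> X \in L -> Y \in L ->
            B (Ad g X) (Ad g Y) = B X Y
        & forall X Y, X \in L -> Y \in L -> B (eta X) (eta Y) = B X Y]
    & [/\ lie_reductive (@commutator n) L,
          [/\ (kk + pp)%VS = L, (kk :&: pp)%VS = 0%VS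
            & is_lie_algebra_of K kk],
          [/\ forall X Y, X \in kk -> Y \in pp -> B X Y = 0,
              forall X, X \in kk -> X != 0 -> B X X < 0
            & forall X, X \in pp -> X != 0 -> 0 < B X X],
          diffeomorphism (K `*` [set mexp X | X in [set Y | Y \in pp]]) G
            (fun u : 'M[R]_n * 'M[R]_n => u.1 *m u.2)
        & forall g, G g ->
            exp_ad_group (@commutator n) (vbasis L) L
              (mxC (mx_in (vbasis L) (Ad g)))]].

End RealAndComplex.

(* Main.v *)
(* Everything rests on a star operation [star S X = S^-1 (S X S^-1)^T S] on
   real matrices for which ad g is stable and phi is orthogonal; its negative
   is the Cartan involution, and no structure theory of g is needed to find it.
   For a simple ideal it comes from a vector of minimal length (Kempf-Ness) in
   the SL_d-orbit of the bracket tensor: at a critical point the derivations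
   are stable under transposition. The metrics on the ideals are then combined,
   and corrected by the square root of phi^* phi to become phi-invariant.

   Polynomials over R commute with complex conjugation, hence G_0 is the group
   of all real points of G_0^c, whatever R^c is. It is star-stable because
   G_0^c is generated by exponentials. If g is in G_0, then
   g^* g = exp(2Y) with Y symmetric, and since all the powers of this element
   lie in the Zariski closed group G_0^c, so does exp(tY) for all t: a regular
   function of exp(tY) is an exponential sum, which vanishes identically if it
   vanishes at the natural numbers. This gives the polar decomposition, which
   is smooth because g |-> sqrt(g^* g) is. *)
Require Import Defs.
From mathcomp Require Import ring lra.
From mathcomp Require Import mxtens.
Set Implicit Arguments.
Unset Strict Implicit.
Unset Printing Implicit Defensive.
Local Open Scope classical_set_scope.
Local Open Scope ring_scope.

(** * Matrices *)

(** Existence of a minimal vector is the obstacle: the orbit is not known to be closed, and a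
    minimising sequence may diverge. Penalised minimisers exist by compactness; were they to escape
    to infinity as the penalty disappears, the limiting direction would be a singular matrix whose
    kernel is an ideal strictly between 0 and the given minimal ideal.

    Making phi orthogonal must not destroy the stability of ad g. The adjoint of phi turns out to be
    an automorphism, so its product M with phi is a positive definite one. Preserving the bracket
    means that the bracket tensor intertwines M with its Kronecker square, and uniqueness of
    positive roots passes this on to the root N of M. Replacing the inner product by <N x, y> then
    alters the adjoints of ad g only by conjugation with an automorphism. Once orthogonal, the
    involution phi is self-adjoint, so star preserves its centraliser, whence the stability of ad
    g_0.

    The invariant form is the trace form tr(XY) in the representation on g, because g_0 may have a
    centre, on which its Killing form vanishes. *)

Section MatrixTopology.
Variable R : realType.

(** The limit lemmas below hold for arbitrary filters; an abstract [F] with its [Filter] hypothesis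
    in the context lets them prove continuity directly. *)
Lemma continuous_filter (U V : topologicalType) (f : U -> V) :
  (forall (F : set_system U) (a : U), Filter F -> F --> a -> f x @[x --> F] --> f a) ->
  continuous f.
Proof. by move=> h a; exact: (h (nbhs a) a (nbhs_filter a)). Qed.

Lemma cvg_mx (T : Type) (F : set_system T) {FF : Filter F} m n
    (f : T -> 'M[R]_(m, n)) (l : 'M[R]_(m, n)) :
  (forall i j, f x i j @[x --> F] --> l i j) -> f x @[x --> F] --> l.
Proof.
move=> fl; apply/cvgrPdist_le => /= e e0.
near=> x.
rewrite /Num.Def.normr/= mx_normrE (bigmax_le _ (ltW e0))//= => i _.
rewrite !mxE/=.
move: i; near: x; apply: filter_forall => /= i.
exact: ((cvgrPdist_le _ _).1 (fl i.1 i.2)).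
Unshelve. all: by end_near. Qed.

Lemma cvg_coord (T : Type) (F : set_system T) {FF : Filter F} m n
    (f : T -> 'M[R]_(m, n)) (l : 'M[R]_(m, n)) i j :
  f x @[x --> F] --> l -> f x i j @[x --> F] --> l i j.
Proof.
move=> fl; apply: (@cvg_comp _ _ _ f (fun M : 'M[R]_(m, n) => M i j) F (nbhs l) _ fl).
exact: coord_continuous.
 Qed.

Lemma cvg_sumr (T : Type) (F : set_system T) {FF : Filter F} (I : Type) (r : seq I)
   (P : pred I) (f : I -> T -> R) (l : I -> R) :
  (forall i, P i -> f i x @[x --> F] --> l i) ->
  \sum_(i <- r | P i) f i x @[x --> F] --> \sum_(i <- r | P i) l i.
Proof. by move=> h; apply: cvg_big => //; exact: add_continuous. Qed.

Lemma cvg_prodr (T : Type) (F : set_system T) {FF : Filter F} (I : Type) (r : seq I)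
   (P : pred I) (f : I -> T -> R) (l : I -> R) :
  (forall i, P i -> f i x @[x --> F] --> l i) ->
  \prod_(i <- r | P i) f i x @[x --> F] --> \prod_(i <- r | P i) l i.
Proof. by move=> h; apply: cvg_big => //; exact: (@mul_continuous R). Qed.

Lemma cvg_mulmx (T : Type) (F : set_system T) {FF : Filter F} m n p
    (f : T -> 'M[R]_(m, n)) (g : T -> 'M[R]_(n, p)) (a : 'M[R]_(m, n)) (b : 'M[R]_(n, p)) :
  f x @[x --> F] --> a -> g x @[x --> F] --> b -> f x *m g x @[x --> F] --> a *m b.
Proof.
move=> fa gb; apply: cvg_mx => i j; rewrite mxE.
under eq_fun do rewrite mxE.
by apply: cvg_sumr => k _; apply: cvgM; apply: cvg_coord.
Qed.

Lemma cvg_trmx (T : Type) (F : set_system T) {FF : Filter F} m n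
    (f : T -> 'M[R]_(m, n)) (a : 'M[R]_(m, n)) :
  f x @[x --> F] --> a -> (f x)^T @[x --> F] --> a^T.
Proof.
move=> fa; apply: cvg_mx => i j; rewrite mxE.
under eq_fun do rewrite mxE.
exact: cvg_coord.
Qed.

Lemma cvg_tens (T : Type) (F : set_system T) {FF : Filter F} m n p q
    (f : T -> 'M[R]_(m, n)) (g : T -> 'M[R]_(p, q)) (a : 'M[R]_(m, n)) (b : 'M[R]_(p, q)) :
  f x @[x --> F] --> a -> g x @[x --> F] --> b -> f x *t g x @[x --> F] --> a *t b.
Proof.
move=> fa gb; apply: cvg_mx => i j; rewrite mxE.
under eq_fun do rewrite mxE.
by apply: cvgM; apply: cvg_coord.
Qed.

Lemma cvg_det (T : Type) (F : set_system T) {FF : Filter F} n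
    (f : T -> 'M[R]_n) (a : 'M[R]_n) :
  f x @[x --> F] --> a -> \det (f x) @[x --> F] --> \det a.
Proof.
move=> fa; rewrite /determinant.
apply: cvg_sumr => s _; apply: cvgM; first exact: cvg_cst.
by apply: cvg_prodr => i _; apply: cvg_coord.
Qed.

Lemma cvg_adj (T : Type) (F : set_system T) {FF : Filter F} n
    (f : T -> 'M[R]_n) (a : 'M[R]_n) :
  f x @[x --> F] --> a -> \adj (f x) @[x --> F] --> \adj a.
Proof.
move=> fa; apply: cvg_mx => i j; rewrite mxE /cofactor.
under eq_fun do rewrite mxE /cofactor.
apply: cvgM; first exact: cvg_cst.
apply: cvg_det; apply: cvg_mx => k l; rewrite !mxE.
by under eq_fun do rewrite !mxE; apply: cvg_coord.
Qed.

(** By convention [invmx] is the identity outside [unitmx], so the formula by determinant and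
    adjugate is available only where the values are eventually invertible. *)
Lemma cvg_invmx (T : Type) (F : set_system T) {FF : Filter F} n
    (f : T -> 'M[R]_n) (a : 'M[R]_n) : a \in unitmx -> (\forall x \near F, f x \in unitmx) ->
  f x @[x --> F] --> a -> invmx (f x) @[x --> F] --> invmx a.
Proof.
move=> ua uf fa; rewrite {2}/invmx ua.
have h : (\det (f x))^-1 *: \adj (f x) @[x --> F] --> (\det a)^-1 *: \adj a.
  apply: cvgZ; last exact: cvg_adj.
  by apply: cvgV; [rewrite -unitfE -unitmxE | exact: cvg_det].
apply: cvg_trans h; apply: near_eq_cvg.
by near=> x; rewrite /invmx (near uf x).
Unshelve. all: by end_near. Qed.

(** Heine-Borel for row vectors, transported through [vec_mx]. *)
Lemma closed_bounded_compact_mx m n (A : set 'M[R]_(m, n)) (C : R) :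
  closed A -> (forall X, A X -> forall i j, `|X i j| <= C) -> compact A.
Proof.
move=> cA bA.
have cv : continuous (@vec_mx R m n).
  move=> v; apply: (@cvg_mx _ (nbhs v)) => i j; rewrite mxE.
  by under eq_fun do rewrite mxE; apply: coord_continuous.
have -> : A = @vec_mx R m n @` (@vec_mx R m n @^-1` A).
  apply/seteqP; split=> [X AX|X [v Av <-]//].
  by exists (mxvec X); rewrite ?/preimage /= mxvecK.
apply: continuous_compact; first exact: continuous_subspaceT.
apply: bounded_closed_compact; last by apply: closed_comp => // x _; exact: cv.
exists (Num.max 0 C); split; rewrite ?num_real// => M CM v /= Av.
rewrite /Num.Def.normr/= mx_normrE bigmax_le//=.
  by apply: le_trans (ltW CM); rewrite le_max lexx.
move=> [i k] _; rewrite ord1; case/mxvec_indexP: k => a b.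
apply: le_trans (ltW CM); rewrite le_max; apply/orP; right.
by have := bA _ Av a b; rewrite mxE.
Qed.

End MatrixTopology.

Section Frobenius.
Variable R : realType.

Definition frob m n (A B : 'M[R]_(m, n)) : R := \tr (A *m B^T).

Lemma frobE m n (A B : 'M[R]_(m, n)) : frob A B = \sum_i \sum_j A i j * B i j.
Proof.
by apply: eq_bigr => i _; rewrite mxE; apply: eq_bigr => j _; rewrite mxE.
Qed.

Lemma frobC m n (A B : 'M[R]_(m, n)) : frob A B = frob B A.
Proof. by rewrite /frob -mxtrace_tr trmx_mul trmxK. Qed.

Lemma frobDl m n (A B C : 'M[R]_(m, n)) : frob (A + B) C = frob A C + frob B C.
Proof. by rewrite /frob mulmxDl mxtraceD. Qed.

Lemma frobDr m n (A B C : 'M[R]_(m, n)) : frob A (B + C) = frob A B + frob A C.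
Proof. by rewrite !(frobC A) frobDl. Qed.

Lemma frobZl m n a (A C : 'M[R]_(m, n)) : frob (a *: A) C = a * frob A C.
Proof. by rewrite /frob -scalemxAl mxtraceZ. Qed.

Lemma frobZr m n a (A C : 'M[R]_(m, n)) : frob A (a *: C) = a * frob A C.
Proof. by rewrite !(frobC A) frobZl. Qed.

Lemma frobNl m n (A C : 'M[R]_(m, n)) : frob (- A) C = - frob A C.
Proof. by rewrite -scaleN1r frobZl mulN1r. Qed.

Lemma frobNr m n (A C : 'M[R]_(m, n)) : frob A (- C) = - frob A C.
Proof. by rewrite !(frobC A) frobNl. Qed.

Lemma frob0l m n (C : 'M[R]_(m, n)) : frob 0 C = 0.
Proof. by rewrite -(scale0r (0 : 'M[R]_(m, n))) frobZl mul0r. Qed.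

Lemma frob0r m n (C : 'M[R]_(m, n)) : frob C 0 = 0.
Proof. by rewrite frobC frob0l. Qed.

Lemma frob_ge0 m n (A : 'M[R]_(m, n)) : 0 <= frob A A.
Proof.
by rewrite frobE; apply: sumr_ge0 => i _; apply: sumr_ge0 => j _; rewrite -expr2 sqr_ge0.
Qed.

Lemma frob_coord m n (A : 'M[R]_(m, n)) i j : A i j ^+ 2 <= frob A A.
Proof.
rewrite frobE (bigD1 i)//= (bigD1 j)//= -expr2 -addrA lerDl addr_ge0//.
  by apply: sumr_ge0 => k _; rewrite -expr2 sqr_ge0.
by apply: sumr_ge0 => k _; apply: sumr_ge0 => l _; rewrite -expr2 sqr_ge0.
Qed.

Lemma frob_eq0 m n (A : 'M[R]_(m, n)) : frob A A = 0 -> A = 0.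
Proof.
move=> A0; apply/matrixP => i j; rewrite mxE; apply/eqP; rewrite -sqrf_eq0.
by rewrite eq_le sqr_ge0 andbT -A0 frob_coord.
Qed.

Lemma frob_gt0 m n (A : 'M[R]_(m, n)) : A != 0 -> 0 < frob A A.
Proof.
by move=> A0; rewrite lt_neqAle frob_ge0 andbT eq_sym; apply: contra_neq A0; exact: frob_eq0.
Qed.

Lemma frob_mull m n p (X : 'M[R]_(m, n)) (A : 'M[R]_(n, p)) B :
  frob (X *m A) B = frob A (X^T *m B).
Proof. by rewrite /frob trmx_mul trmxK -mulmxA mxtrace_mulC mulmxA. Qed.

Lemma frob_mulr m n p (X : 'M[R]_(n, p)) (A : 'M[R]_(m, n)) B :
  frob (A *m X) B = frob A (B *m X^T).
Proof. by rewrite /frob trmx_mul trmxK mulmxA. Qed.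

Lemma frob_tr m n (A B : 'M[R]_(m, n)) : frob A^T B^T = frob A B.
Proof. by rewrite /frob -trmx_mul mxtrace_tr mxtrace_mulC. Qed.

(** With $c = |g|^2$ the quantity $c(ac - b^2)$ is the sum of squares $|cf - bg|^2$; if $c$
    vanishes, so does $g$. *)
Lemma cauchy_schwarz (I : finType) (f g : I -> R) :
  (\sum_i f i * g i) ^+ 2 <= (\sum_i f i ^+ 2) * (\sum_i g i ^+ 2).
Proof.
set a := \sum_i f i ^+ 2; set b := \sum_i f i * g i; set c := \sum_i g i ^+ 2.
have c0 : 0 <= c by apply: sumr_ge0 => i _; exact: sqr_ge0.
have h : 0 <= c * (a * c - b ^+ 2).
  have -> : c * (a * c - b ^+ 2) = \sum_i (c * f i - b * g i) ^+ 2.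
    have E i : (c * f i - b * g i) ^+ 2 =
      c ^+ 2 * f i ^+ 2 + (- (2 * b * c)) * (f i * g i) + b ^+ 2 * g i ^+ 2 by ring.
    by rewrite (eq_bigr _ (fun i _ => E i)) !big_split/= -!mulr_sumr -/a -/b -/c; ring.
  by apply: sumr_ge0 => i _; exact: sqr_ge0.
have [c1|c1] := eqVneq c 0; last first.
  by rewrite -subr_ge0; move: h; rewrite pmulr_rge0// lt_neqAle eq_sym c1.
suff -> : b = 0 by rewrite c1 mulr0 expr0n.
rewrite /b big1// => i _.
suff -> : g i = 0 by rewrite mulr0.
apply/eqP; rewrite -sqrf_eq0; apply: contra_eqT c1 => gi.
rewrite gt_eqF// /c (bigD1 i)//= ltr_pwDl ?lt_neqAle ?[0 == _]eq_sym ?gi ?sqr_ge0//.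
by apply: sumr_ge0 => j _; exact: sqr_ge0.
Qed.

Lemma frob_mulmx_le m n p (A : 'M[R]_(m, n)) (B : 'M[R]_(n, p)) :
  frob (A *m B) (A *m B) <= frob A A * frob B B.
Proof.
rewrite !frobE [X in _ * X]exchange_big/= mulr_suml; apply: ler_sum => i _.
rewrite mulr_sumr; apply: ler_sum => j _.
rewrite -expr2 mxE; apply: le_trans (cauchy_schwarz _ _) _.
by rewrite !(eq_bigr _ (fun _ _ => expr2 _)).
Qed.

Lemma cvg_frob (T : Type) (F : set_system T) {FF : Filter F} m n
    (f g : T -> 'M[R]_(m, n)) (a b : 'M[R]_(m, n)) :
  f x @[x --> F] --> a -> g x @[x --> F] --> b ->
  frob (f x) (g x) @[x --> F] --> frob a b.
Proof.
move=> fa gb; rewrite frobE; under eq_fun do rewrite frobE.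
by apply: cvg_sumr => i _; apply: cvg_sumr => j _; apply: cvgM; apply: cvg_coord.
Qed.

End Frobenius.

Section TensorProduct.
Variable R : comNzRingType.

Lemma tensDl m n p q (M N : 'M[R]_(m, n)) (K : 'M[R]_(p, q)) :
  (M + N) *t K = M *t K + N *t K.
Proof. by apply/matrixP => i j; rewrite !mxE mulrDl. Qed.

Lemma tensDr m n p q (M N : 'M[R]_(m, n)) (K : 'M[R]_(p, q)) :
  K *t (M + N) = K *t M + K *t N.
Proof. by apply/matrixP => i j; rewrite !mxE mulrDr. Qed.

Lemma tensZl m n p q a (M : 'M[R]_(m, n)) (K : 'M[R]_(p, q)) :
  (a *: M) *t K = a *: (M *t K).
Proof. by apply/matrixP => i j; rewrite !mxE mulrA. Qed.

Lemma tensZr m n p q a (M : 'M[R]_(m, n)) (K : 'M[R]_(p, q)) :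
  K *t (a *: M) = a *: (K *t M).
Proof. by apply/matrixP => i j; rewrite !mxE mulrCA. Qed.

Lemma tensBl m n p q (M N : 'M[R]_(m, n)) (K : 'M[R]_(p, q)) :
  (M - N) *t K = M *t K - N *t K.
Proof. by apply/matrixP => i j; rewrite !mxE mulrBl. Qed.

Lemma tensBr m n p q (M N : 'M[R]_(m, n)) (K : 'M[R]_(p, q)) :
  K *t (M - N) = K *t M - K *t N.
Proof. by apply/matrixP => i j; rewrite !mxE mulrBr. Qed.

Lemma tens11 m n : 1%:M *t 1%:M = 1%:M :> 'M[R]_(m * n).
Proof.
apply/matrixP => i j; case: (mxtens_indexP i) => a b; case: (mxtens_indexP j) => k l.
rewrite tensmxE !mxE (can_eq (@mxtens_indexK m n)) xpair_eqE.
by case: eqP; case: eqP => _ _; rewrite ?mulr1n ?mulr0n ?mulr1 ?mulr0.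
Qed.

End TensorProduct.

(** * Minimal vectors and derivations *)

Section MinimalVectors.
Variables (R : realType) (d : nat).
Local Notation T := 'M[R]_(d, d * d).
Implicit Types (A X Y S : 'M[R]_d) (W : T).

(* [W] encodes the bracket [(a, b) |-> W *m kron a b] on R^d. [tact] is the
   action of GL_d on such brackets and [tder] its differential, so that
   [tder X W = 0] means that [X] is a derivation. *)
Definition tact A W : T := A *m W *m (invmx A *t invmx A).

Definition tder X W : T := X *m W - W *m (X *t 1%:M + 1%:M *t X).

Lemma tderD X Y W : tder (X + Y) W = tder X W + tder Y W.
Proof.
rewrite /tder mulmxDl tensDl tensDr addrACA [in LHS]mulmxDr.
by rewrite opprD addrACA.
Qed.

Lemma tderZ a X W : tder (a *: X) W = a *: tder X W.
Proof.
by rewrite /tder tensZl tensZr -scalerDr -scalemxAl -scalemxAr scalerBr.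
Qed.

Lemma frob_tder X W (W' : T) : frob (tder X W) W' = frob W (tder X^T W').
Proof.
rewrite /tder frobDl frobDr frobNl frobNr frob_mull frob_mulr.
by rewrite linearD/= !trmx_tens !trmx1.
Qed.

Lemma tder_comm X Y W :
  tder (X *m Y - Y *m X) W = tder X (tder Y W) - tder Y (tder X W).
Proof.
rewrite /tder.
set TX := _ *t _ + _ *t X; set TY := Y *t _ + _ *t Y.
have -> : (X *m Y - Y *m X) *t 1%:M + 1%:M *t (X *m Y - Y *m X) = TX *m TY - TY *m TX.
  rewrite tensBl tensBr.
  rewrite /TX /TY !mulmxDr !mulmxDl !tensmx_mul !mul1mx !mulmx1.
  move: (_ *t _) (_ *t _) (_ *t _) (_ *t _) (_ *t _) (_ *t _) => a b c e f g.
  by apply/matrixP => i j; rewrite !mxE; ring.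
rewrite !(mulmxBl, mulmxBr) !mulmxA.
move: (_ *m _) (_ *m _) (_ *m _) (_ *m _) (_ *m _) (_ *m _) => a b c e f g.
by apply/matrixP => i j; rewrite !mxE; ring.
Qed.

Lemma tact_tder A X W : A \in unitmx ->
  tder (A *m X *m invmx A) (tact A W) = tact A (tder X W).
Proof.
move=> uA; rewrite /tder /tact.
rewrite mulmxBr mulmxBl; congr (_ - _).
  by rewrite !mulmxA mulmxKV.
rewrite -!mulmxA; congr (_ *m (_ *m _)).
rewrite mulmxDr mulmxDl !tensmx_mul !mul1mx !mulmx1.
by rewrite !mulKmx.
Qed.

Lemma tactM A B W : A \in unitmx -> B \in unitmx ->
  tact (A *m B) W = tact A (tact B W).
Proof.
move=> uA uB; rewrite /tact.
have -> : invmx (A *m B) = invmx B *m invmx A.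
  apply: (can_inj (mulKmx (_ : A *m B \in unitmx))); rewrite ?unitmx_mul ?uA//.
  by rewrite mulmxV ?unitmx_mul ?uA// !mulmxA mulmxK// mulmxV.
by rewrite -tensmx_mul !mulmxA.
Qed.

Lemma tact_eq0 A W : A \in unitmx -> (tact A W == 0) = (W == 0).
Proof.
move=> uA; apply/eqP/eqP => [|->]; last by rewrite /tact mulmx0 mul0mx.
move=> /(congr1 (tact (invmx A))); rewrite -tactM ?unitmx_inv// mulVmx//.
by rewrite {1}/tact mul1mx invmx1 tens11 mulmx1 /tact mulmx0 mul0mx.
Qed.

End MinimalVectors.

(** * Stationarity of the penalised energy on SL_d *)

Section CriticalPoints.
Variables (R : realType) (d : nat).
Local Notation T := 'M[R]_(d, d * d).
Implicit Types (A B X Y S N : 'M[R]_d) (W : T).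

(** Unitriangular block matrices on both sides turn the bordered matrix with diagonal blocks $1 +
    uv$ and 1 into a unitriangular one, without changing the determinant. *)
Lemma det_rank1_update (u : 'cV[R]_d) (v : 'rV[R]_d) :
  v *m u = 0 -> \det (1%:M + u *m v) = 1.
Proof.
move=> vu.
have e : block_mx 1%:M 0 v (1%:M : 'M[R]_1) *m block_mx (1%:M + u *m v) u 0 1%:M
    *m block_mx 1%:M 0 (- v) 1%:M = block_mx 1%:M u 0 1%:M :> 'M[R]_(d + 1)%N.
  rewrite !mulmx_block !(mul0mx, mulmx0, mul1mx, mulmx1, addr0, add0r).
  rewrite mulmxN addrK vu add0r mulmxDr mulmx1 mulmxA vu mul0mx addr0.
  by rewrite mul1mx addrN.
move: (congr1 determinant e).
by rewrite !det_mulmx !det_lblock !det_ublock !det1 !(mul1r, mulr1).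
Qed.

(** This replaces differentiation at a minimum: at $s = -c/K$ with $K > M + |c|$ the linear term
    outweighs the quadratic remainder and the value is negative, unless $c = 0$. *)
Lemma linear_coef_eq0 (c M : R) (q : R -> R) :
  (forall s, 0 <= s * c + s ^+ 2 * q s) ->
  (forall s, `|s| <= 1 -> `|q s| <= M) -> c = 0.
Proof.
move=> h qM; have M0 : 0 <= M by apply: le_trans (qM 0 _); rewrite ?normr0.
set K := M + `|c| + 1; have K0 : 0 < K by rewrite /K ltr_wpDl// addr_ge0.
have sle : `|- (c / K)| <= 1.
  rewrite normrN normrM normfV (gtr0_norm K0) ler_pdivrMr// mul1r /K.
  by rewrite -addrA addrCA lerDl addr_ge0.
have := h (- (c / K)); have := qM _ sle.
set q' := q _ => q1.
have -> : - (c / K) * c + (- (c / K)) ^+ 2 * q' = - (c ^+ 2 * (K - q')) / K ^+ 2.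
  by field; rewrite gt_eqF.
rewrite pmulr_lge0 ?invr_gt0 ?exprn_gt0// oppr_ge0 pmulr_lle0; last first.
  rewrite subr_gt0; apply: le_lt_trans (ler_norm _) _; apply: le_lt_trans q1 _.
  by rewrite /K -addrA ltrDl ltr_wpDl.
by move=> c2; apply/eqP; rewrite -sqrf_eq0 eq_le c2 sqr_ge0.
Qed.

Lemma tact_transvection N W s : N *m N = 0 ->
  tact (1%:M + s *: N) W = W + s *: tder N W
    + s ^+ 2 *: (W *m (N *t N) - N *m W *m (N *t 1%:M + 1%:M *t N))
    + s ^+ 3 *: (N *m W *m (N *t N)).
Proof.
move=> NN.
have iN : (1%:M + s *: N) *m (1%:M - s *: N) = 1%:M.
  rewrite mulmxDl mulmxBr mulmx1 mul1mx -scalemxAl mulmxBr mulmx1 -scalemxAr NN.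
  by rewrite scaler0 subr0 subrK.
have uN : 1%:M + s *: N \in unitmx by case/mulmx1_unit: iN.
have -> : tact (1%:M + s *: N) W =
    (1%:M + s *: N) *m W *m ((1%:M - s *: N) *t (1%:M - s *: N)).
  by rewrite /tact -[in RHS](mulKmx uN (1%:M - s *: N)) iN mulmx1.
rewrite tensBl !tensBr tens11 !tensZl !tensZr /tder.
rewrite mulmxDl mul1mx mulmxDl !mulmxBr !mulmxDr !mulmx1.
have mZr a (C : T) (D : 'M[R]_(d * d)) : C *m (a *: D) = a *: (C *m D).
  by rewrite scalemxAr.
rewrite -!scalemxAl !mZr.
move: (N *m W *m (N *t N)) (N *m W *m (N *t 1%:M)) (N *m W *m (1%:M *t N)) (N *m W).
move: (W *m (N *t N)) (W *m (N *t 1%:M)) (W *m (1%:M *t N)) => a b c e f g h.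
by apply/matrixP => i j; rewrite !mxE; ring.
Qed.

(* The penalty [e * |A|^2] makes the squared length coercive on SL_d. *)
Definition energy (e : R) W A := frob (tact A W) (tact A W) + e * frob A A.

(** Half the derivative at $t = 0$ of the energy of $\exp(tS)A$. *)
Definition variation (e : R) W A S :=
  frob (tder S (tact A W)) (tact A W) + e * frob (S *m A) A.

(* [1 + s N] has determinant 1 and inverse [1 - s N], so that the energy along
   it is a polynomial in [s]. *)
Lemma variation_nilpotent e W A (u : 'cV[R]_d) (v : 'rV[R]_d) :
  \det A = 1 -> (forall B, \det B = 1 -> energy e W A <= energy e W B) ->
  v *m u = 0 -> variation e W A (u *m v) = 0.
Proof.
move=> dA minA vu; set N := u *m v.
have NN : N *m N = 0 by rewrite /N mulmxA -(mulmxA u) vu mulmx0 mul0mx.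
have uA : A \in unitmx by rewrite unitmxE dA unitr1.
have dN s : \det (1%:M + s *: N) = 1.
  by rewrite /N scalemxAl det_rank1_update// -scalemxAr vu scaler0.
set V := tact A W.
set Y := V *m (N *t N) - N *m V *m (N *t 1%:M + 1%:M *t N).
set Z := N *m V *m (N *t N).
set X := tder N V.
(* [q] collects what is of order at least two in $s$; [M] below bounds it for $|s| \le 1$. *)
pose q s := frob X X + 2 * frob V Y + e * frob (N *m A) (N *m A)
  + s * (2 * frob V Z + 2 * frob X Y) + s ^+ 2 * (2 * frob X Z + frob Y Y)
  + s ^+ 3 * (2 * frob Y Z) + s ^+ 4 * frob Z Z.
have h s : 0 <= s * (2 * variation e W A N) + s ^+ 2 * q s.
  have d1 : \det ((1%:M + s *: N) *m A) = 1 by rewrite det_mulmx dN dA mulr1.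
  have := minA _ d1; rewrite -subr_ge0; congr (0 <= _).
  rewrite /energy tactM//; last by rewrite unitmxE dN unitr1.
  rewrite -/V tact_transvection// -/X -/Y -/Z mulmxDl mul1mx -scalemxAl.
  rewrite !frobDl !frobDr !frobZl !frobZr.
  rewrite (frobC X V) (frobC Y V) (frobC Z V) (frobC Y X) (frobC Z X) (frobC Z Y).
  rewrite (frobC A (N *m A)) /q /variation -/V -/X (frobC X V).
  ring.
pose M := `|frob X X + 2 * frob V Y + e * frob (N *m A) (N *m A)|
  + `|2 * frob V Z + 2 * frob X Y| + `|2 * frob X Z + frob Y Y|
  + `|2 * frob Y Z| + `|frob Z Z|.
have b s a k : `|s| <= 1 -> `|s ^+ k * a| <= `|a| :> R.
  by move=> s1; rewrite normrM ler_piMl// normrX exprn_ile1.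
have h1 := @linear_coef_eq0 _ M q h; have : 2 * variation e W A N = 0.
  apply: h1 => s s1; rewrite /q /M.
  do 3 (apply: le_trans (ler_normD _ _) _; apply: lerD; last exact: b).
  apply: le_trans (ler_normD _ _) _; apply: lerD => //.
  by rewrite -[s]expr1; apply: b.
by move/eqP; rewrite mulf_eq0 pnatr_eq0/= => /eqP.
Qed.

(** Square-zero matrices of rank one span the traceless ones: the off-diagonal units are such, and
    $(e_i + e_j)(e_i - e_j)^T$ shows that all diagonal units have the same variation, so that the
    diagonal contributes a multiple of the trace. *)
Lemma variation_traceless e W A : \det A = 1 ->
  (forall B, \det B = 1 -> energy e W A <= energy e W B) ->
  forall S, \tr S = 0 -> variation e W A S = 0.
Proof.
move=> dA minA S trS.
have vD X Y : variation e W A (X + Y) = variation e W A X + variation e W A Y.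
  by rewrite /variation tderD (frobDl (tder X _)) mulmxDl (frobDl (X *m A)); ring.
have vZ a X : variation e W A (a *: X) = a * variation e W A X.
  by rewrite /variation tderZ frobZl -scalemxAl frobZl; ring.
have v0 : variation e W A 0 = 0 by rewrite -(scale0r (0 : 'M[R]_d)) vZ mul0r.
have vs (I : finType) (f : I -> 'M[R]_d) :
    variation e W A (\sum_i f i) = \sum_i variation e W A (f i).
  by elim/big_rec2: _ => [//|i y x _ <-]; rewrite vD.
have vN := variation_nilpotent dA minA.
have vij i j : i != j -> variation e W A (delta_mx i j) = 0.
  move=> ij; rewrite -(mul_delta_mx (0 : 'I_1)); apply: vN.
  by rewrite mul_delta_mx_cond eq_sym (negbTE ij).
have vii i j : variation e W A (delta_mx i i) = variation e W A (delta_mx j j).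
  have [->//|ij] := eqVneq i j.
  have : variation e W A ((delta_mx i (0 : 'I_1) + delta_mx j 0) *m
      (delta_mx 0 i - delta_mx 0 j)) = 0.
    apply: vN; rewrite mulmxDr !mulmxBl !mul_delta_mx_cond !eqxx eq_sym.
    by rewrite (negbTE ij) !mulr0n !mulr1n subr0 sub0r addrN.
  rewrite mulmxDl !mulmxBr !mul_delta_mx -!(scaleN1r (delta_mx _ _)) !vD !vZ.
  rewrite (vij _ _ ij) (vij j i) 1?eq_sym// mulr0 add0r addr0 mulN1r.
  by move/eqP; rewrite subr_eq0 => /eqP.
rewrite (matrix_sum_delta S) vs.
(* For $d = 0$ there is no diagonal unit, and the default 0 serves as the common value. *)
have [c vc] : exists c, forall i, variation e W A (delta_mx i i) = c.
  have [[i0 _]|no] := pselect (exists i : 'I_d, True).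
    by exists (variation e W A (delta_mx i0 i0)).
  by exists 0 => i; case: no; exists i.
rewrite (eq_bigr (fun i => S i i * c)); first by rewrite -mulr_suml [X in X * _]trS mul0r.
move=> i _; rewrite vs (bigD1 i)//= big1 ?addr0 => [|j ji].
  by rewrite vZ vc.
by rewrite vZ vij ?mulr0// eq_sym.
Qed.

End CriticalPoints.

Section KempfNess.
Variables (R : realType) (d : nat).
Local Notation T := 'M[R]_(d, d * d).
Implicit Types (A B X Y S N : 'M[R]_d) (W : T) (v : 'cV[R]_d).

(** If $X$ kills the tensor $V$, then $|X^T V|^2 = \langle [X, X^T] V, V\rangle$. As $[X, X^T]$ is
    traceless, criticality trades this for the penalty term. *)
Lemma frob_tder_tr e W A X :
  (forall S, \tr S = 0 -> variation e W A S = 0) -> tder X (tact A W) = 0 ->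
  frob (tder X^T (tact A W)) (tder X^T (tact A W))
    = e * (frob (X *m A) (X *m A) - frob (X^T *m A) (X^T *m A)).
Proof.
move=> cr X0.
have trS : \tr (X *m X^T - X^T *m X) = 0.
  by rewrite raddfB/= mxtrace_mulC addrN.
have h1 : frob (tder X^T (tact A W)) (tder X^T (tact A W)) =
    frob (tder (X *m X^T - X^T *m X) (tact A W)) (tact A W).
  have t0 : tder X^T 0 = 0 :> T by rewrite /tder mulmx0 mul0mx addrN.
  by rewrite tder_comm X0 t0 subr0 (frob_tder X).
have h2 : frob ((X *m X^T - X^T *m X) *m A) A =
    frob (X^T *m A) (X^T *m A) - frob (X *m A) (X *m A).
  rewrite mulmxBl frobDl frobNl -!mulmxA; congr (_ - _).
    by rewrite (frob_mull X).
  by rewrite (frob_mull X^T) trmxK.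
rewrite h1; have := cr _ trS; rewrite /variation h2 => /eqP.
by rewrite addr_eq0 => /eqP ->; ring.
Qed.

(* A closed and homogeneous condition satisfied by the minimisers for every
   penalty [e > 0]. The kernel of such a [B] is stable under the derivations,
   which for an irreducible bracket bounds the minimisers as [e] tends to 0. *)
Definition kernel_bound W B := forall Y v, tder Y W = 0 ->
  frob ((B *m Y *m v)^T *m B) ((B *m Y *m v)^T *m B)
    <= frob (B *m v) (B *m v) * frob (B *m Y) (B *m Y).

(** With $X = AYA^{-1}$ the identity [frob_tder_tr] gives $|X^T A| \le |XA| = |AY|$, since its left
    side is nonnegative. The bound follows from $(AYv)^T A = (Av)^T X^T A$. *)
Lemma kernel_bound_critical e W A : 0 < e -> A \in unitmx ->
  (forall S, \tr S = 0 -> variation e W A S = 0) -> kernel_bound W A.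
Proof.
move=> e0 uA cr Y v Y0; set X := A *m Y *m invmx A.
have X0 : tder X (tact A W) = 0.
  by rewrite /X tact_tder// Y0 /tact mulmx0 mul0mx.
have := frob_ge0 (tder X^T (tact A W)); rewrite (frob_tder_tr cr X0).
rewrite pmulr_rge0// subr_ge0 => XA.
have XAE : X *m A = A *m Y by rewrite /X mulmxKV.
have -> : (A *m Y *m v)^T *m A = (A *m v)^T *m (X^T *m A).
  by rewrite -XAE -mulmxA trmx_mul !mulmxA.
apply: le_trans (frob_mulmx_le _ _) _; rewrite frob_tr.
by apply: ler_wpM2l; rewrite ?frob_ge0// -XAE.
Qed.

Lemma kernel_boundZ W B a : kernel_bound W B -> kernel_bound W (a *: B).
Proof.
move=> cB Y v Y0.
have -> : (a *: B *m Y *m v)^T *m (a *: B) = (a * a) *: ((B *m Y *m v)^T *m B).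
  by rewrite -scalemxAr -!scalemxAl linearZ/= -scalemxAl scalerA.
rewrite -!scalemxAl !frobZl !frobZr.
have := cB Y v Y0; move: (frob _ _) (frob _ _) (frob _ _) => x y z xy.
have -> : a * a * (a * a * z) = (a ^+ 2) ^+ 2 * z by ring.
have -> : a * (a * y) * (a * (a * x)) = (a ^+ 2) ^+ 2 * (y * x) by ring.
by apply: ler_wpM2l => //; rewrite sqr_ge0.
Qed.

(** When $Bv = 0$ the bound forces $(BYv)^T B = 0$; multiplied by $Yv$, this says that $BYv$ has
    norm 0. *)
Lemma kernel_bound_stable W B Y v : kernel_bound W B -> tder Y W = 0 ->
  B *m v = 0 -> B *m (Y *m v) = 0.
Proof.
move=> cB Y0 Bv; have := cB _ v Y0; rewrite Bv frob0l mul0r => h.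
have /frob_eq0 : frob ((B *m Y *m v)^T *m B) ((B *m Y *m v)^T *m B) = 0.
  by apply/eqP; rewrite eq_le h frob_ge0.
move/(congr1 (fun Z => Z *m (Y *m v))); rewrite mul0mx -!mulmxA.
move/(congr1 mxtrace); rewrite mxtrace0 mulmxA => h0.
by apply: frob_eq0; rewrite /frob mxtrace_mulC; move: h0; rewrite -mulmxA.
Qed.

End KempfNess.

(** * Existence of critical points for irreducible brackets *)

Section CriticalPointExists.
Variables (R : realType) (d : nat) (W : 'M[R]_(d, d * d)).
Implicit Types (A B X Y S N : 'M[R]_d) (v : 'cV[R]_d).
Hypothesis d_gt0 : (0 < d)%N.
Hypothesis irreducible : forall B,
  (forall Y v, tder Y W = 0 -> B *m v = 0 -> B *m (Y *m v) = 0) ->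
  B = 0 \/ B \in unitmx.

(* On matrices of determinant 1 the inverse is the adjugate, which is
   continuous everywhere. *)
Let energy' e A := frob (A *m W *m (\adj A *t \adj A)) (A *m W *m (\adj A *t \adj A))
  + e * frob A A.

Let energy'E e A : \det A = 1 -> energy' e A = energy e W A.
Proof.
move=> dA; rewrite /energy' (_ : \adj A = invmx A)//.
by rewrite /invmx unitmxE dA unitr1 invr1 scale1r.
Qed.

Let det_cont : continuous (fun A : 'M[R]_d => \det A).
Proof. by apply: continuous_filter => F A FF FA; exact: cvg_det. Qed.

Let frob_cont : continuous (fun A : 'M[R]_d => frob A A).
Proof. by apply: continuous_filter => F A FF FA; exact: cvg_frob. Qed.

Let energy'_cont e : continuous (energy' e).
Proof.
apply: continuous_filter => F A FF FA.
have c1 : X *m W *m (\adj X *t \adj X) @[X --> F] --> A *m W *m (\adj A *t \adj A).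
  apply: cvg_mulmx; first by apply: cvg_mulmx => //; exact: cvg_cst.
  by apply: cvg_tens; apply: cvg_adj.
apply: cvgD; first exact: cvg_frob.
by apply: cvgM; [exact: cvg_cst | exact: cvg_frob].
Qed.

Let slball r := [set A : 'M[R]_d | \det A = 1 /\ frob A A <= r].

Let slball_compact (r : R) : compact (slball r).
Proof.
apply: (@closed_bounded_compact_mx _ _ _ _ (1 + r)).
  have -> : slball r = (fun A => \det A) @^-1` [set 1] `&` (fun A => frob A A) @^-1` [set x | x <= r].
    by apply/seteqP; split.
  apply: closedI; apply: closed_comp.
  - by move=> A _; apply: det_cont.
  - exact: closed_eq.
  - by move=> A _; apply: frob_cont.
  - exact: closed_le.
move=> A [_ Ar] i j; have h := le_trans (frob_coord A i j) Ar.
have [|l] := leP `|A i j| 1.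
  by move/le_trans; apply; rewrite lerDl (le_trans _ h)// sqr_ge0.
apply: le_trans (_ : A i j ^+ 2 <= _).
  by rewrite -real_normK ?num_real// expr2 ler_peMr// ltW.
by apply: le_trans h _; rewrite lerDr.
Qed.

Let minimizer_slball e r : (slball r) !=set0 ->
  exists2 A, slball r A & forall B, slball r B -> energy e W A <= energy e W B.
Proof.
move=> ne.
have [A] := compact_EVT_min ne (@slball_compact r) (continuous_subspaceT (@energy'_cont e)).
rewrite inE => Ar minA; exists A => // B Br.
by rewrite -!energy'E ?(proj1 Ar) ?(proj1 Br)//; apply: minA; rewrite inE.
Qed.

Let slball1 r : frob (1%:M : 'M[R]_d) 1%:M <= r -> slball r !=set0.
Proof. by move=> h; exists 1%:M; split; rewrite ?det1. Qed.

Let minimizer e : 0 < e -> exists2 A, \det A = 1 &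
  forall B, \det B = 1 -> energy e W A <= energy e W B.
Proof.
(* A squared radius: outside this ball the penalty alone exceeds the energy of the identity. *)
move=> e0; set r := energy e W 1%:M / e.
have r1 : frob (1%:M : 'M[R]_d) 1%:M <= r.
  by rewrite /r ler_pdivlMr// /energy mulrC lerDr frob_ge0.
have [A Ar minA] := minimizer_slball e (slball1 r1).
exists A => [|B dB]; first exact: (proj1 Ar).
have [Br|Br] := leP (frob B B) r; first exact: minA.
apply: le_trans (minA 1%:M _) _; first by split; rewrite ?det1.
apply: le_trans (_ : e * frob B B <= _); last by rewrite /energy lerDr frob_ge0.
by rewrite mulrC -ler_pdivrMr// ltW.
Qed.

Let bounded_set_C := [set B | frob B B = 1 /\ kernel_bound W B].

Let C_compact : compact bounded_set_C.
Proof.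
apply: (@closed_bounded_compact_mx _ _ _ _ 1).
  have -> : bounded_set_C = (fun A => frob A A) @^-1` [set 1] `&`
      \bigcap_(p in [set p : 'M[R]_d * 'cV[R]_d | tder p.1 W = 0])
        (fun B => frob (B *m p.2) (B *m p.2) * frob (B *m p.1) (B *m p.1)
          - frob ((B *m p.1 *m p.2)^T *m B) ((B *m p.1 *m p.2)^T *m B)) @^-1` [set x | 0 <= x].
    apply/seteqP; split=> B.
      by case=> B1 cB; split => // -[Y v] Y0 /=; rewrite subr_ge0; apply: cB.
    case=> B1 cB; split => // Y v Y0; have := cB (Y, v) Y0.
    by rewrite /= subr_ge0.
  apply: closedI.
    apply: closed_comp; last exact: closed_eq.
    by move=> A _; apply: frob_cont.
  apply: closed_bigI => -[Y v] _; apply: closed_comp; last exact: closed_ge.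
  move=> C _; move: C; apply: continuous_filter => F B FF FB.
  have c1 p (Z : 'M[R]_(d, p)) : X *m Z @[X --> F] --> B *m Z.
    by apply: cvg_mulmx => //; exact: cvg_cst.
  have c2 : (X *m Y *m v)^T *m X @[X --> F] --> (B *m Y *m v)^T *m B.
    by apply: cvg_mulmx => //; apply: cvg_trmx; apply: cvg_mulmx => //; exact: cvg_cst.
  by apply: cvgB; [apply: cvgM|]; exact: cvg_frob.
move=> B [B1 _] i j; rewrite -(@ler_pXn2r _ 2)// ?nnegrE// expr1n.
by rewrite real_normK ?num_real// -B1 frob_coord.
Qed.

(** The compact set consists of unit vectors satisfying the kernel bound. Irreducibility leaves only
    0 and invertible matrices, and 0 has the wrong norm, so $|\det|$ has a positive minimum; when
    the set is empty, 1 is taken instead. *)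
Let det_lower_bound : exists2 delta, 0 < delta &
  forall B, bounded_set_C B -> delta <= `|\det B|.
Proof.
have [ne|em] := pselect (bounded_set_C !=set0); last first.
  by exists 1 => // B CB; case: em; exists B.
have cd : continuous (fun B : 'M[R]_d => `|\det B|).
  by apply: continuous_filter => F B FF FB; apply: cvg_norm; exact: cvg_det.
have [B] := compact_EVT_min ne (@C_compact) (continuous_subspaceT cd).
rewrite inE => -[B1 cB] minB; exists `|\det B|; last first.
  by move=> A CA; apply: minB; rewrite inE.
have [Y v Y0 Bv|B0|] := @irreducible B; first by apply: (kernel_bound_stable (W := W)).
  by move: B1; rewrite B0 frob0l => /eqP; rewrite eq_sym oner_eq0.
by rewrite unitmxE unitfE normr_gt0.
Qed.

(** A penalised minimiser of norm $t$ and determinant 1, divided by $t$, has determinant $t^{-d}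
    \ge$ [delta]. As $d > 0$, this confines all of them to one ball, whatever the penalty. The
    minimum of the bare energy over that ball is then global, by letting the penalty tend to 0. *)
Lemma critical_point_exists : exists2 A, A \in unitmx &
  forall S, \tr S = 0 -> variation 0 W A S = 0.
Proof.
have [delta delta0 hdelta] := det_lower_bound.
(* The first summand bounds the minimisers of norm above 1; the second is at least 1 and puts the
   identity into the ball. *)
set r := delta^-1 ^+ 2 + frob (1%:M : 'M[R]_d) 1%:M.
have bnd e A : 0 < e -> \det A = 1 ->
    (forall B, \det B = 1 -> energy e W A <= energy e W B) -> frob A A <= r.
  move=> e0 dA minA; have uA : A \in unitmx by rewrite unitmxE dA unitr1.
  have A0 : A != 0.
    apply: contra_eq_neq dA => ->; rewrite -(scale0r (0 : 'M[R]_d)) detZ.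
    by rewrite expr0n eqn0Ngt d_gt0 mul0r eq_sym oner_eq0.
  set t := Num.sqrt (frob A A).
  have t0 : 0 < t by rewrite sqrtr_gt0 frob_gt0.
  have t2 : t ^+ 2 = frob A A by rewrite sqr_sqrtr// frob_ge0.
  have CA : bounded_set_C (t^-1 *: A).
    split; first by rewrite frobZl frobZr mulrA -expr2 -t2 -exprMn mulVf ?gt_eqF// expr1n.
    apply: kernel_boundZ; apply: (kernel_bound_critical e0 uA) => S trS.
    exact: (variation_traceless dA minA).
  have := hdelta _ CA; rewrite detZ dA mulr1 normrX ger0_norm ?invr_ge0 ?(ltW t0)//.
  move=> h; have [t1|t1] := leP t 1.
    rewrite /r -t2; apply: le_trans (_ : 1 <= _); first by rewrite exprn_ile1// ltW.
    have [j _] : exists j : 'I_d, True by exists (Ordinal d_gt0).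
    apply: le_trans (_ : 0 + (1%:M : 'M[R]_d) j j ^+ 2 <= _).
      by rewrite mxE eqxx expr1n add0r.
    by apply: lerD; [exact: sqr_ge0 | exact: frob_coord].
  rewrite /r -t2; apply: ler_wpDr; first exact: frob_ge0.
  have ti : t <= delta^-1.
    rewrite -[t]invrK lef_pV2 ?posrE ?invr_gt0//; apply: le_trans h _.
    by rewrite -[leRHS]expr1 ler_wiXn2l ?invr_ge0 ?invf_le1 1?ltW.
  by rewrite lerXn2r ?nnegrE ?invr_ge0// ltW.
have [A [dA _] minA] := minimizer_slball 0 (@slball1 r (ler_wpDl (sqr_ge0 _) (lexx _))).
exists A; first by rewrite unitmxE dA unitr1.
apply: variation_traceless => // B dB.
apply/ler_addgt0Pr => e e0.
(* Small enough for the penalty to cost at most [e] at the competitor [B]. *)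
set e' := e / (1 + frob B B).
have fB : 0 < 1 + frob B B by rewrite ltr_wpDr// frob_ge0.
have e'0 : 0 < e' by rewrite divr_gt0.
have [A' dA' minA'] := minimizer e'0.
apply: le_trans (minA A' _) _; first by split => //; exact: bnd minA'.
apply: le_trans (_ : energy e' W A' <= _).
  by rewrite /energy mul0r addr0 lerDl mulr_ge0 ?frob_ge0// ltW.
apply: le_trans (minA' _ dB) _.
rewrite /energy mul0r addr0 lerD2l /e' mulrAC ler_pdivrMr//.
by rewrite ler_wpM2l// ?ltW// ltr_pwDl.
Qed.

(** Without penalty, [frob_tder_tr] says that transposition preserves the derivations of the
    critical tensor; conjugation by [A] carries this back to [W]. *)
Lemma derivations_self_adjoint : exists2 A, A \in unitmx &
  forall X, tder X W = 0 -> tder (invmx A *m (A *m X *m invmx A)^T *m A) W = 0.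
Proof.
have [A uA cA] := critical_point_exists; exists A => // X X0.
set Y := A *m X *m invmx A.
have Y0 : tder Y (tact A W) = 0 by rewrite tact_tder// X0 /tact mulmx0 mul0mx.
have := frob_tder_tr cA Y0; rewrite mul0r => /frob_eq0 h; apply/eqP.
rewrite -(tact_eq0 _ uA) -tact_tder// !mulmxA mulmxV// mul1mx mulmxK//.
by rewrite h eqxx.
Qed.

End CriticalPointExists.

(** * Derivations of a bracket with a self-adjoint derivation algebra are inner *)

Section AdjointDerivations.
Variable R : realType.

(** The condition on [u] makes the Gram matrix of [f] invertible, and the coefficients of the
    projection solve the normal equations. *)
Lemma orthogonal_projection (V : lmodType R) d (f : 'I_d -> V) (q : V -> V -> R) :
  (forall a x y z, q (a *: x + y) z = a * q x z + q y z) ->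
  (forall a x y z, q z (a *: x + y) = a * q z x + q z y) ->
  (forall u : 'rV_d, q (\sum_i u 0 i *: f i) (\sum_i u 0 i *: f i) = 0 -> u = 0) ->
  forall x, exists u : 'rV[R]_d, forall j, q (x - \sum_i u 0 i *: f i) (f j) = 0.
Proof.
move=> ql qr q0 x.
have q0l z : q 0 z = 0 by have := ql (-1) 0 0 z; rewrite scaler0 addr0 mulN1r addNr.
have q0r z : q z 0 = 0 by have := qr (-1) 0 0 z; rewrite scaler0 addr0 mulN1r addNr.
have qZl a y z : q (a *: y) z = a * q y z by rewrite -[a *: y]addr0 ql q0l addr0.
have qZr a y z : q z (a *: y) = a * q z y by rewrite -[a *: y]addr0 qr q0r addr0.
have qDl y z w : q (y + z) w = q y w + q z w by rewrite -[y]scale1r ql mul1r scale1r.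
have qDr y z w : q w (y + z) = q w y + q w z by rewrite -[y]scale1r qr mul1r scale1r.
have qsl (I : finType) (F : I -> V) z : q (\sum_i F i) z = \sum_i q (F i) z.
  by elim/big_rec2: _ => // i a b _ <-; rewrite qDl.
have qsr (I : finType) (F : I -> V) z : q z (\sum_i F i) = \sum_i q z (F i).
  by elim/big_rec2: _ => // i a b _ <-; rewrite qDr.
pose G := \matrix_(i, j) q (f i) (f j).
have uG : G \in unitmx.
  rewrite -row_free_unit -kermx_eq0; apply/rowV0P => u /sub_kermxP uG.
  apply: q0; rewrite qsr big1// => j _; rewrite qZr qsl.
  rewrite (eq_bigr (fun i => u 0 i * G i j)) => [|i _]; last by rewrite qZl mxE.
  by have := congr1 (fun M : 'rV_d => M 0 j) uG; rewrite !mxE => ->; rewrite mulr0.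
pose r := \row_j q x (f j).
exists (r *m invmx G) => j.
rewrite qDl -scaleN1r qZl qsl mulN1r.
rewrite (eq_bigr (fun i => (r *m invmx G) 0 i * G i j)) => [|i _]; last by rewrite qZl [G i j]mxE.
have := congr1 (fun M : 'rV_d => M 0 j) (mulmxKV uG r).
by rewrite [in LHS]mxE => ->; rewrite mxE subrr.
Qed.

Variables (d : nat) (W : 'M[R]_(d, d * d)).
Implicit Types (a b : 'cV[R]_d) (X Y : 'M[R]_d).

Definition brmx a b : 'cV[R]_d :=
  \col_k \sum_i \sum_j W k (mxtens_index (i, j)) * a i 0 * b j 0.

Definition admx a : 'M[R]_d :=
  \matrix_(k, j) \sum_i W k (mxtens_index (i, j)) * a i 0.

Lemma mul_admx a b : admx a *m b = brmx a b.
Proof.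
apply/matrixP => k l; rewrite ord1 !mxE exchange_big/=; apply: eq_bigr => j _.
by rewrite mxE mulr_suml.
Qed.

Lemma admxD x a b : admx (x *: a + b) = x *: admx a + admx b.
Proof.
apply/matrixP => k l; rewrite !mxE mulr_sumr -big_split/=; apply: eq_bigr => i _.
by rewrite !mxE mulrDr mulrCA.
Qed.

Definition kron (a b : 'cV[R]_d) : 'cV[R]_(d * d) :=
  \col_p (a (mxtens_unindex p).1 0 * b (mxtens_unindex p).2 0).

Lemma sum_mxtens (F : 'I_(d * d) -> R) :
  \sum_p F p = \sum_i \sum_j F (mxtens_index (i, j)).
Proof.
rewrite pair_big/= (reindex (@mxtens_index d d))/=; last first.
  by exists (@mxtens_unindex d d) => p _; rewrite ?mxtens_indexK ?mxtens_unindexK.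
by apply: eq_bigr => -[].
Qed.

Lemma mul_kron a b : W *m kron a b = brmx a b.
Proof.
apply/matrixP => k l; rewrite ord1 !mxE sum_mxtens; apply: eq_bigr => i _.
by apply: eq_bigr => j _; rewrite mxE mxtens_indexK/= mulrA.
Qed.

Lemma tens_kron X Y a b : (X *t Y) *m kron a b = kron (X *m a) (Y *m b).
Proof.
apply/matrixP => p l; rewrite ord1; case: (mxtens_indexP p) => i j.
rewrite !mxE sum_mxtens mxtens_indexK/= big_distrlr/=; apply: eq_bigr => u _.
by apply: eq_bigr => v _; rewrite tensmxE mxE mxtens_indexK/= mulrACA.
Qed.

Lemma kron_ext (X Y : 'M[R]_(d, d * d)) :
  (forall a b, X *m kron a b = Y *m kron a b) -> X = Y.
Proof.
move=> h; apply/matrixP => k p; case: (mxtens_indexP p) => i j.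
have e : kron (delta_mx i 0) (delta_mx j 0) = delta_mx (mxtens_index (i, j)) 0.
  apply/matrixP => q l; rewrite ord1 !mxE; case: (mxtens_indexP q) => u v.
  rewrite mxtens_indexK/= !andbT (can_eq (@mxtens_indexK d d)) xpair_eqE.
  by case: eqP; case: eqP => _ _; rewrite ?mulr1n ?mulr0n ?mulr1 ?mulr0.
have := congr1 (fun M : 'cV_d => M k 0) (h (delta_mx i 0) (delta_mx j 0)).
by rewrite e -!colE !mxE.
Qed.

Lemma tder_eq0P X : tder X W = 0 <->
  forall a b, X *m brmx a b = brmx (X *m a) b + brmx a (X *m b).
Proof.
have E a b : tder X W *m kron a b = X *m brmx a b - (brmx (X *m a) b + brmx a (X *m b)).
  rewrite /tder mulmxBl -!mulmxA mulmxDl !tens_kron !mul1mx mulmxDr.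
  by rewrite !mul_kron.
split=> [X0 a b|h].
  by apply/eqP; rewrite -subr_eq0 -E X0 mul0mx.
by apply: kron_ext => a b; rewrite E h subrr mul0mx.
Qed.

Lemma bracket_automorphismP X : X *m W = W *m (X *t X) <->
  forall a b, X *m brmx a b = brmx (X *m a) (X *m b).
Proof.
split=> [XW a b|h]; first by rewrite -!mul_kron -tens_kron !mulmxA XW.
by apply: kron_ext => a b; rewrite -!mulmxA tens_kron !mul_kron.
Qed.

Lemma commutator_admx X a : tder X W = 0 ->
  X *m admx a - admx a *m X = admx (X *m a).
Proof.
move/tder_eq0P => X0; apply/matrixP => i j.
have E Y Z : (forall b, Y *m b = Z *m b) -> Y = Z.
  move=> h; apply/matrixP => k l.
  by have := congr1 (fun M : 'cV_d => M k 0) (h (delta_mx l 0)); rewrite -!colE !mxE.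
congr (fun_of_matrix _ i j); apply: E => b.
rewrite mulmxBl -!mulmxA !mul_admx X0; by rewrite addrK.
Qed.

(** Let $C$ be the part of $X$ orthogonal to the inner derivations and put $b = Ca$, so that
    $\mathrm{ad}(b) = [C, \mathrm{ad}(a)]$. With $Y$ the adjoint of $\mathrm{ad}(a)$, its squared
    norm is $\langle C, [\mathrm{ad}(b), Y]\rangle$. Since $Y$ is a derivation, the second entry is
    inner and the product is 0; hence $Ca = 0$ for all $a$. *)
Lemma derivation_inner (A : 'M[R]_d) : A \in unitmx ->
  (forall X, tder X W = 0 -> tder (invmx A *m (A *m X *m invmx A)^T *m A) W = 0) ->
  (forall a, tder (admx a) W = 0) ->
  (forall a, admx a = 0 -> a = 0) ->
  forall X, tder X W = 0 -> exists a, X = admx a.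
Proof.
move=> uA adjD adD ad0 X X0.
pose c (Y : 'M[R]_d) := A *m Y *m invmx A.
have cM Y Z : c (Y *m Z) = c Y *m c Z.
  by rewrite /c !mulmxA mulmxKV.
have cD x Y Z : c (x *: Y + Z) = x *: c Y + c Z.
  by rewrite /c mulmxDr mulmxDl -scalemxAr -scalemxAl.
pose q Y Z := frob (c Y) (c Z).
have ql t x y z : q (t *: x + y) z = t * q x z + q y z.
  by rewrite /q cD frobDl frobZl.
have qr t x y z : q z (t *: x + y) = t * q z x + q z y.
  by rewrite /q cD frobDr frobZr.
have c0 Y : c Y = 0 -> Y = 0.
  move=> cY; have : invmx A *m c Y *m A = 0 by rewrite cY mulmx0 mul0mx.
  by rewrite /c !mulmxA mulVmx// mul1mx mulmxKV.
have ads (u : 'rV[R]_d) : \sum_i u 0 i *: admx (delta_mx i 0) = admx u^T.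
  have -> : u^T = \sum_i u 0 i *: delta_mx i 0.
    by rewrite {1}[u]row_sum_delta linear_sum/=; apply: eq_bigr => i _; rewrite linearZ/= trmx_delta.
  have ad00 : admx 0 = 0 by apply/matrixP => k l; rewrite !mxE big1// => i _; rewrite mxE mulr0.
  by elim/big_rec2: _ => [//|i x y _ ->]; rewrite admxD.
have [|u hu] := orthogonal_projection (f := fun i => admx (delta_mx i 0)) ql qr _ X.
  move=> u; rewrite ads => /frob_eq0/c0/ad0 /(congr1 trmx).
  by rewrite trmxK trmx0.
exists u^T; move: hu; rewrite ads; set C := X - _ => hu.
have C0 : tder C W = 0 by rewrite /C -scaleN1r tderD tderZ X0 adD scaler0 addr0.
have qC a : q C (admx a) = 0.
  have -> : a = a^T^T by rewrite trmxK.
  have q0 Z : q Z 0 = 0 by rewrite /q /c mulmx0 mul0mx frob0r.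
  rewrite -ads; elim/big_rec: _ => [//|i y _ h].
  by rewrite qr hu h mulr0 addr0.
suff : C = 0 by move/eqP; rewrite subr_eq0 => /eqP.
(* The orthogonal complement of [ad] is an ideal of the derivation algebra, so
   it commutes with [ad]. *)
have adC a : admx (C *m a) = 0.
  have Zb : admx (C *m a) = C *m admx a - admx a *m C by rewrite commutator_admx.
  move: (C *m a) Zb => b Zb; apply: c0; apply: frob_eq0; rewrite -/(q _ _).
  move: (adjD _ (adD a)); rewrite -/(c (admx a)).
  set Y := invmx A *m (c (admx a))^T *m A => Y0.
  have cY : c Y = (c (admx a))^T by rewrite {1}/c /Y !mulmxA mulmxV// mul1mx mulmxK.
  clearbody Y.
  have -> : q (admx b) (admx b) = q C (admx b *m Y - Y *m admx b).
    have cB U V : c (U - V) = c U - c V.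
      by rewrite -scaleN1r addrC cD scaleN1r addrC.
    rewrite {1}/q {1}Zb /q; move: (admx b) => B.
    rewrite (cB (C *m _)) (cB (B *m Y)) !cM cY.
    rewrite (frobDl (c C *m _)) (frobDr (c C)) frobNl frobNr.
    by rewrite (frob_mulr (c (admx a))) (frob_mull (c (admx a))).
  rewrite -opprB commutator_admx//.
  have qN U V : q U (- V) = - q U V by rewrite /q /c mulmxN mulNmx frobNr.
  by rewrite qN qC oppr0.
apply/matrixP => i j; rewrite [RHS]mxE.
have := ad0 _ (adC (delta_mx j 0)).
by move/(congr1 (fun M : 'cV_d => M i 0)); rewrite -colE !mxE.
Qed.

End AdjointDerivations.

(** * Invariant metrics on semisimple Lie algebras *)

Section SemisimpleMetric.
Variables (R : realType) (g : vectType R) (br : g -> g -> g).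
Hypothesis hbr : lie_bracket br.
Implicit Types (x y z : g) (U I J : {vspace g}).

Lemma brPl a x y z : br (a *: x + y) z = a *: br x z + br y z.
Proof. by case: hbr => + _ _ _; apply. Qed.

Lemma brPr a x y z : br z (a *: x + y) = a *: br z x + br z y.
Proof. by case: hbr => _ + _ _; apply. Qed.

Lemma br0l z : br 0 z = 0.
Proof. by have := brPl (-1) 0 0 z; rewrite scaler0 addr0 scaleN1r addNr. Qed.

Lemma br0r z : br z 0 = 0.
Proof. by have := brPr (-1) 0 0 z; rewrite scaler0 addr0 scaleN1r addNr. Qed.

Lemma brDl x y z : br (x + y) z = br x z + br y z.
Proof. by rewrite -[x]scale1r brPl !scale1r. Qed.

Lemma brDr x y z : br z (x + y) = br z x + br z y.
Proof. by rewrite -[x]scale1r brPr !scale1r. Qed.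

Lemma brZl a x z : br (a *: x) z = a *: br x z.
Proof. by rewrite -[a *: x]addr0 brPl br0l addr0. Qed.

Lemma brZr a x z : br z (a *: x) = a *: br z x.
Proof. by rewrite -[a *: x]addr0 brPr br0r addr0. Qed.

Lemma brNl x z : br (- x) z = - br x z.
Proof. by rewrite -scaleN1r brZl scaleN1r. Qed.

Lemma brNr x z : br z (- x) = - br z x.
Proof. by rewrite -scaleN1r brZr scaleN1r. Qed.

Lemma brC x y : br x y = - br y x.
Proof.
case: hbr => _ _ a _; have := a (x + y); rewrite brDl !brDr !a add0r addr0.
by move/eqP; rewrite addr_eq0 => /eqP.
Qed.

Lemma br_sumr (K : finType) (F : K -> g) z : br z (\sum_i F i) = \sum_i br z (F i).
Proof. by elim/big_rec2: _ => [|i a b _ <-]; rewrite ?br0r ?brDr. Qed.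

Lemma br_suml (K : finType) (F : K -> g) z : br (\sum_i F i) z = \sum_i br (F i) z.
Proof. by elim/big_rec2: _ => [|i a b _ <-]; rewrite ?br0l ?brDl. Qed.

Lemma br_jacobi x y z : br x (br y z) = br (br x y) z + br y (br x z).
Proof.
case: hbr => _ _ _ j; have := j x y z.
rewrite (brC z (br x y)) (brC z x) -[- br x z]scaleN1r brZr scaleN1r.
by move/eqP; rewrite subr_eq0 subr_eq => /eqP.
Qed.

Lemma mem_lie_prod U J x y : x \in U -> y \in J -> br x y \in lie_prod br U J.
Proof.
move=> xU yJ; rewrite (coord_vbasis xU) (coord_vbasis yJ) br_suml.
apply: memv_suml => i _; rewrite brZl; apply: memvZ; rewrite br_sumr.
apply: memv_suml => j _; rewrite brZr; apply: memvZ; apply: memv_span.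
by apply/allpairsP; exists ((vbasis U)`_i, (vbasis J)`_j); split => //=; apply: mem_nth; rewrite size_tuple.
Qed.

Lemma lie_prod_subP U J I : reflect (forall x y, x \in U -> y \in J -> br x y \in I)
  (lie_prod br U J <= I)%VS.
Proof.
apply: (iffP idP) => [s x y xU yJ|h].
  by apply: (subvP s); apply: mem_lie_prod.
apply/span_subvP => _ /allpairsP[[x y] /= [xU yJ ->]].
by apply: h; exact: vbasis_mem.
Qed.

(** Among the subspaces contained in [P], one of maximal dimension is everything: adding the line of
    a missing vector would enlarge it. *)
Lemma vspace_of_pred (P : g -> Prop) : P 0 ->
  (forall a x y, P x -> P y -> P (a *: x + y)) ->
  exists S : {vspace g}, forall x, x \in S <-> P x.
Proof.
move=> P0 PD.
pose Q k := `[< exists S : {vspace g}, (forall x, x \in S -> P x) /\ \dim S = k >].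
have exQ : exists k, Q k.
  exists 0%N; apply/asboolP; exists 0%VS; split; last exact: dimv0.
  by move=> x; rewrite memv0 => /eqP ->.
have ubQ k : Q k -> (k <= \dim {: g})%N.
  by move/asboolP => [S [_ <-]]; apply: dimvS; exact: subvf.
case: (ex_maxnP exQ ubQ) => k /asboolP[S [SP dS]] kmax.
exists S => x; split => [|Px]; first exact: SP.
have : Q (\dim (S + <[x]>)).
  apply/asboolP; exists (S + <[x]>)%VS; split => // _ /memv_addP[u uS [_ /vlineP[a ->] ->]].
  by rewrite addrC; apply: PD => //; exact: SP.
move/kmax; rewrite -dS => h.
have e : (S == S + <[x]>)%VS by rewrite eqEdim addvSl h.
by have := memv_add (mem0v S) (memv_line x); rewrite add0r -(eqP e).
Qed.

Definition ideal I := forall x y, y \in I -> br x y \in I.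

(** [b] is bilinear on all of g but definite only on [U]. The adjoint on [U] of each ad x, with [x]
    arbitrary in g, has to come from an element of [U]. *)
Definition adjoint_metric U (b : g -> g -> R) :=
  [/\ forall a x y z, b (a *: x + y) z = a * b x z + b y z,
      forall x y, b x y = b y x,
      forall x, x \in U -> x != 0 -> 0 < b x x
    & forall x, exists2 x', x' \in U &
        forall y z, y \in U -> z \in U -> b (br x y) z = b y (br x' z)].

(** Every ad x restricts to a derivation of [I], so a subspace of [I] stable under the derivations
    is an ideal of g. Minimality thus makes the structure tensor of [I] irreducible, and the
    critical point [A] supplies the metric. The second conclusion is what allows [I] to be split
    off. *)
Lemma minimal_ideal_metric I : ideal I -> I != 0%VS ->
  (forall J, ideal J -> (J <= I)%VS -> J = 0%VS \/ J = I) ->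
  (forall x, x \in I -> (forall y, y \in I -> br x y = 0) -> x = 0) ->
  (exists b, adjoint_metric I b) /\
  (forall x, exists2 i, i \in I & forall y, y \in I -> br x y = br i y).
Proof.
move=> idI I0 minI cfI.
set X := vbasis I; set d := \dim I.
pose c x : 'cV[R]_d := \col_k coord X k x.
pose dec (a : 'cV[R]_d) := \sum_k a k 0 *: X`_k.
pose W : 'M[R]_(d, d * d) := \matrix_(k, p)
  coord X k (br X`_(mxtens_unindex p).1 X`_(mxtens_unindex p).2).
pose M x : 'M[R]_d := \matrix_(k, j) coord X k (br x X`_j).
have XI (k : 'I_d) : X`_k \in I by apply: vbasis_mem; apply: mem_nth; rewrite size_tuple.
have decI a : dec a \in I by apply: memv_suml => k _; apply: memvZ.
have cD a x y : c (a *: x + y) = a *: c x + c y.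
  by apply/matrixP => i j; rewrite !mxE linearP.
have c0 : c 0 = 0 by apply/matrixP => i j; rewrite !mxE linear0.
have cK x : x \in I -> dec (c x) = x.
  move=> xI; rewrite [RHS](coord_vbasis xI); apply: eq_bigr => k _.
  by rewrite mxE.
have decK a : c (dec a) = a.
  apply/matrixP => i j; rewrite ord1 mxE /dec coord_sum_free//.
  exact: basis_free (vbasisP I).
have cM x y : y \in I -> c (br x y) = M x *m c y.
  move=> yI; rewrite [in LHS](coord_vbasis yI) br_sumr.
  apply/matrixP => k j; rewrite ord1 !mxE linear_sum; apply: eq_bigr => i _.
  by rewrite brZr linearZ/= !mxE mulrC.
have MW x : x \in I -> M x = admx W (c x).
  move=> xI; apply/matrixP => k j; rewrite !mxE {1}(coord_vbasis xI) br_suml linear_sum.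
  apply: eq_bigr => i _; rewrite brZl linearZ/= !mxE mxtens_indexK /=.
  by rewrite mulrC.
have cW x y : x \in I -> y \in I -> c (br x y) = brmx W (c x) (c y).
  by move=> xI yI; rewrite cM// MW// mul_admx.
have derM x : tder (M x) W = 0.
  apply/tder_eq0P => a b; rewrite -[a]decK -[b]decK -cW// -!cM// ?idI//.
  rewrite -!cW ?idI//.
  by rewrite br_jacobi -[X in c (X + _)]scale1r cD scale1r.
have decA a : admx W a = M (dec a) by rewrite MW// decK.
have derA a : tder (admx W a) W = 0 by rewrite decA.
have adA a : admx W a = 0 -> a = 0.
  move=> a0; rewrite -[a]decK (_ : dec a = 0)//; apply: cfI => // y yI.
  rewrite -[br _ _]cK ?idI// cM// -decA a0 mul0mx.
  by apply: big1 => k _; rewrite mxE scale0r.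
have d_gt0 : (0 < d)%N by rewrite lt0n dimv_eq0.
have irr B : (forall Y (v : 'cV[R]_d), tder Y W = 0 -> B *m v = 0 -> B *m (Y *m v) = 0) ->
    B = 0 \/ B \in unitmx.
  move=> stB.
  have [||J hJ] := @vspace_of_pred (fun x => x \in I /\ B *m c x = 0).
  - by rewrite mem0v c0 mulmx0.
  - move=> a x y [xI Bx] [yI By]; rewrite memvD ?memvZ// cD mulmxDr -scalemxAr Bx By.
    by rewrite scaler0 addr0.
  have idJ : ideal J.
    by move=> x y /hJ[yI By]; apply/hJ; split; [exact: idI | rewrite cM//; apply: stB].
  have JI : (J <= I)%VS by apply/subvP => x /hJ[].
  have [J0|JE] := minI _ idJ JI; [right|left].
    rewrite -unitmx_tr -row_free_unit -kermx_eq0; apply/rowV0P => u /sub_kermxP uB.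
    have : dec u^T \in J.
      by apply/hJ; split => //; rewrite decK -[B]trmxK -trmx_mul uB trmx0.
    rewrite J0 memv0 => /eqP h.
    by rewrite -[u]trmxK -[u^T]decK h c0 trmx0.
  apply/matrixP => k l; rewrite [RHS]mxE.
  have : dec (delta_mx l 0) \in J by rewrite JE.
  by case/hJ => _; rewrite decK -colE => /(congr1 (fun Z : 'cV_d => Z k 0)); rewrite !mxE.
have [A uA adj] := derivations_self_adjoint d_gt0 irr.
have inner := derivation_inner uA adj derA adA.
split; last first.
  move=> x; have [a Ma] := inner _ (derM x); exists (dec a) => // y yI.
  by rewrite -[LHS]cK ?idI// -[RHS]cK ?idI// !cM// Ma decA.
exists (fun x y => frob (A *m c x) (A *m c y)); split.
- by move=> a x y z; rewrite cD mulmxDr -scalemxAr frobDl frobZl.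
- by move=> x y; rewrite frobC.
- move=> x xI x0; apply: frob_gt0; apply: contra_neq x0 => h.
  rewrite -[x]cK// (_ : c x = 0); last by rewrite -(mulKmx uA (c x)) h mulmx0.
  by apply: big1 => k _; rewrite mxE scale0r.
- move=> x; have [a ha] := inner _ (adj _ (derM x)); exists (dec a) => // y z yI zI.
  rewrite !cM// -decA -ha !mulmxA mulmxV// mul1mx -[in LHS](mulmxKV uA (A *m M x)).
  by rewrite -(mulmxA _ A) frob_mull -!mulmxA.
Qed.

(** Induction on the dimension, splitting off a minimal ideal [I]. Each ad x acts on [I] as ad (p x)
    for a unique [p x] in [I]; on [U] this [p] is a projection onto [I] commuting with ad g, with
    kernel the centraliser [U'] of [I]. The metrics on [I] and [U'] add up, the mixed brackets being
    0. *)
Lemma metric_on_ideals :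
  (forall J, ideal J -> (forall x y, x \in J -> y \in J -> br x y = 0) -> J = 0%VS) ->
  forall U, ideal U -> exists b, adjoint_metric U b.
Proof.
move=> abelian0 U; have [k] := ubnP (\dim U); elim: k U => // k IH U dU idU.
have [U0|U0] := eqVneq U 0%VS.
  exists (fun _ _ => 0); split => //.
  - by move=> a x y z; rewrite mulr0 addr0.
  - by move=> x; rewrite U0 memv0 => /eqP ->; rewrite eqxx.
  - by move=> x; exists 0; rewrite ?mem0v.
pose P m := `[< exists J, [/\ ideal J, (J <= U)%VS, J != 0%VS & \dim J = m] >].
have exP : exists m, P m by exists (\dim U); apply/asboolP; exists U.
case: (ex_minnP exP) => m /asboolP[I [idI IU I0 dI]] mmin.
have minI J : ideal J -> (J <= I)%VS -> J = 0%VS \/ J = I.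
  move=> idJ JI; have [->|J0] := eqVneq J 0%VS; [by left | right].
  apply/eqP; rewrite eqEdim JI dI mmin//; apply/asboolP; exists J; split => //.
  exact: subv_trans JI IU.
(* The centre of [I] is an ideal of all of g by the Jacobi identity, and it is abelian. *)
have cfI x : x \in I -> (forall y, y \in I -> br x y = 0) -> x = 0.
  have [||Z hZ] := @vspace_of_pred (fun x => x \in I /\ forall y, y \in I -> br x y = 0).
  - by split; [exact: mem0v | move=> y _; rewrite br0l].
  - move=> a u v [uI u0] [vI v0]; split; first by rewrite memvD ?memvZ.
    by move=> y yI; rewrite brPl u0// v0// scaler0 addr0.
  have Z0 : Z = 0%VS.
    apply: abelian0 => [u v /hZ[vI v0]|u v /hZ[_ u0] /hZ[vI _]]; last exact: u0.
    apply/hZ; split; first exact: idI.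
    move=> y yI; rewrite brC br_jacobi (brC y u) brNl.
    rewrite (brC (br u y)) opprK (v0 _ (idI _ _ yI)) add0r.
    by rewrite (brC y v) v0// oppr0 br0r oppr0.
  by move=> xI x0; have : x \in Z by [apply/hZ]; rewrite Z0 memv0 => /eqP.
have [[b1 [b1D b1C b1p b1a]] inn] := minimal_ideal_metric idI I0 minI cfI.
have /choice[p hp] : forall x, exists i, i \in I /\ forall y, y \in I -> br x y = br i y.
  by move=> x; have [i iI ix] := inn x; exists i.
have pI x : p x \in I by case: (hp x).
have pE x y : y \in I -> br x y = br (p x) y by case: (hp x) => _; apply.
have p_unique x i : i \in I -> (forall y, y \in I -> br x y = br i y) -> p x = i.
  move=> iI hi; apply/eqP; rewrite -subr_eq0; apply/eqP.
  apply: cfI; first by rewrite memvB.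
  by move=> y yI; rewrite brDl brNl -hi// -pE// subrr.
have pD a x y : p (a *: x + y) = a *: p x + p y.
  apply: p_unique => [|z zI]; first by rewrite memvD ?memvZ.
  by rewrite !brPl -!pE.
have pid x : x \in I -> p x = x by move=> xI; apply: p_unique.
have [||U' hU'] := @vspace_of_pred (fun x => x \in U /\ forall y, y \in I -> br x y = 0).
- by split; [exact: mem0v | move=> y _; rewrite br0l].
- move=> a u v [uI u0] [vI v0]; split; first by rewrite memvD ?memvZ.
  by move=> y yI; rewrite brPl u0// v0// scaler0 addr0.
have U'U x : x \in U' -> x \in U by case/hU'.
have U'I x y : x \in U' -> y \in I -> br x y = 0 by case/hU' => _; apply.
have idU' : ideal U'.
  move=> u v /hU'[vU v0]; apply/hU'; split; first exact: idU.
  move=> y yI; rewrite brC br_jacobi (brC y u) brNl.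
  rewrite (brC (br u y)) opprK (v0 _ (idI _ _ yI)) add0r.
  by rewrite (brC y v) v0// oppr0 br0r oppr0.
have p0 x : x \in U' -> p x = 0.
  by move=> xU'; apply: p_unique; rewrite ?mem0v// => y yI; rewrite U'I// br0l.
have IUs x : x \in I -> x \in U by move/(subvP IU).
have qU' x : x \in U -> x - p x \in U'.
  move=> xU; apply/hU'; split; first by rewrite memvB// IUs.
  by move=> y yI; rewrite brDl brNl -pE// subrr.
have dU' : (\dim U' < k)%N.
  rewrite -ltnS; apply: leq_trans dU; rewrite ltnS.
  have s : (U' <= U)%VS by apply/subvP.
  rewrite ltn_neqAle dimvS// andbT; apply: contraNneq I0 => dd.
  have E : (U' == U)%VS by rewrite eqEdim s dd leqnn.
  rewrite -subv0; apply/subvP => x xI; rewrite memv0 -(pid _ xI) p0//.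
  by rewrite (eqP E) IUs.
have [b2 [b2D b2C b2p b2a]] := IH _ dU' idU'.
pose q x := x - p x.
have qD a x y : q (a *: x + y) = a *: q x + q y.
  by rewrite /q pD opprD addrACA scalerBr.
exists (fun x y => b1 (p x) (p y) + b2 (q x) (q y)); split.
- by move=> a x y z; rewrite pD qD b1D b2D; ring.
- by move=> x y; rewrite b1C b2C.
- move=> x xU x0; have b1ge : 0 <= b1 (p x) (p x).
    have [->|px] := eqVneq (p x) 0; last by rewrite ltW// b1p.
    by have := b1D (-1) 0 0 0; rewrite scaler0 addr0 mulN1r addNr => ->.
  have b2ge : 0 <= b2 (q x) (q x).
    have [->|qx] := eqVneq (q x) 0; last by rewrite ltW// b2p// qU'.
    by have := b2D (-1) 0 0 0; rewrite scaler0 addr0 mulN1r addNr => ->.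
  have [px|px] := eqVneq (p x) 0; last by rewrite ltr_pwDl// b1p.
  by rewrite ltr_wpDl// b2p ?qU'// /q px subr0.
- move=> x; have [x1 x1I h1] := b1a x; have [x2 x2U' h2] := b2a x.
  exists (x1 + x2); first by apply: memvD; [exact: IUs | exact: U'U].
  move=> y z yU zU.
  have key u v : v \in U -> p (br u v) = br u (p v) /\ q (br u v) = br u (q v).
    move=> vU; have E : p (br u v) = br u (p v).
      have -> : br u v = br u (p v) + br u (q v) by rewrite -brDr /q addrC subrK.
      rewrite -[X in p (X + _)]scale1r pD scale1r pid ?idI//.
      by rewrite (p0 (br u (q v))) ?addr0//; apply: idU'; exact: qU'.
    by split=> //; rewrite /q E brDr brNr.
  have [-> ->] := key x y yU.
  have [-> ->] := key (x1 + x2) z zU.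
  rewrite h1// h2 ?qU'//.
  have -> : br (x1 + x2) (p z) = br x1 (p z) by rewrite brDl (U'I x2)// addr0.
  have -> : br (x1 + x2) (q z) = br x2 (q z).
    by rewrite brDl (brC x1) (U'I (q z))// ?qU'// oppr0 add0r.
  by [].
Qed.

End SemisimpleMetric.

(** * Spectral theorem, positive definite matrices and their square roots *)

Section Spectral.
Variable R : realType.

(** For a complex eigenvector $x + iy$ with eigenvalue $a$, symmetry gives $\mathrm{Im}(a)(|x|^2 +
    |y|^2) = 0$. So $a$ is real, and whichever of $x$, $y$ is nonzero is a real eigenvector. *)
Lemma real_eigenvector n (A : 'M[R]_n) : A^T = A -> (0 < n)%N ->
  exists v : 'rV[R]_n, exists a, v *m A = a *: v /\ v != 0.
Proof.
move=> sA n0.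
have [a /eigenvalueP[v va v0]] := eigenvalue_closed (map_mx (real_complex R) A) n0.
pose x := map_mx (@complex.Re R) v; pose y := map_mx (@complex.Im R) v.
have E j : (v *m map_mx (real_complex R) A) 0 j =
    ((x *m A) 0 j +i* (y *m A) 0 j)%C.
  rewrite !mxE (eq_bigr (fun i => (x 0 i * A i j +i* (y 0 i * A i j))%C)); last first.
    by move=> i _; rewrite !mxE; case: (v 0 i) => u w /=; simpc.
  by elim/big_rec3: _ => // i p q r _ ->; simpc.
have Ex : x *m A = complex.Re a *: x - complex.Im a *: y.
  apply/rowP => j; have := congr1 (fun M : 'rV_n => complex.Re (M 0 j)) va.
  by rewrite E !mxE /=; case: a {va} => p q; case: (v 0 j) => u w.
have Ey : y *m A = complex.Im a *: x + complex.Re a *: y.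
  apply/rowP => j; have := congr1 (fun M : 'rV_n => complex.Im (M 0 j)) va.
  by rewrite E !mxE /=; case: a {va Ex} => p q; case: (v 0 j) => u w /= ->; rewrite addrC.
have xy0 : (x != 0) || (y != 0).
  rewrite -negb_and; apply: contra v0 => /andP[/eqP x0 /eqP y0].
  apply/eqP/rowP => j; have := congr1 (fun M : 'rV_n => M 0 j) x0.
  have := congr1 (fun M : 'rV_n => M 0 j) y0; rewrite !mxE.
  by case: (v 0 j) => u w /= -> ->.
have a0 : complex.Im a = 0.
  have : frob (x *m A) y = frob (y *m A) x by rewrite frob_mulr sA frobC.
  rewrite Ex Ey !frobDl frobNl !frobZl (frobC y x) => h.
  have : complex.Im a * (frob x x + frob y y) = 0 by move: h; lra.
  move/eqP; rewrite mulf_eq0 => /orP[/eqP//|]; rewrite paddr_eq0 ?frob_ge0//.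
  by case/andP => /eqP/frob_eq0 x0 /eqP/frob_eq0 y0; move: xy0; rewrite x0 y0 eqxx.
move: Ex Ey; rewrite a0 !scale0r subr0 add0r => Ex Ey.
by case/orP: xy0 => h; [exists x | exists y]; exists (complex.Re a).
Qed.

(** [P] is the Householder reflection along $v - e$, which exchanges $v$ with the first unit vector
    $e$; when $v = e$ there is no such reflection, and the identity does. *)
Lemma orthogonal_first_row n (v : 'rV[R]_(1 + n)) : v *m v^T = 1%:M ->
  exists P : 'M[R]_(1 + n), P *m P^T = 1%:M /\ usubmx P = v.
Proof.
move=> vv; pose e : 'rV[R]_(1 + n) := row_mx 1%:M 0.
have eP (P : 'M[R]_(1 + n)) : usubmx P = e *m P.
  by rewrite -[P in RHS]vsubmxK mul_row_col mul1mx mul0mx addr0.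
have ee : e *m e^T = 1%:M by rewrite tr_row_mx mul_row_col trmx1 mulmx1 mul0mx addr0.
have [ve|ve] := eqVneq v e.
  by exists 1%:M; rewrite eP ve mulmx1 trmx1 mulmx1.
pose w := v - e; pose t := frob w w.
have t0 : t != 0 by apply: contra_neq ve => /frob_eq0/eqP; rewrite subr_eq0 => /eqP.
have wt : w *m w^T = t%:M.
  by rewrite [LHS]mx11_scalar -trace_mx11.
pose P := 1%:M - (2 / t) *: (w^T *m w).
have sP : P^T = P by rewrite /P linearB/= linearZ/= trmx1 trmx_mul trmxK.
have PP : P *m P = 1%:M.
  rewrite /P; clearbody w; rewrite mulmxBl mul1mx mulmxBr mulmx1 -scalemxAl -!scalemxAr.
  have -> : w^T *m w *m (w^T *m w) = t *: (w^T *m w).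
    by rewrite -mulmxA (mulmxA w) wt mul_scalar_mx -scalemxAr.
  move: (w^T *m w) => M; apply/matrixP => i j; rewrite !mxE.
  by field.
exists P; rewrite sP; split => //.
rewrite eP /P mulmxBr mulmx1 -scalemxAr mulmxA.
have -> : e *m w^T = (- (t / 2))%:M.
  have h : v *m e^T = e *m v^T.
    by rewrite -[LHS]trmxK trmx_mul trmxK; apply/matrixP => i j; rewrite !ord1 mxE.
  have : w *m w^T = 1%:M - e *m v^T - (e *m v^T - 1%:M).
    by rewrite /w linearB/= mulmxBl !mulmxBr vv ee h.
  rewrite wt => h2; rewrite /w linearB/= mulmxBr ee.
  apply/matrixP => i j; rewrite !ord1.
  have := congr1 (fun M : 'M[R]_1 => M 0 0) h2; rewrite !mxE eqxx !mulr1n.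
  lra.
rewrite mul_scalar_mx scalerA mulrN (_ : 2 / t * (t / 2) = 1); last by field.
by rewrite scaleN1r opprK /w addrC subrK.
Qed.

Lemma spectral_symmetric n (A : 'M[R]_n) : A^T = A ->
  exists U : 'M[R]_n, exists d : 'rV[R]_n,
    [/\ U *m U^T = 1%:M, U^T *m U = 1%:M & A = U^T *m diag_mx d *m U].
Proof.
elim: n A => [|n IH] A sA.
  by exists 1%:M, 0; split; apply/matrixP => -[].
have [v0 [a [va v00]]] := real_eigenvector sA (ltn0Sn n).
have fv : 0 < frob v0 v0 by exact: frob_gt0.
pose v : 'rV[R]_(1 + n) := (Num.sqrt (frob v0 v0))^-1 *: v0.
have vv : v *m v^T = 1%:M.
  rewrite /v linearZ/= -scalemxAl -scalemxAr scalerA -expr2 exprVn sqr_sqrtr ?frob_ge0//.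
  have -> : v0 *m v0^T = (frob v0 v0)%:M.
    by rewrite [LHS]mx11_scalar -trace_mx11.
  by rewrite scale_scalar_mx mulVf// gt_eqF.
have vA : v *m (A : 'M[R]_(1 + n)) = a *: v by rewrite -scalemxAl va scalerA mulrC -scalerA.
have [P [PP vP]] := orthogonal_first_row vv.
have P'P : P^T *m P = 1%:M by apply: mulmx1C.
pose B := P *m (A : 'M[R]_(1 + n)) *m P^T.
have sB : B^T = B by rewrite /B !trmx_mul trmxK [A^T]sA mulmxA.
have uB : usubmx B = row_mx a%:M 0.
  have -> : usubmx B = v *m (A : 'M[R]_(1 + n)) *m P^T.
    by rewrite /B -vP !mul_usub_mx.
  rewrite vA -scalemxAl -vP.
  rewrite mul_usub_mx PP -[1%:M in LHS](@submxK _ 1 n 1 n) /block_mx.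
  rewrite (_ : ulsubmx 1%:M = 1%:M); last by apply/matrixP => i j; rewrite !mxE !ord1.
  rewrite (_ : ursubmx 1%:M = 0); last first.
    by apply/matrixP => i j; rewrite !mxE !ord1 -val_eqE.
  by rewrite col_mxKu scale_row_mx scaler0 scale_scalar_mx mulr1.
have EB : B = block_mx a%:M 0 0 (drsubmx B).
  rewrite -[LHS](@submxK _ 1 n 1 n); congr block_mx.
  - by rewrite /ulsubmx uB row_mxKl.
  - by rewrite /ursubmx uB row_mxKr.
  - by rewrite -[in LHS]sB -trmx_ursub /ursubmx uB row_mxKr trmx0.
have [U [d [UU U'U Ed]]] := IH (drsubmx B) (etrans (trmx_drsub B) (congr1 _ sB)).
exists (block_mx 1%:M 0 0 U *m P), (row_mx a%:M d).
have bU : block_mx (1%:M : 'M[R]_1) 0 0 U *m (block_mx 1%:M 0 0 U)^T = 1%:M.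
  by rewrite tr_block_mx mulmx_block !trmx0 !(mulmx0, mul0mx, addr0, add0r) trmx1 mulmx1 UU -scalar_mx_block.
have key : block_mx a%:M 0 0 (U^T *m diag_mx d *m U) =
    (block_mx (1%:M : 'M[R]_1) 0 0 U)^T *m block_mx a%:M 0 0 (diag_mx d)
      *m block_mx (1%:M : 'M[R]_1) 0 0 U :> 'M[R]_(1 + n)%N.
  by rewrite tr_block_mx !mulmx_block !trmx0 !(mulmx0, mul0mx, addr0, add0r) trmx1 mulmx1 mul1mx.
split.
- by rewrite trmx_mul mulmxA -(mulmxA _ P) PP mulmx1 bU.
- by rewrite trmx_mul mulmxA -(mulmxA P^T) (mulmx1C bU) mulmx1 P'P.
have -> : A = P^T *m B *m P by rewrite /B !mulmxA P'P mul1mx -mulmxA P'P mulmx1.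
rewrite EB Ed trmx_mul -!mulmxA; congr (_ *m _); rewrite !mulmxA; congr (_ *m _).
have -> : diag_mx (row_mx a%:M d) = block_mx a%:M 0 0 (diag_mx d).
  rewrite diag_mx_row; congr block_mx.
  by apply/matrixP => i j; rewrite !ord1 !mxE !eqxx.
exact: key.
Qed.

Definition posdef n (A : 'M[R]_n) := A^T = A /\ forall v : 'cV[R]_n, v != 0 -> 0 < frob (A *m v) v.

Lemma posdef_unit n (A : 'M[R]_n) : posdef A -> A \in unitmx.
Proof.
move=> [_ pA]; rewrite -unitmx_tr -row_free_unit -kermx_eq0; apply/rowV0P => u /sub_kermxP uA.
apply: contra_eq uA => u0.
have := pA u^T; rewrite -[A in frob (A *m _)]trmxK -trmx_mul => h.
apply/negP => /eqP uA; move: h; rewrite uA trmx0 frob0l ltxx => h.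
by apply/negP: isT; apply: contraT => _; apply: h; rewrite -[0]trmx0 (inj_eq trmx_inj).
Qed.

Lemma posdef_gram n (A : 'M[R]_n) : A \in unitmx -> posdef (A^T *m A).
Proof.
move=> uA; split=> [|v v0]; first by rewrite trmx_mul trmxK.
rewrite -mulmxA frob_mull trmxK frob_gt0//.
by apply: contra_neq v0 => h; rewrite -(mulKmx uA v) h mulmx0.
Qed.

Lemma posdef_diag n (U : 'M[R]_n) d : U *m U^T = 1%:M ->
  posdef (U^T *m diag_mx d *m U) <-> forall i, 0 < d 0 i.
Proof.
move=> UU; split=> [[_ pd] i|dp].
  have := pd (U^T *m delta_mx i 0); rewrite !mulmxA -(mulmxA _ U) UU mulmx1 -mulmxA.
  rewrite frob_mull trmxK mulmxA UU mul1mx.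
  have -> : frob (diag_mx d *m delta_mx i 0) (delta_mx i (0 : 'I_1)) = d 0 i.
    rewrite frobE (bigD1 i)//= [X in _ + X]big1 => [|j ji]; last first.
      by rewrite big_ord1 [X in _ * X]mxE (negbTE ji) mulr0.
    by rewrite addr0 big_ord1 mul_diag_mx !mxE !eqxx !mulr1.
  apply; apply/negP => /eqP/(congr1 (mulmx U)); rewrite mulmxA UU mul1mx mulmx0.
  by move/matrixP/(_ i 0)/eqP; rewrite !mxE !eqxx oner_eq0.
split=> [|v v0].
  by rewrite !trmx_mul trmxK tr_diag_mx mulmxA.
rewrite -!mulmxA frob_mull trmxK.
have w0 : U *m v != 0.
  apply: contra_neq v0 => h; have U'U : U^T *m U = 1%:M by apply: mulmx1C.
  by rewrite -[v]mul1mx -U'U -mulmxA h mulmx0.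
move: (U *m v) w0 => w w0; rewrite frobE.
have [i wi] : exists i, w i 0 != 0.
  apply/existsP; apply: contraT; rewrite negb_exists => /forallP h.
  case/negP: w0; apply/eqP/matrixP => i j; rewrite ord1 mxE; apply/eqP.
  by have := h i; rewrite negbK.
have E j : \sum_k (diag_mx d *m w) j k * w j k = d 0 j * w j 0 ^+ 2.
  by rewrite big_ord1 mul_diag_mx mxE -mulrA expr2.
rewrite (eq_bigr _ (fun j _ => E j)) (bigD1 i)//= ltr_pwDl//.
  by rewrite mulr_gt0// lt_neqAle sqr_ge0 eq_sym sqrf_eq0 wi.
by apply: sumr_ge0 => j _; rewrite mulr_ge0 ?sqr_ge0// ltW.
Qed.

Lemma posdef_sqrt n (A : 'M[R]_n) : posdef A -> exists2 B, posdef B & B *m B = A.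
Proof.
move=> pA; have [U [d [UU U'U E]]] := spectral_symmetric pA.1.
move: pA; rewrite E => /posdef_diag => /(_ UU) dp.
exists (U^T *m diag_mx (map_mx (@Num.sqrt R) d) *m U).
  by apply/posdef_diag => // i; rewrite mxE sqrtr_gt0.
rewrite !mulmxA -(mulmxA _ U) UU mulmx1 -(mulmxA U^T) mulmx_diag; congr (_ *m diag_mx _ *m _).
by apply/rowP => j; rewrite !mxE -expr2 sqr_sqrtr// ltW.
Qed.

Lemma posdef_frob_ge0 n m (A : 'M[R]_n) (E : 'M[R]_(n, m)) : posdef A -> 0 <= frob (A *m E) E.
Proof.
move=> pA; have [B [sB _] <-] := posdef_sqrt pA.
by rewrite -mulmxA frob_mull sB frob_ge0.
Qed.

Lemma posdef_frob_eq0 n m (A : 'M[R]_n) (E : 'M[R]_(n, m)) : posdef A ->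
  frob (A *m E) E = 0 -> E = 0.
Proof.
move=> pA; have [B pB <-] := posdef_sqrt pA; rewrite -mulmxA frob_mull pB.1 => /frob_eq0 h.
by rewrite -(mulKmx (posdef_unit pB) E) h mulmx0.
Qed.

(** Pairing the equation with $E$ writes 0 as the sum of the nonnegative numbers $\langle AE,
    E\rangle$ and $\langle BE^T, E^T\rangle$. *)
Lemma sylvester_uniq n m (A : 'M[R]_n) (B : 'M[R]_m) (E : 'M[R]_(n, m)) :
  posdef A -> posdef B -> A *m E + E *m B = 0 -> E = 0.
Proof.
move=> pA pB h; have := congr1 (fun M => frob M E) h.
rewrite frobDl frob0l => h0.
have hB : frob (E *m B) E = frob (B *m E^T) E^T.
  by rewrite -frob_tr trmx_mul pB.1.
apply: (posdef_frob_eq0 pA); apply/eqP.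
have := posdef_frob_ge0 E pA; have := posdef_frob_ge0 E^T pB.
by rewrite -hB eq_le => h1 ->; rewrite andbT; move: h0 h1; lra.
Qed.

(** The defect $AZ - ZB$ solves the homogeneous Sylvester equation. With $Z = 1$ this is uniqueness
    of positive roots; with $Z$ a bracket tensor it makes the root of a positive definite
    automorphism an automorphism. *)
Lemma sqrt_intertwine n m (A : 'M[R]_n) (B : 'M[R]_m) (Z : 'M[R]_(n, m)) :
  posdef A -> posdef B -> A *m A *m Z = Z *m (B *m B) -> A *m Z = Z *m B.
Proof.
move=> pA pB h; apply/eqP; rewrite -subr_eq0; apply/eqP.
apply: (sylvester_uniq pA pB); rewrite mulmxBr mulmxBl !mulmxA h mulmxA.
by rewrite addrA subrK subrr.
Qed.

End Spectral.

Section Frames.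
Variables (R : realType) (g : vectType R) (n : nat).

(** Linear coordinates as a map rather than a basis, so that a change of metric is simply
    composition with an invertible [S]. *)
Definition frame (C : g -> 'cV[R]_n) :=
  (forall a x y, C (a *: x + y) = a *: C x + C y) /\
  exists D : 'cV[R]_n -> g, cancel C D /\ cancel D C.

Lemma frame_mul (S : 'M[R]_n) C : S \in unitmx -> frame C -> frame (fun x => S *m C x).
Proof.
move=> uS [lC [D [CD DC]]]; split; first by move=> a x y; rewrite lC mulmxDr scalemxAr.
exists (fun v => D (invmx S *m v)); split=> x; first by rewrite mulKmx.
by rewrite DC mulKVmx.
Qed.

Definition frame_mx (C : g -> 'cV[R]_n) (D : 'cV[R]_n -> g) (h : g -> g) : 'M[R]_n :=
  \matrix_(k, j) C (h (D (delta_mx j 0))) k 0.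

Variable (C : g -> 'cV[R]_n).
Hypothesis fC : frame C.

Let lC := proj1 fC.

Lemma frame0 : C 0 = 0.
Proof. by have := lC (-1) 0 0; rewrite scaler0 addr0 scaleN1r addNr. Qed.

Lemma frame_inj : injective C.
Proof. by case: fC => _ [D [CD _]]; exact: can_inj CD. Qed.

Lemma frame_surj v : exists x, C x = v.
Proof. by case: fC => _ [D [_ DC]]; exists (D v). Qed.

Lemma frame_mx_ext (A B : 'M[R]_n) : (forall x, A *m C x = B *m C x) -> A = B.
Proof.
move=> h; apply/matrixP => i j; have [x Cx] := frame_surj (delta_mx j 0).
have := congr1 (fun M : 'cV_n => M i 0) (h x).
by rewrite Cx -!colE !mxE.
Qed.

Lemma frame_mx_exists (h : g -> g) : (forall a x y, h (a *: x + y) = a *: h x + h y) ->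
  exists A : 'M[R]_n, forall x, A *m C x = C (h x).
Proof.
move=> lh; have [D [CD DC]] := fC.2.
have lD a u v : D (a *: u + v) = a *: D u + D v.
  by apply: frame_inj; rewrite lC !DC.
have D0 : D 0 = 0 by rewrite -frame0 CD.
exists (frame_mx C D h) => x; rewrite -[x in RHS]CD; move: (C x) => v.
rewrite [v in RHS]matrix_sum_delta.
have sumCD (f : 'I_n -> 'cV[R]_n) : C (h (D (\sum_i f i))) = \sum_i C (h (D (f i))).
  elim/big_rec2: _ => [|i a b _ <-].
    have h0 : h 0 = 0 by have := lh (-1) 0 0; rewrite scaler0 addr0 scaleN1r addNr.
    by rewrite D0 h0 frame0.
  by rewrite -[f i]scale1r lD lh lC !scale1r.
rewrite sumCD; apply/matrixP => k l; rewrite ord1 mxE summxE; apply: eq_bigr => i _.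
rewrite big_ord1 -[_ *: _]addr0 lD D0 lh lC mxE [h 0](_ : _ = 0).
  by rewrite frame0 mxE [in RHS]mxE mxE mulrC addr0.
by have := lh (-1) 0 0; rewrite scaler0 addr0 scaleN1r addNr.
Qed.

(** [S] is the positive square root of the Gram matrix of [b] in the frame. *)
Lemma frame_orthonormalize (b : g -> g -> R) :
  (forall a x y z, b (a *: x + y) z = a * b x z + b y z) ->
  (forall x y, b x y = b y x) -> (forall x, x != 0 -> 0 < b x x) ->
  exists2 S : 'M[R]_n, S \in unitmx & forall x y, b x y = frob (S *m C x) (S *m C y).
Proof.
move=> lb sb pb; have [D [CD DC]] := fC.2.
have lD a u v : D (a *: u + v) = a *: D u + D v.
  by apply: frame_inj; rewrite lC !DC.
have D0 : D 0 = 0 by rewrite -frame0 CD.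
pose H : 'M[R]_n := \matrix_(i, j) b (D (delta_mx i 0)) (D (delta_mx j 0)).
have bD0 z : b 0 z = 0 by have := lb (-1) 0 0 z; rewrite scaler0 addr0 mulN1r addNr.
have sumb (f : 'I_n -> 'cV[R]_n) z : b (D (\sum_i f i)) z = \sum_i b (D (f i)) z.
  elim/big_rec2: _ => [|i a c _ <-]; first by rewrite D0.
  by rewrite -[f i]scale1r lD lb mul1r scale1r.
have bZ a u z : b (D (a *: u)) z = a * b (D u) z.
  by rewrite -[a *: u]addr0 lD lb D0 bD0 addr0.
have bH u v : b (D u) (D v) = frob (H *m u) v.
  have us (w : 'cV[R]_n) : w = \sum_i w i 0 *: delta_mx i 0.
    by rewrite {1}[w]matrix_sum_delta; apply: eq_bigr => i _; rewrite big_ord1.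
  rewrite {1}(us u) {1}(us v) sumb.
  have -> : frob (H *m u) v = \sum_i \sum_j v i 0 * H i j * u j 0.
    rewrite frobC frobE; apply: eq_bigr => i _.
    by rewrite big_ord1 mxE mulr_sumr; apply: eq_bigr => j _; rewrite mulrA.
  rewrite exchange_big/=; apply: eq_bigr => i _.
  rewrite bZ sb sumb mulr_sumr; apply: eq_bigr => j _.
  by rewrite bZ mxE; ring.
have pH : posdef H.
  split=> [|v v0]; first by apply/matrixP => i j; rewrite !mxE sb.
  by rewrite -bH; apply: pb; apply: contra_neq v0 => h; rewrite -[v]DC h frame0.
have [S pS SS] := posdef_sqrt pH.
exists S => [|x y]; first exact: posdef_unit.
by rewrite -[x in LHS]CD -[y in LHS]CD bH -SS -mulmxA frob_mull pS.1.
Qed.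

End Frames.

Lemma posdef_tens (R : realType) n m (A : 'M[R]_n) (B : 'M[R]_m) :
  posdef A -> posdef B -> posdef (A *t B).
Proof.
move=> pA pB; have [A' pA' <-] := posdef_sqrt pA; have [B' pB' <-] := posdef_sqrt pB.
have -> : (A' *m A') *t (B' *m B') = (A' *t B')^T *m (A' *t B').
  by rewrite trmx_tens tensmx_mul pA'.1 pB'.1.
apply: posdef_gram; have [uA uB] := (posdef_unit pA', posdef_unit pB').
have : (A' *t B') *m (invmx A' *t invmx B') = 1%:M.
  by rewrite tensmx_mul !mulmxV// tens11.
by case/mulmx1_unit.
Qed.

Lemma posdef_inv (R : realType) n (A : 'M[R]_n) : posdef A -> posdef (invmx A).
Proof.
move=> pA; have uA := posdef_unit pA; split=> [|v v0]; first by rewrite trmx_inv pA.1.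
rewrite -{2}(mulKVmx uA v) frobC; apply: pA.2.
by apply: contra_neq v0 => h; rewrite -(mulKVmx uA v) h mulmx0.
Qed.

Lemma frob_adjoint (R : realType) m (A B : 'M[R]_m) :
  (forall u v : 'cV_m, frob (A *m u) v = frob u (B *m v)) -> A^T = B.
Proof.
move=> h; apply/matrixP => i j; rewrite mxE.
have := h (delta_mx i 0) (delta_mx j 0); rewrite -!colE.
have fd (w : 'cV[R]_m) k : frob w (delta_mx k 0) = w k 0.
  rewrite frobE (eq_bigr (fun l => w l 0 * (l == k)%:R)) => [|l _]; last first.
    by rewrite big_ord1 mxE eqxx andbT.
  rewrite (bigD1 k)//= big1 => [|l lk]; first by rewrite eqxx mulr1 addr0.
  by rewrite (negbTE lk) mulr0.
by rewrite fd frobC fd !mxE.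
Qed.

(** * A metric adapted both to the bracket and to the involution *)

Section CartanFrame.
Variables (R : realType) (g : vectType R) (br : g -> g -> g) (n : nat).
Hypothesis hbr : lie_bracket br.
Hypothesis hss : lie_semisimple br fullv.
Variable phi : g -> g.
Hypothesis phiD : forall a x y, phi (a *: x + y) = a *: phi x + phi y.
Hypothesis phi_br : forall x y, phi (br x y) = br (phi x) (phi y).
Hypothesis phiK : forall x, phi (phi x) = x.
Variable C0 : g -> 'cV[R]_n.
Hypothesis fC0 : frame C0.

Lemma semisimple_abelian_ideal J : ideal br J ->
  (forall x y, x \in J -> y \in J -> br x y = 0) -> J = 0%VS.
Proof.
move=> idJ abJ; apply: hss.
  split; first exact: subvf.
  by apply/(lie_prod_subP hbr) => x y _ yJ; exact: idJ.
exists 1%N => /=; apply/eqP; rewrite -subv0; apply/(lie_prod_subP hbr) => x y xJ yJ.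
by rewrite abJ// mem0v.
Qed.

Lemma center_free x : (forall y, br x y = 0) -> x = 0.
Proof.
move=> x0.
have [||Z hZ] := @vspace_of_pred _ _ (fun x => forall y, br x y = 0).
- by move=> y; rewrite (br0l hbr).
- by move=> a u v u0 v0 y; rewrite (brPl hbr) u0 v0 scaler0 addr0.
have Z0 : Z = 0%VS.
  apply: semisimple_abelian_ideal => [u v /hZ v0|u v /hZ u0 _]; last exact: u0.
  by apply/hZ => y; rewrite (brC hbr u v) v0 oppr0 (br0l hbr).
by move/hZ: x0; rewrite Z0 memv0 => /eqP.
Qed.

Let ad_exists (C : g -> 'cV[R]_n) : frame C ->
  {ad : g -> 'M[R]_n | forall x y, ad x *m C y = C (br x y)}.
Proof.
move=> fC; apply: cid.
have h x : exists A : 'M[R]_n, forall y, A *m C y = C (br x y).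
  by apply: (frame_mx_exists fC) => a y z; exact: brPr.
by have [ad adE] := choice h; exists ad.
Qed.

(** The metric assembled from the ideals yields an involutive anti-automorphism [s] with ad (s x)
    the transpose of ad x. For [beta] the adjoint of [phi] is the automorphism [psi], so $M = P^T P$
    and its positive root $N$ preserve the bracket. The final metric is [beta] twisted by $N$; the
    root [T] of $N$ realises it as a change of frame. *)
Lemma invariant_metric : exists2 S : 'M[R]_n, S \in unitmx &
  (forall x, exists x', forall y z,
     frob (S *m C0 (br x y)) (S *m C0 z) = frob (S *m C0 y) (S *m C0 (br x' z))) /\
  (forall y z, frob (S *m C0 (phi y)) (S *m C0 (phi z)) = frob (S *m C0 y) (S *m C0 z)).
Proof.
have [b [bD bC bp ba]] := metric_on_ideals hbr semisimple_abelian_ideal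
  (fun x y (_ : y \in fullv) => memvf (br x y)).
have [S0 uS0 S0b] := frame_orthonormalize fC0 bD bC (fun x => bp x (memvf x)).
have fC1 := frame_mul uS0 fC0; set C1 := (fun x => _) in fC1.
have [ad adE] := ad_exists fC1.
have adD a x y : ad (a *: x + y) = a *: ad x + ad y.
  apply: (frame_mx_ext fC1) => z.
  by rewrite mulmxDl -scalemxAl !adE (brPl hbr) fC1.1.
have ad_inj x y : ad x = ad y -> x = y.
  move=> xy; apply/eqP; rewrite -subr_eq0; apply/eqP; apply: center_free => z.
  apply: (frame_inj fC1); rewrite -adE (_ : x - y = (-1) *: y + x); last first.
    by rewrite scaleN1r addrC.
  by rewrite adD xy scaleN1r addNr mul0mx (frame0 fC1).
have adB x y : ad (br x y) = ad x *m ad y - ad y *m ad x.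
  apply: (frame_mx_ext fC1) => z; rewrite mulmxBl -!mulmxA !adE.
  by rewrite -scaleN1r addrC -fC1.1 scaleN1r addrC (br_jacobi hbr x) addrK.
have adT x : exists x', ad x' = (ad x)^T.
  have [x' _ hx'] := ba x; exists x'; apply/esym; apply: frob_adjoint => u v.
  have [y <-] := frame_surj fC1 u; have [z <-] := frame_surj fC1 v.
  by rewrite !adE -!S0b hx'// memvf.
have [s sE] := choice adT.
have sD a x y : s (a *: x + y) = a *: s x + s y.
  by apply: ad_inj; rewrite adD !sE adD linearP.
have sK x : s (s x) = x by apply: ad_inj; rewrite !sE trmxK.
have sB x y : s (br x y) = br (s y) (s x).
  by apply: ad_inj; rewrite adB !sE adB linearB/= !trmx_mul.
have [F FE] := frame_mx_exists fC1 phiD.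
have FF : F *m F = 1%:M.
  by apply: (frame_mx_ext fC1) => x; rewrite -mulmxA !FE phiK mul1mx.
have adF x : ad (phi x) = F *m ad x *m F.
  apply: (frame_mx_ext fC1) => y; rewrite -!mulmxA FE adE [in RHS]adE FE phi_br.
  by rewrite phiK.
(* The form [-B(x, theta y)] attached to the Killing form [B], for which every
   automorphism [phi] has the automorphism [theta phi^-1 theta] as adjoint. *)
pose beta x y := frob (ad x) (ad y).
have betaE x y : beta x y = \tr (ad x *m ad (s y)) by rewrite /beta /frob sE.
have [|||S1 uS1 S1b] := @frame_orthonormalize _ _ _ _ fC0 beta.
- by move=> a x y z; rewrite /beta adD frobDl frobZl.
- by move=> x y; rewrite /beta frobC.
- move=> x x0; apply: frob_gt0; apply: contra_neq x0 => x0.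
  apply: center_free => z; apply: (frame_inj fC1).
  by rewrite -adE x0 mul0mx (frame0 fC1).
have fC2 := frame_mul uS1 fC0; set C2 := (fun x => _) in fC2.
have {}S1b x y : frob (C2 x) (C2 y) = beta x y by rewrite S1b.
have [ad2 ad2E] := ad_exists fC2.
have ad2T x : (ad2 x)^T = ad2 (s x).
  apply: frob_adjoint => u v.
  have [y <-] := frame_surj fC2 u; have [z <-] := frame_surj fC2 v.
  rewrite !ad2E !S1b !betaE sB sK !adB mulmxBl mulmxBr !raddfB/= !mulmxA.
  congr (_ - _); by rewrite -[in LHS]mulmxA mxtrace_mulC.
have [P PE] := frame_mx_exists fC2 phiD.
pose psi x := s (phi (s x)).
have psiD a x y : psi (a *: x + y) = a *: psi x + psi y by rewrite /psi sD phiD sD.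
have psiB x y : psi (br x y) = br (psi x) (psi y) by rewrite /psi sB phi_br sB.
have [Q QE] := frame_mx_exists fC2 psiD.
have PT : P^T = Q.
  apply: frob_adjoint => u v.
  have [y <-] := frame_surj fC2 u; have [z <-] := frame_surj fC2 v.
  rewrite PE QE !S1b !betaE /psi sK !adF -!mulmxA mxtrace_mulC.
  by rewrite !mulmxA.
have PP : P *m P = 1%:M.
  by apply: (frame_mx_ext fC2) => x; rewrite -mulmxA !PE phiK mul1mx.
have uP : P \in unitmx by case/mulmx1_unit: PP.
have pM := posdef_gram uP; set M := P^T *m P in pM.
have [N pN NN] := posdef_sqrt pM.
have uN := posdef_unit pN.
have [D2 [CD2 DC2]] := fC2.2.
pose W : 'M[R]_(n, n * n) := \matrix_(k, p)
  C2 (br (D2 (delta_mx (mxtens_unindex p).1 0)) (D2 (delta_mx (mxtens_unindex p).2 0))) k 0.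
have C2s (h : 'I_n -> g) : C2 (\sum_i h i) = \sum_i C2 (h i).
  elim/big_rec2: _ => [|i a c _ <-]; first exact: frame0 fC2.
  by rewrite -[h i]scale1r fC2.1 !scale1r.
have dec x : x = \sum_i (C2 x) i 0 *: D2 (delta_mx i 0).
  apply: (frame_inj fC2); rewrite C2s {1}[C2 x]matrix_sum_delta; apply: eq_bigr => i _.
  by rewrite big_ord1 -[_ *: D2 _]addr0 fC2.1 DC2 (frame0 fC2) addr0.
have brW x y : C2 (br x y) = brmx W (C2 x) (C2 y).
  rewrite {1}(dec x) {1}(dec y) (br_suml hbr) C2s.
  apply/matrixP => k l; rewrite ord1 summxE mxE; apply: eq_bigr => i _.
  rewrite (br_sumr hbr) C2s summxE; apply: eq_bigr => j _.
  rewrite (brZl hbr) (brZr hbr) scalerA -[_ *: br _ _]addr0 fC2.1 (frame0 fC2) addr0.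
  by rewrite [LHS]mxE [W _ _]mxE mxtens_indexK [X in _ = X * _ * _]/=; ring.
have MW : M *m W = W *m (M *t M).
  apply/bracket_automorphismP => u v.
  have [x <-] := frame_surj fC2 u; have [y <-] := frame_surj fC2 v.
  by rewrite -brW /M PT -!mulmxA !PE !QE phi_br psiB brW.
have NW : N *m W = W *m (N *t N).
  by apply: sqrt_intertwine => //; [exact: posdef_tens | rewrite tensmx_mul NN].
(* This is orthogonality of phi for the twisted metric. As $P^2 = 1$, the inverse of $N^2 = P^T P$
   is $PP^T$, so $P^T$ intertwines $N^2$ with $N^{-2}$, hence $N$ with $N^{-1}$. *)
have PNP : P^T *m N *m P = N.
  pose N' := invmx N.
  have pN' : posdef N' by exact: posdef_inv.
  have h : N *m P^T = P^T *m N'.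
    apply: sqrt_intertwine => //.
    have -> : N' *m N' = P *m P^T.
      have : P *m P^T *m (N *m N) = 1%:M.
        by rewrite NN /M mulmxA -(mulmxA P) -trmx_mul PP trmx1 mulmx1.
      by move/(congr1 (fun Z => Z *m (N' *m N'))); rewrite mul1mx !mulmxA !mulmxK.
    by rewrite NN /M !mulmxA -[P^T *m P *m _]mulmxA.
  have h2 : P^T *m N = N' *m P^T.
    by rewrite -[LHS](mulKmx uN) (mulmxA N) h -(mulmxA P^T) mulVmx// mulmx1.
  by rewrite h2 -mulmxA -/M -NN mulKmx.
have [T pT TT] := posdef_sqrt pN.
have TN u v : frob (T *m u) (T *m v) = frob (N *m u) v :> R.
  by rewrite -TT -mulmxA [RHS]frob_mull pT.1.
exists (T *m S1); first by rewrite unitmx_mul (posdef_unit pT).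
split=> [x|y z].
  (* Since $N$ is an automorphism, $N^{-1}\,\mathrm{ad}(s x)\,N = \mathrm{ad}(N^{-1} s x)$, which is
     the adjoint of $\mathrm{ad}(x)$ for the twisted metric. *)
  have [x' hx'] := frame_surj fC2 (invmx N *m C2 (s x)); exists x' => y z.
  rewrite -!mulmxA !TN -/(C2 _) -ad2E frob_mull pN.1 frob_mull ad2T.
  rewrite [RHS]frob_mull pN.1; congr (frob _ _).
  rewrite -[S1 *m C0 z]/(C2 z) -[S1 *m C0 (br x' z)]/(C2 _) brW.
  have [z' hz'] := frame_surj fC2 (N *m C2 z).
  rewrite (bracket_automorphismP W N).1// hx' mulKVmx// -hz' -brW.
  by rewrite -ad2E.
rewrite -!mulmxA !TN -[S1 *m C0 (phi y)]/(C2 _) -[S1 *m C0 (phi z)]/(C2 _) -!PE.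
by rewrite -{2}PNP frobC frob_mull frobC !mulmxA.
Qed.

End CartanFrame.

(** * Matrix exponentials and Zariski closed groups *)

Section MatrixExponential.
Variable R : realType.

Lemma mxX_bound n (A : 'M[R]_n) k i j :
  `|(A ^+ k) i j| <= (\sum_i \sum_j `|A i j|) ^+ k.
Proof.
set c := \sum_i _; have c0 : 0 <= c by apply: sumr_ge0 => u _; apply: sumr_ge0.
elim: k i j => [|k IH] i j.
  by rewrite !expr0 mxE; case: (i == j); rewrite ?mulr1n ?mulr0n ?normr1 ?normr0 ?ler01.
rewrite exprS -mulmxE mxE; apply: le_trans (ler_norm_sum _ _ _) _.
apply: le_trans (_ : \sum_l `|A i l| * c ^+ k <= _).
  by apply: ler_sum => l _; rewrite normrM ler_wpM2l.
rewrite -mulr_suml exprS ler_wpM2r ?exprn_ge0// /c [leRHS](bigD1 i)//= lerDl.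
by apply: sumr_ge0 => u _; apply: sumr_ge0.
Qed.

Lemma mexp_coef_cvg n (A : 'M[R]_n) i j t :
  cvgn (pseries (fun k => (A ^+ k) i j / k`!%:R) t).
Proof.
apply: normed_cvg; set c := \sum_i \sum_j `|A i j|.
have c0 : 0 <= c by apply: sumr_ge0 => u _; apply: sumr_ge0.
apply: (@series_le_cvg _ _ (exp_coeff (c * `|t|))) => //.
- by move=> k /=; rewrite normr_ge0.
- by move=> k; apply: exp_coeff_ge0; rewrite mulr_ge0.
- move=> k /=; rewrite /exp_coeff/= !normrM normfV (ger0_norm (ler0n _ _)) normrX exprMn.
  by rewrite mulrAC ler_wpM2r ?invr_ge0 ?ler0n// ler_wpM2r ?exprn_ge0// mxX_bound.
- exact: is_cvg_series_exp_coeff.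
Qed.

Definition mexp_sum n (A : 'M[R]_n) N := \sum_(0 <= k < N) (k`!%:R)^-1 *: A ^+ k.

Lemma mexp_lim n (A : 'M[R]_n) : mexp_sum A N @[N --> \oo] --> mexp A.
Proof.
apply: cvg_mx => i j; rewrite mxE.
have := @mexp_coef_cvg _ A i j 1; rewrite /pseries.
have -> : (fun k => (A ^+ k) i j / k`!%:R * 1 ^+ k) = (fun k => (A ^+ k) i j / k`!%:R).
  by apply/funext => k; rewrite expr1n mulr1.
move=> c; apply: cvg_trans c; apply: near_eq_cvg; near=> N.
rewrite /mexp_sum summxE /series/=; apply: eq_bigr => k _.
by rewrite mxE mulrC.
Unshelve. all: by end_near. Qed.

Lemma mx_lim_unique m n (f : nat -> 'M[R]_(m, n)) (a b : 'M[R]_(m, n)) :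
  f @ \oo --> a -> f @ \oo --> b -> a = b.
Proof. by move=> fa fb; apply: (cvg_unique _ fa fb); exact: norm_hausdorff. Qed.

(** [P] may be rectangular, so that this serves for commutation, conjugation and restriction to
    blocks alike. *)
Lemma mexp_intertwine n m (A : 'M[R]_n) (B : 'M[R]_m) (P : 'M[R]_(n, m)) :
  A *m P = P *m B -> mexp A *m P = P *m mexp B.
Proof.
move=> h; apply: (@mx_lim_unique _ _ (fun N => mexp_sum A N *m P)).
  by apply: cvg_mulmx; [exact: mexp_lim | exact: cvg_cst].
have -> : (fun N => mexp_sum A N *m P) = (fun N => P *m mexp_sum B N).
  apply/funext => N; rewrite /mexp_sum mulmx_suml mulmx_sumr; apply: eq_bigr => k _.
  rewrite -scalemxAl -scalemxAr; congr (_ *: _).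
  elim: k => [|k IH]; first by rewrite !expr0 mul1mx mulmx1.
  by rewrite !exprS -!mulmxE -mulmxA IH mulmxA h mulmxA.
by apply: cvg_mulmx; [exact: cvg_cst | exact: mexp_lim].
Qed.

Lemma mexp_vanish n m p (A : 'M[R]_n) (U : 'M[R]_(m, n)) (V : 'M[R]_(n, p)) :
  (forall k, U *m A ^+ k *m V = 0) -> U *m mexp A *m V = 0.
Proof.
move=> h; apply: (@mx_lim_unique _ _ (fun N => U *m mexp_sum A N *m V)).
  apply: cvg_mulmx; last exact: cvg_cst.
  by apply: cvg_mulmx; [exact: cvg_cst | exact: mexp_lim].
rewrite (_ : (fun _ => _) = (fun=> 0)); first exact: cvg_cst.
apply/funext => N; rewrite /mexp_sum mulmx_sumr mulmx_suml big1// => k _.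
by rewrite -scalemxAr -scalemxAl h scaler0.
Qed.

Lemma scalemxX n (a : R) (A : 'M[R]_n) k : (a *: A) ^+ k = a ^+ k *: A ^+ k.
Proof.
elim: k => [|k IH]; first by rewrite !expr0 scale1r.
by rewrite !exprS IH -!mulmxE -scalemxAl -scalemxAr scalerA.
Qed.

Lemma trmxX n (A : 'M[R]_n) k : (A^T) ^+ k = (A ^+ k)^T.
Proof.
elim: k => [|k IH]; first by rewrite !expr0 trmx1.
by rewrite exprSr exprS -!mulmxE IH trmx_mul.
Qed.

Lemma mexp_tr n (A : 'M[R]_n) : mexp A^T = (mexp A)^T.
Proof.
by apply/matrixP => i j; rewrite !mxE; under eq_fun do rewrite trmxX mxE.
Qed.

Lemma mexp0 n : mexp 0 = 1%:M :> 'M[R]_n.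
Proof.
apply: (mx_lim_unique (@mexp_lim n 0)); rewrite -cvg_shiftS/=.
rewrite (_ : (fun _ => _) = (fun=> 1%:M)); first exact: cvg_cst.
apply/funext => N; rewrite /mexp_sum big_nat_recl// big1 => [|k _].
  by rewrite addr0 expr0 fact0 invr1 scale1r.
by rewrite exprS mul0r scaler0.
Qed.

Definition mderive m n (M M' : R -> 'M[R]_(m, n)) :=
  forall t i j, is_derive t (1 : R) (fun s => M s i j) (M' t i j).

(** Termwise differentiation of a power series in each entry. Passing to the derived series
    multiplies the coefficients by [A]; the factor [B] is there to iterate this, since convergence
    of the second derived series is required too. *)
Lemma mderive_mexp n (A : 'M[R]_n) :
  mderive (fun t => mexp (t *: A)) (fun t => A *m mexp (t *: A)).
Proof.
move=> t i j; pose c k := (A ^+ k) i j / k`!%:R.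
have XZ s k : (s *: A) ^+ k = s ^+ k *: A ^+ k by exact: scalemxX.
have E : (fun s => mexp (s *: A) i j) = (fun s => limn (pseries c s)).
  apply/funext => s; rewrite mxE; congr (limn (series _)); apply/funext => k.
  by rewrite /c XZ mxE /= -mulrA mulrC.
have diffsE (B : 'M[R]_n) :
    pseries_diffs (fun k => (B *m A ^+ k) i j / k`!%:R) = (fun k => (B *m A *m A ^+ k) i j / k`!%:R).
  apply/funext => k; rewrite /pseries_diffs exprS -mulmxE mulmxA factS natrM.
  move: ((B *m A *m A ^+ k) i j) (k`!%:R) => a f.
  by rewrite invfM mulrCA mulVKf ?pnatr_eq0.
have cE : c = (fun k => (1%:M *m A ^+ k) i j / k`!%:R).
  by apply/funext => k; rewrite mul1mx.
have cvgE (B : 'M[R]_n) s : cvgn (pseries (fun k => (B *m A ^+ k) i j / k`!%:R) s) /\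
   limn (pseries (fun k => (B *m A ^+ k) i j / k`!%:R) s) = (B *m mexp (s *: A)) i j.
  have h : pseries (fun k => (B *m A ^+ k) i j / k`!%:R) s @ \oo --> (B *m mexp (s *: A)) i j.
    have -> : pseries (fun k => (B *m A ^+ k) i j / k`!%:R) s =
        (fun N => (B *m mexp_sum (s *: A) N) i j).
      apply/funext => N; rewrite /pseries/series/= /mexp_sum mulmx_sumr summxE.
      apply: eq_bigr => k _; rewrite XZ -!scalemxAr [RHS]mxE [in RHS]mxE; ring.
    by apply: cvg_coord; apply: cvg_mulmx; [exact: cvg_cst | exact: mexp_lim].
  by split; [apply/cvg_ex; exists ((B *m mexp (s *: A)) i j) | exact/cvg_lim].
rewrite E -[A in A *m mexp _]mul1mx -(cvgE _ _).2 -diffsE -cE.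
apply: (@pseries_snd_diffs _ c (`|t| + 1)).
- by rewrite cE; exact: (cvgE _ _).1.
- by rewrite cE diffsE; exact: (cvgE _ _).1.
- by rewrite cE !diffsE; exact: (cvgE _ _).1.
- by rewrite [ltRHS]ger0_norm ?addr_ge0// ltrDl.
Qed.

Lemma mderiveM m n p (M M' : R -> 'M[R]_(m, n)) (N N' : R -> 'M[R]_(n, p)) :
  mderive M M' -> mderive N N' ->
  mderive (fun t => M t *m N t) (fun t => M' t *m N t + M t *m N' t).
Proof.
move=> hM hN t i j.
have -> : (fun s => (M s *m N s) i j) = \sum_k (fun s => M s i k * N s k j).
  by apply/funext => s; rewrite mxE fct_sumE.
have -> : (M' t *m N t + M t *m N' t) i j =
    \sum_k (M t i k *: N' t k j + N t k j *: M' t i k).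
  rewrite !mxE -big_split; apply: eq_bigr => k _ /=.
  by rewrite addrC; congr (_ + _); rewrite mulrC.
by apply: is_derive_sum => k; apply: is_deriveM.
Qed.

Lemma mderive_cst m n (A : 'M[R]_(m, n)) : mderive (fun=> A) (fun=> 0).
Proof. by move=> t i j; rewrite mxE; exact: is_derive_cst. Qed.

Lemma mderive0_cst m n (M M' : R -> 'M[R]_(m, n)) : mderive M M' ->
  (forall t, M' t = 0) -> forall t, M t = M 0.
Proof.
move=> hM M0 t; apply/matrixP => i j; apply: (@is_derive_0_is_cst _ (fun s => M s i j)) => s.
by have := hM s i j; rewrite M0 mxE.
Qed.

Lemma mexp_comm n (A B : 'M[R]_n) : A *m B = B *m A -> mexp A *m B = B *m mexp A.
Proof. exact: mexp_intertwine. Qed.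

Lemma mexpNK n (A : 'M[R]_n) : mexp A *m mexp (- A) = 1%:M.
Proof.
pose f t := mexp (t *: A) *m mexp (t *: - A).
have hf := mderiveM (mderive_mexp A) (mderive_mexp (- A)).
have := mderive0_cst hf _ 1; rewrite /= !scale1r !scale0r mexp0 mulmx1.
apply => t; rewrite mulNmx mulmxN mulmxA.
rewrite (mexp_comm (_ : t *: A *m A = _)) ?subrr//.
by rewrite -scalemxAl -scalemxAr.
Qed.

Lemma mexp_unit n (A : 'M[R]_n) : mexp A \in unitmx.
Proof. by case/mulmx1_unit: (mexpNK A). Qed.

Lemma mexpN n (A : 'M[R]_n) : mexp (- A) = invmx (mexp A).
Proof. by rewrite -[RHS]mulmx1 -(mexpNK A) mulKmx ?mexp_unit. Qed.

Lemma mexpD n (A B : 'M[R]_n) : A *m B = B *m A -> mexp (A + B) = mexp A *m mexp B.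
Proof.
move=> AB.
have h : mexp A *m mexp B *m mexp (- (A + B)) = 1%:M.
  have hf := mderiveM (mderiveM (mderive_mexp A) (mderive_mexp B)) (mderive_mexp (- (A + B))).
  have := mderive0_cst hf _ 1; rewrite /= !scale1r !scale0r mexp0 !mulmx1.
  apply => t.
  have cA : mexp (t *: A) *m B = B *m mexp (t *: A).
    by apply: mexp_comm; rewrite -scalemxAl -scalemxAr AB.
  have cAA : mexp (t *: A) *m A = A *m mexp (t *: A).
    by apply: mexp_comm; rewrite -scalemxAl -scalemxAr.
  have cB : mexp (t *: B) *m A = A *m mexp (t *: B).
    by apply: mexp_comm; rewrite -scalemxAl -scalemxAr AB.
  have cBB : mexp (t *: B) *m B = B *m mexp (t *: B).
    by apply: mexp_comm; rewrite -scalemxAl -scalemxAr.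
  move: (mexp (t *: A)) (mexp (t *: B)) cA cAA cB cBB => a b cA cAA cB cBB.
  have e1 : a *m b *m A = A *m a *m b by rewrite -mulmxA cB mulmxA cAA.
  have e2 : a *m b *m B = a *m (B *m b) by rewrite -mulmxA cBB.
  by rewrite mulNmx mulmxN (mulmxA (a *m b)) mulmxDr e1 e2 subrr.
by rewrite -[RHS]mulmx1 -(mexpNK (- (A + B))) opprK mulmxA h mul1mx.
Qed.

(** Repeated differentiation recovers the moments $U A^k V$. With the converse [mexp_vanish] it
    gives an identity theorem: a matrix coefficient of the exponential that is 0 on the real line is
    0 on the complex one. *)
Lemma mexp_deriv_vanish n m p (A : 'M[R]_n) (U : 'M[R]_(m, n)) (V : 'M[R]_(n, p)) :
  (forall t, U *m mexp (t *: A) *m V = 0) -> forall k, U *m A ^+ k *m V = 0.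
Proof.
move=> h k; suff : forall t, U *m A ^+ k *m mexp (t *: A) *m V = 0.
  by move/(_ 0); rewrite scale0r mexp0 mulmx1.
elim: k => [|k IH] t; first by rewrite expr0 mulmx1 h.
have hf := mderiveM (mderiveM (mderive_cst (U *m A ^+ k)) (mderive_mexp A)) (mderive_cst V).
apply/matrixP => i j; have := @derive_val _ _ _ _ _ _ _ (hf t i j).
rewrite (_ : (fun _ => _) = (fun=> 0)); last by apply/funext => s; rewrite IH mxE.
rewrite derive_cst mul0mx add0r mulmx0 addr0 => E.
by rewrite [RHS]mxE E exprSr -mulmxE !mulmxA.
Qed.

End MatrixExponential.

Section ComplexExponential.
Variable R : realType.
Local Notation C := R[i].

Lemma ReM (x y : C) : complex.Re (x * y) =
  complex.Re x * complex.Re y - complex.Im x * complex.Im y.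
Proof. by case: x => a b; case: y => c d. Qed.

Lemma ImM (x y : C) : complex.Im (x * y) =
  complex.Re x * complex.Im y + complex.Im x * complex.Re y.
Proof. by case: x => a b; case: y => c d. Qed.

Lemma Re_sum (I : Type) (r : seq I) (P : pred I) (f : I -> C) :
  complex.Re (\sum_(i <- r | P i) f i) = \sum_(i <- r | P i) complex.Re (f i).
Proof. exact: raddf_sum. Qed.

Lemma Im_sum (I : Type) (r : seq I) (P : pred I) (f : I -> C) :
  complex.Im (\sum_(i <- r | P i) f i) = \sum_(i <- r | P i) complex.Im (f i).
Proof. exact: raddf_sum. Qed.

Lemma Re_realM (x : C) (a : R) : complex.Re (x * a%:C%C) = complex.Re x * a.
Proof. by rewrite ReM /= mulr0 subr0. Qed.

Lemma Im_realM (x : C) (a : R) : complex.Im (x * a%:C%C) = complex.Im x * a.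
Proof. by rewrite ImM /= mulr0 add0r. Qed.

Lemma complex_ext (x y : C) : complex.Re x = complex.Re y -> complex.Im x = complex.Im y -> x = y.
Proof. by case: x => a b; case: y => c d /= -> ->. Qed.

Definition Rmx m n (A : 'M[C]_(m, n)) : 'M[R]_(m, n) := map_mx (@complex.Re R) A.
Definition Imx m n (A : 'M[C]_(m, n)) : 'M[R]_(m, n) := map_mx (@complex.Im R) A.

(** The embedding of complex matrices as the real matrices commuting with the complex structure; it
    transfers the theory of [mexp] to [mexpC]. *)
Definition realify m n (A : 'M[C]_(m, n)) : 'M[R]_(m + m, n + n) :=
  block_mx (Rmx A) (- Imx A) (Imx A) (Rmx A).

Lemma RmxM m n p (A : 'M[C]_(m, n)) (B : 'M[C]_(n, p)) :
  Rmx (A *m B) = Rmx A *m Rmx B - Imx A *m Imx B.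
Proof.
apply/matrixP => i j; rewrite !mxE Re_sum -sumrB; apply: eq_bigr => k _.
by rewrite !mxE ReM.
Qed.

Lemma ImxM m n p (A : 'M[C]_(m, n)) (B : 'M[C]_(n, p)) :
  Imx (A *m B) = Rmx A *m Imx B + Imx A *m Rmx B.
Proof.
apply/matrixP => i j; rewrite !mxE Im_sum -big_split; apply: eq_bigr => k _.
by rewrite !mxE ImM.
Qed.

Lemma realifyM m n p (A : 'M[C]_(m, n)) (B : 'M[C]_(n, p)) :
  realify (A *m B) = realify A *m realify B.
Proof.
rewrite /realify mulmx_block RmxM ImxM !mulNmx !mulmxN opprD.
by congr block_mx; rewrite // addrC.
Qed.

Lemma realify1 n : realify (1%:M : 'M[C]_n) = 1%:M.
Proof.
have e : Rmx (1%:M : 'M[C]_n) = 1%:M.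
  by apply/matrixP => i j; rewrite !mxE; case: (i == j).
have f : Imx (1%:M : 'M[C]_n) = 0.
  by apply/matrixP => i j; rewrite !mxE; case: (i == j).
by rewrite /realify e f oppr0 -scalar_mx_block.
Qed.

Lemma realify_inj m n : injective (@realify m n).
Proof.
move=> A B /eq_block_mx[rAB _ iAB _]; apply/matrixP => i j; apply: complex_ext.
  by have := congr1 (fun M : 'M[R]_(m, n) => M i j) rAB; rewrite !mxE.
by have := congr1 (fun M : 'M[R]_(m, n) => M i j) iAB; rewrite !mxE.
Qed.

Lemma realify0 m n : realify (0 : 'M[C]_(m, n)) = 0.
Proof.
by rewrite /realify /Rmx /Imx !map_mx0 oppr0 block_mx0.
Qed.

Lemma realifyD m n (A B : 'M[C]_(m, n)) : realify (A + B) = realify A + realify B.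
Proof.
by rewrite /realify /Rmx /Imx !map_mxD opprD add_block_mx.
Qed.

Lemma realifyX n (A : 'M[C]_n) k : realify (A ^+ k) = realify A ^+ k.
Proof.
elim: k => [|k IH]; first by rewrite !expr0 realify1.
by rewrite !exprS -!mulmxE realifyM IH.
Qed.

Lemma realify_realZ m n (t : R) (A : 'M[C]_(m, n)) :
  realify (t%:C%C *: A) = t *: realify A.
Proof.
rewrite /realify scale_block_mx scalerN; congr block_mx;
  try congr (- _); by apply/matrixP => i j; rewrite !mxE mulrC ?Re_realM ?Im_realM mulrC.
Qed.

(** The real exponential commutes with the complex structure [J], hence has the block form of a
    realified matrix; its blocks are then compared series by series. *)
Lemma realify_mexpC n (A : 'M[C]_n) : realify (mexpC A) = mexp (realify A).
Proof.
have Rk (z : C) (k : nat) : complex.Re (z / k`!%:R) = complex.Re z / k`!%:R.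
  by rewrite -(rmorph_nat (real_complex R)) -fmorphV Re_realM.
have Ik (z : C) (k : nat) : complex.Im (z / k`!%:R) = complex.Im z / k`!%:R.
  by rewrite -(rmorph_nat (real_complex R)) -fmorphV Im_realM.
pose J := block_mx 0 (- 1%:M) 1%:M 0 : 'M[R]_(n + n).
have hJ : realify A *m J = J *m realify A.
  by rewrite /realify /J !mulmx_block !(mulmx0, mul0mx, mulmx1, mul1mx, addr0, add0r, mulmxN, mulNmx, opprK).
have := mexp_intertwine hJ; set E := mexp _; rewrite -(submxK E) /J !mulmx_block.
rewrite !(mulmx0, mul0mx, mulmx1, mul1mx, addr0, add0r, mulmxN, mulNmx).
case/eq_block_mx => Eur Eul _ _.
have Edr : drsubmx E = ulsubmx E by apply: oppr_inj.
rewrite Edr Eur; congr block_mx; try congr (- _).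
- apply/matrixP => i j; rewrite !mxE /=; congr (limn (series _)).
  by apply/funext => k; rewrite -realifyX block_mxEul mxE Rk.
- apply/matrixP => i j; rewrite !mxE /=; congr (limn (series _)).
  by apply/funext => k; rewrite -realifyX block_mxEdl mxE Ik.
- apply/matrixP => i j; rewrite !mxE /=; congr (limn (series _)).
  by apply/funext => k; rewrite -realifyX block_mxEdl mxE Ik.
- apply/matrixP => i j; rewrite !mxE /=; congr (limn (series _)).
  by apply/funext => k; rewrite -realifyX block_mxEul mxE Rk.
Qed.

Local Opaque mexpC.

Lemma mexpC_intertwine n m (A : 'M[C]_n) (B : 'M[C]_m) (P : 'M[C]_(n, m)) :
  A *m P = P *m B -> mexpC A *m P = P *m mexpC B.
Proof.
move=> h; apply: realify_inj; rewrite !realifyM (realify_mexpC A) (realify_mexpC B).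
by apply: mexp_intertwine; rewrite -!realifyM h.
Qed.

Lemma mexpCD n (A B : 'M[C]_n) : A *m B = B *m A -> mexpC (A + B) = mexpC A *m mexpC B.
Proof.
move=> AB; apply: realify_inj.
rewrite [LHS]realify_mexpC [RHS]realifyM [X in _ = X *m _]realify_mexpC.
rewrite [X in _ = _ *m X]realify_mexpC realifyD.
by apply: mexpD; rewrite -!realifyM AB.
Qed.

Lemma mexpC0 n : mexpC 0 = 1%:M :> 'M[C]_n.
Proof. by apply: realify_inj; rewrite realify_mexpC realify0 mexp0 realify1. Qed.

Lemma mexpCNK n (A : 'M[C]_n) : mexpC A *m mexpC (- A) = 1%:M.
Proof. by rewrite -mexpCD ?mulmxN ?mulNmx// subrr mexpC0. Qed.

Lemma mexpC_unit n (A : 'M[C]_n) : mexpC A \in unitmx.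
Proof. by have [uA _] := mulmx1_unit (mexpCNK A); exact: uA. Qed.

Lemma mxCM m n p (A : 'M[R]_(m, n)) (B : 'M[R]_(n, p)) :
  map_mx (real_complex R) (A *m B) = map_mx (real_complex R) A *m map_mx (real_complex R) B.
Proof. exact: map_mxM. Qed.

Lemma mxCX n (A : 'M[R]_n) k : mxC A ^+ k = mxC (A ^+ k).
Proof.
elim: k => [|k IH]; first by rewrite !expr0 /mxC map_mx1.
by rewrite !exprS -!mulmxE IH /mxC mxCM.
Qed.

Local Transparent mexpC.

Lemma mexpC_real n (A : 'M[R]_n) : mexpC (mxC A) = mxC (mexp A).
Proof.
have Rk (z : C) (k : nat) : complex.Re (z / k`!%:R) = complex.Re z / k`!%:R.
  by rewrite -(rmorph_nat (real_complex R)) -fmorphV Re_realM.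
have Ik (z : C) (k : nat) : complex.Im (z / k`!%:R) = complex.Im z / k`!%:R.
  by rewrite -(rmorph_nat (real_complex R)) -fmorphV Im_realM.
apply/matrixP => i j; rewrite !mxE; apply: complex_ext => /=.
  by congr (limn (series _)); apply/funext => k; rewrite Rk mxCX mxE.
rewrite [X in limn (series X)](_ : _ = (fun=> 0)); last first.
  by apply/funext => k; rewrite Ik mxCX mxE /= mul0r.
rewrite (_ : series _ = (fun=> 0)); last by apply/funext => k; rewrite /series/= big1.
by rewrite lim_cst.
Qed.

Lemma mexpC_tr n (A : 'M[C]_n) : mexpC A^T = (mexpC A)^T.
Proof.
have trX k : (A^T) ^+ k = (A ^+ k)^T.
  elim: k => [|k IH]; first by rewrite !expr0 trmx1.
  by rewrite exprSr exprS -!mulmxE IH trmx_mul.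
apply/matrixP => i j; rewrite !mxE.
by congr (limn _ +i* limn _)%C; congr series; apply/funext => k; rewrite trX mxE.
Qed.

Local Opaque mexpC.

Lemma mexpC_vanish n m p (Y : 'M[C]_n) (U : 'M[C]_(m, n)) (V : 'M[C]_(n, p)) :
  (forall t : R, U *m mexpC (t%:C%C *: Y) *m V = 0) ->
  forall z : C, U *m mexpC (z *: Y) *m V = 0.
Proof.
move=> h z; apply: realify_inj; rewrite !realifyM (realify_mexpC (z *: Y)) realify0.
apply: mexp_vanish => k; rewrite -realifyX -!realifyM.
have ZX : (z *: Y) ^+ k = z ^+ k *: Y ^+ k.
  elim: k => [|k IH]; first by rewrite !expr0 scale1r.
  by rewrite !exprS IH -!mulmxE -scalemxAl -scalemxAr scalerA.
suff e : U *m Y ^+ k *m V = 0 by rewrite ZX -scalemxAr -scalemxAl e scaler0 realify0.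
apply: realify_inj; rewrite !realifyM realifyX realify0.
apply: mexp_deriv_vanish => t; rewrite -realify_realZ -(realify_mexpC (t%:C%C *: Y)) -!realifyM.
by rewrite h realify0.
Qed.

End ComplexExponential.

(** * Regular functions along complex one-parameter groups *)

Section ExponentialCurves.
Variable R : realType.
Local Notation C := R[i].

Lemma mexpC_tensl p q (Y : 'M[C]_p) :
  mexpC (Y *t (1%:M : 'M[C]_q)) = mexpC Y *t (1%:M : 'M[C]_q).
Proof.
have YX k : (Y *t (1%:M : 'M[C]_q)) ^+ k = Y ^+ k *t 1%:M.
  elim: k => [|k IH]; first by rewrite !expr0 tens11.
  by rewrite !exprS -!mulmxE IH tensmx_mul mul1mx.
apply/matrixP => i j; case: (mxtens_indexP i) => a b; case: (mxtens_indexP j) => c d.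
rewrite tensmxE !mxE; under eq_fun do rewrite YX tensmxE mxE.
under [X in (_ +i* limn (series X))%C]eq_fun do rewrite YX tensmxE mxE.
have s0 : limn (series (fun _ : nat => 0 : R)) = 0.
  by rewrite (_ : series _ = (fun=> 0)) ?lim_cst//; apply/funext => k; rewrite /series/= big1.
case: (b == d).
  by rewrite mulr1; congr (limn (series _) +i* limn (series _))%C; apply/funext => k; rewrite mulr1.
rewrite mulr0; congr (_ +i* _)%C; rewrite -[RHS]s0; congr (limn (series _)).
  by apply/funext => k; rewrite mulr0 mul0r.
by apply/funext => k; rewrite mulr0 mul0r.
Qed.

Lemma mexpC_tensr p q (Y : 'M[C]_q) :
  mexpC ((1%:M : 'M[C]_p) *t Y) = (1%:M : 'M[C]_p) *t mexpC Y.
Proof.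
have YX k : ((1%:M : 'M[C]_p) *t Y) ^+ k = 1%:M *t Y ^+ k.
  elim: k => [|k IH]; first by rewrite !expr0 tens11.
  by rewrite !exprS -!mulmxE IH tensmx_mul mul1mx.
apply/matrixP => i j; case: (mxtens_indexP i) => a b; case: (mxtens_indexP j) => c d.
rewrite tensmxE !mxE; under eq_fun do rewrite YX tensmxE mxE.
under [X in (_ +i* limn (series X))%C]eq_fun do rewrite YX tensmxE mxE.
have s0 : limn (series (fun _ : nat => 0 : R)) = 0.
  by rewrite (_ : series _ = (fun=> 0)) ?lim_cst//; apply/funext => k; rewrite /series/= big1.
case: (a == c).
  by rewrite mul1r; congr (limn (series _) +i* limn (series _))%C; apply/funext => k; rewrite mul1r.
rewrite mul0r; congr (_ +i* _)%C; rewrite -[RHS]s0; congr (limn (series _)).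
  by apply/funext => k; rewrite mul0r mul0r.
by apply/funext => k; rewrite mul0r mul0r.
Qed.

Local Opaque mexpC.

(* This class of functions is a ring, by block sums and Kronecker products. *)
Definition exp_entry (F : C -> C) := exists p, exists Y : 'M[C]_p,
  exists u : 'rV[C]_p, exists v : 'cV[C]_p, forall z, F z = (u *m mexpC (z *: Y) *m v) 0 0.

Lemma exp_entry_ext F G : (forall z, F z = G z) -> exp_entry F -> exp_entry G.
Proof. by move=> FG [p [Y [u [v h]]]]; exists p, Y, u, v => z; rewrite -FG. Qed.

Lemma exp_entry_cst c : exp_entry (fun=> c).
Proof.
exists 1%N, 0, c%:M, 1%:M => z.
by rewrite scaler0 mexpC0 !mulmx1 mxE eqxx mulr1n.
Qed.

Lemma exp_entry_coord n (X : 'M[C]_n) i j : exp_entry (fun z => mexpC (z *: X) i j).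
Proof.
exists n, X, (delta_mx 0 i), (delta_mx j 0) => z.
by rewrite -rowE -colE [RHS]mxE [RHS]mxE.
Qed.

Lemma exp_entryD F G : exp_entry F -> exp_entry G -> exp_entry (fun z => F z + G z).
Proof.
move=> [p [Y [u [v hF]]]] [q [Z [w [x hG]]]].
exists (p + q)%N, (block_mx Y 0 0 Z), (row_mx u w), (col_mx v x) => z.
set E := mexpC (z *: block_mx _ _ _ _).
have h1 : (z *: Y) *m row_mx 1%:M 0 = row_mx 1%:M 0 *m (z *: block_mx Y 0 0 Z).
  by rewrite -scalemxAl -scalemxAr mul_mx_row mul_row_block !(mulmx1, mulmx0, mul0mx, mul1mx, addr0).
have h2 : (z *: Z) *m row_mx 0 1%:M = row_mx 0 1%:M *m (z *: block_mx Y 0 0 Z).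
  by rewrite -scalemxAl -scalemxAr mul_mx_row mul_row_block !(mulmx1, mulmx0, mul0mx, mul1mx, add0r).
have uw : row_mx u w = u *m row_mx 1%:M 0 + w *m row_mx 0 1%:M.
  by rewrite !mul_mx_row !mulmx1 !mulmx0 add_row_mx addr0 add0r.
rewrite uw [X in X *m _]mulmxDl -(mulmxA u) -(mulmxA w).
rewrite -(mexpC_intertwine h1) -(mexpC_intertwine h2) mulmxDl -!mulmxA !mul_row_col.
by rewrite !mul0mx !mul1mx addr0 add0r hF hG [in RHS]mxE -!mulmxA.
Qed.

Lemma exp_entryM F G : exp_entry F -> exp_entry G -> exp_entry (fun z => F z * G z).
Proof.
move=> [p [Y [u [v hF]]]] [q [Z [w [x hG]]]].
exists (p * q)%N, (Y *t 1%:M + 1%:M *t Z), (u *t w), (v *t x) => z.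
have -> : mexpC (z *: (Y *t 1%:M + 1%:M *t Z)) = mexpC (z *: Y) *t mexpC (z *: Z).
  rewrite scalerDr -tensZl -tensZr mexpCD; last first.
    by rewrite !tensmx_mul !mulmx1 !mul1mx.
  by rewrite mexpC_tensl mexpC_tensr tensmx_mul mulmx1 mul1mx.
have := tensmxE (u *m mexpC (z *: Y) *m v) (w *m mexpC (z *: Z) *m x) 0 0 0 0.
rewrite -!tensmx_mul hF hG => <-.
by congr (fun_of_matrix _ _ _); apply: ord_inj.
Qed.

Lemma exp_entry_sum (I : Type) (r : seq I) (P : pred I) (F : I -> C -> C) :
  (forall i, exp_entry (F i)) -> exp_entry (fun z => \sum_(i <- r | P i) F i z).
Proof.
move=> h; elim: r => [|i r IH].
  by apply: exp_entry_ext (exp_entry_cst 0) => z; rewrite big_nil.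
have [Pi|Pi] := boolP (P i).
  by apply: exp_entry_ext (exp_entryD (h i) IH) => z; rewrite big_cons Pi.
by apply: exp_entry_ext IH => z; rewrite big_cons (negbTE Pi).
Qed.

Lemma exp_entry_prod (I : Type) (r : seq I) (P : pred I) (F : I -> C -> C) :
  (forall i, exp_entry (F i)) -> exp_entry (fun z => \prod_(i <- r | P i) F i z).
Proof.
move=> h; elim: r => [|i r IH].
  by apply: exp_entry_ext (exp_entry_cst 1) => z; rewrite big_nil.
have [Pi|Pi] := boolP (P i).
  by apply: exp_entry_ext (exp_entryM (h i) IH) => z; rewrite big_cons Pi.
by apply: exp_entry_ext IH => z; rewrite big_cons (negbTE Pi).
Qed.

Lemma det_mexpC_inv n (X : 'M[C]_n) : (\det (mexpC X))^-1 = \det (mexpC (- X)).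
Proof.
have h : \det (mexpC X) * \det (mexpC (- X)) = 1 by rewrite -det_mulmx mexpCNK det1.
have d0 : \det (mexpC X) != 0 by move: (mexpC_unit X); rewrite unitmxE unitfE.
by apply: (mulfI d0); rewrite h mulfV.
Qed.

(** The inverse determinant stays in the class because it is the determinant of the exponential of
    $-X$. *)
Lemma exp_entry_regular A n (f : 'M[C]_n -> C) (X : 'M[C]_n) :
  regular A f -> exp_entry (fun z => f (mexpC (z *: X))).
Proof.
elim=> {f} [c _|i j||f h _ IHf _ IHh|f h _ IHf _ IHh].
- exact: exp_entry_cst.
- exact: exp_entry_coord.
- apply: (@exp_entry_ext (fun z => \det (mexpC (z *: - X)))).
    by move=> z; rewrite [in RHS]det_mexpC_inv scalerN.
  apply: exp_entry_sum => s; apply: exp_entryM; first exact: exp_entry_cst.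
  by apply: exp_entry_prod => i; exact: exp_entry_coord.
- exact: exp_entryD.
- exact: exp_entryM.
Qed.

Lemma exp_entry_eq0 F : exp_entry F -> (forall t : R, F t%:C%C = 0) -> forall z, F z = 0.
Proof.
move=> [p [Y [u [v hF]]]] h z; rewrite hF mexpC_vanish ?mxE// => t.
by rewrite [LHS]mx11_scalar -hF h raddf0.
Qed.

(** Passes from real to complex parameters, which is how the Lie algebra of the real points is
    compared with that of the complex group. *)
Lemma zariski_closed_mexpC A n (Z : set 'M[C]_n) (X : 'M[C]_n) : zariski_closed A Z ->
  (forall t : R, Z (mexpC (t%:C%C *: X))) -> forall z, Z (mexpC (z *: X)).
Proof.
move=> [S SA ->] h z; split; first exact: mexpC_unit.
move=> f Sf; apply: (exp_entry_eq0 (exp_entry_regular X (SA _ Sf))) => t.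
by have [_] := h t; apply.
Qed.

End ExponentialCurves.

(** * Exponential sums and Zariski closed sets containing all powers *)

Section RealExponentialSums.
Variable R : realType.
Local Notation C := R[i].

Lemma polynomial_interpolation (xs : seq R) (h : R -> R) :
  exists P : {poly R}, forall x, x \in xs -> P.[x] = h x.
Proof.
elim: xs => [|x0 xs [P hP]]; first by exists 0.
have [x0xs|x0xs] := boolP (x0 \in xs).
  by exists P => x; rewrite inE => /orP[/eqP ->|]; apply: hP.
pose N := \prod_(x <- xs) ('X - x%:P).
have Nx x : (N.[x] == 0) = (x \in xs) by rewrite -/(root _ _) root_prod_XsubC.
exists (P + ((h x0 - P.[x0]) / N.[x0])%:P * N) => x.
rewrite hornerD hornerM hornerC inE => /orP[/eqP ->|xxs].
  by rewrite divfK ?Nx// addrC subrK.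
by have /eqP -> : N.[x] == 0 by [rewrite Nx]; rewrite mulr0 addr0 hP.
Qed.

Definition exp_sum (F : R -> C) :=
  exists s : seq (C * R), forall t, F t = \sum_(p <- s) p.1 * (expR (t * p.2))%:C%C.

Lemma exp_sum_ext F G : (forall t, F t = G t) -> exp_sum F -> exp_sum G.
Proof. by move=> FG [s h]; exists s => t; rewrite -FG. Qed.

Lemma exp_sum_cst c : exp_sum (fun=> c).
Proof. by exists [:: (c, 0)] => t; rewrite big_seq1 /= mulr0 expR0 mulr1. Qed.

Lemma exp_sum_expR d : exp_sum (fun t => (expR (t * d))%:C%C).
Proof. by exists [:: (1, d)] => t; rewrite big_seq1 /= mul1r. Qed.

Lemma exp_sumD F G : exp_sum F -> exp_sum G -> exp_sum (fun t => F t + G t).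
Proof.
by move=> [s hF] [r hG]; exists (s ++ r) => t; rewrite big_cat hF hG.
Qed.

Lemma exp_sumM F G : exp_sum F -> exp_sum G -> exp_sum (fun t => F t * G t).
Proof.
move=> [s hF] [r hG]; exists [seq (p.1 * q.1, p.2 + q.2) | p <- s, q <- r] => t.
rewrite big_allpairs_dep hF hG mulr_suml; apply: eq_bigr => p _.
rewrite mulr_sumr; apply: eq_bigr => q _ /=.
by rewrite mulrDr expRD rmorphM mulrACA.
Qed.

Lemma exp_sum_sum (I : Type) (r : seq I) (P : pred I) (F : I -> R -> C) :
  (forall i, exp_sum (F i)) -> exp_sum (fun t => \sum_(i <- r | P i) F i t).
Proof.
move=> h; elim: r => [|i r IH].
  by apply: exp_sum_ext (exp_sum_cst 0) => t; rewrite big_nil.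
have [Pi|Pi] := boolP (P i).
  by apply: exp_sum_ext (exp_sumD (h i) IH) => t; rewrite big_cons Pi.
by apply: exp_sum_ext IH => t; rewrite big_cons (negbTE Pi).
Qed.

Lemma exp_sum_prod (I : Type) (r : seq I) (P : pred I) (F : I -> R -> C) :
  (forall i, exp_sum (F i)) -> exp_sum (fun t => \prod_(i <- r | P i) F i t).
Proof.
move=> h; elim: r => [|i r IH].
  by apply: exp_sum_ext (exp_sum_cst 1) => t; rewrite big_nil.
have [Pi|Pi] := boolP (P i).
  by apply: exp_sum_ext (exp_sumM (h i) IH) => t; rewrite big_cons Pi.
by apply: exp_sum_ext IH => t; rewrite big_cons (negbTE Pi).
Qed.

(** For fixed $t$ a polynomial $P$ with $P(e^a) = e^{ta}$ at the finitely many exponents $a$ exists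
    by interpolation. It writes $F(t)$ as $\sum_k P_k F(k)$, a combination of values at natural
    numbers. *)
Lemma exp_sum_eq0 F : exp_sum F -> (forall k : nat, F k%:R = 0) -> forall t, F t = 0.
Proof.
move=> [s hF] h t.
have [P hP] := polynomial_interpolation [seq expR p.2 | p <- s] (fun x => expR (t * ln x)).
transitivity (\sum_(k < size P) (P`_k)%:C%C * F k%:R); last first.
  by rewrite big1// => k _; rewrite h mulr0.
transitivity (\sum_(p <- s) p.1 * (P.[expR p.2])%:C%C).
  rewrite hF; apply: eq_big_seq => p ps.
  by rewrite hP ?expRK//; apply: map_f.
under [RHS]eq_bigr => k _ do rewrite hF mulr_sumr.
rewrite exchange_big/=; apply: eq_bigr => p _.
rewrite horner_coef rmorph_sum mulr_sumr; apply: eq_bigr => k _.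
by rewrite rmorphM -expRM_natl mulr_natl /= mulrCA.
Qed.

Lemma mexp_diag n (d : 'rV[R]_n) : mexp (diag_mx d) = diag_mx (map_mx expR d).
Proof.
have dX k : diag_mx d ^+ k = diag_mx (map_mx (fun x => x ^+ k) d).
  elim: k => [|k IH].
    by rewrite expr0; apply/matrixP => i j; rewrite !mxE expr0.
  rewrite exprS IH -mulmxE mulmx_diag; congr diag_mx.
  by apply/rowP => j; rewrite !mxE exprS.
apply/matrixP => i j; rewrite !mxE; under eq_fun do rewrite dX !mxE.
have [->|ij] := eqVneq i j; first by rewrite mulr1n.
rewrite mulr0n (_ : series _ = (fun=> 0)) ?lim_cst//.
by apply/funext => k; rewrite /series/= big1// => l _; rewrite mulr0n mul0r.
Qed.

Lemma mexp_conj n (Q A : 'M[R]_n) : Q \in unitmx ->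
  mexp (invmx Q *m A *m Q) = invmx Q *m mexp A *m Q.
Proof.
move=> uQ; have h : invmx Q *m A *m Q *m invmx Q = invmx Q *m A by rewrite mulmxK.
by rewrite -[LHS](mulmxK (_ : invmx Q \in unitmx)) ?unitmx_inv// invmxK (mexp_intertwine h).
Qed.

Lemma mexp_diagonalizable n (Q : 'M[R]_n) (d : 'rV[R]_n) t : Q \in unitmx ->
  mexp (t *: (invmx Q *m diag_mx d *m Q)) =
  invmx Q *m diag_mx (map_mx (fun x => expR (t * x)) d) *m Q.
Proof.
move=> uQ; rewrite scalemxAl scalemxAr mexp_conj//; congr (_ *m _ *m _).
have -> : t *: diag_mx d = diag_mx (t *: d) by rewrite linearZ.
by rewrite mexp_diag; congr diag_mx; apply/rowP => j; rewrite !mxE.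
Qed.

Local Opaque mexpC mexp.

Lemma det_mexp_inv n (X : 'M[R]_n) :
  (\det (mxC (mexp X)))^-1 = \det (mxC (mexp (- X))).
Proof.
have e : - mxC X = mxC (- X) by rewrite /mxC map_mxN.
by have := det_mexpC_inv (mxC X); rewrite e mexpC_real (mexpC_real (- X)).
Qed.

Lemma exp_sum_regular A n (f : 'M[C]_n -> C) (Q : 'M[R]_n) (d : 'rV[R]_n) :
  Q \in unitmx -> regular A f ->
  exp_sum (fun t => f (mxC (mexp (t *: (invmx Q *m diag_mx d *m Q))))).
Proof.
move=> uQ.
have coord d' i j : exp_sum (fun t => mxC (mexp (t *: (invmx Q *m diag_mx d' *m Q))) i j).
  apply: (@exp_sum_ext (fun t => \sum_k (invmx Q i k)%:C%C * (Q k j)%:C%C * (expR (t * d' 0 k))%:C%C)).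
    move=> t; rewrite mexp_diagonalizable// !mxE rmorph_sum; apply: eq_bigr => k _ /=.
    rewrite mul_mx_diag !mxE !rmorphM /=; ring.
  apply: exp_sum_sum => k; apply: exp_sumM; first exact: exp_sum_cst.
  exact: exp_sum_expR.
elim=> {f} [c _|i j||f h _ IHf _ IHh|f h _ IHf _ IHh].
- exact: exp_sum_cst.
- exact: coord.
- apply: (@exp_sum_ext (fun t => \det (mxC (mexp (t *: (invmx Q *m diag_mx (- d) *m Q)))))).
    move=> t; rewrite [RHS]det_mexp_inv; congr (\det (mxC (mexp _))).
    by rewrite linearN/= mulmxN mulNmx scalerN.
  apply: exp_sum_sum => s; apply: exp_sumM; first exact: exp_sum_cst.
  by apply: exp_sum_prod => i; exact: coord.
- exact: exp_sumD.
- exact: exp_sumM.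
Qed.

Lemma zariski_closed_powers A n (Z : set 'M[C]_n) (Q : 'M[R]_n) (d : 'rV[R]_n) :
  Q \in unitmx -> zariski_closed A Z ->
  (forall k : nat, Z (mxC (mexp (k%:R *: (invmx Q *m diag_mx d *m Q))))) ->
  forall t, Z (mxC (mexp (t *: (invmx Q *m diag_mx d *m Q)))).
Proof.
move=> uQ [S SA ->] h t; split; first by rewrite -mexpC_real mexpC_unit.
move=> f Sf; apply: (exp_sum_eq0 (exp_sum_regular d uQ (SA _ Sf))) => k.
by have [_] := h k; apply.
Qed.

End RealExponentialSums.

(** * Smoothness of the polar decomposition *)

Section ClassC.
Variable R : realType.

(** Fréchet differentiability with its derivative named and the remainder as an explicit inequality,
    so that estimates can be added and multiplied. *)
Definition has_diff (V W : normedModType R) (f : V -> W) x (L : {linear V -> W}) :=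
  continuous L /\ forall e, 0 < e -> \forall y \near x, `|f y - f x - L (y - x)| <= e * `|y - x|.

Lemma has_diff_differentiable (V W : normedModType R) (f : V -> W) x L :
  has_diff f x L -> differentiable f x /\ forall v, 'D_v f x = L v.
Proof.
move=> [cL hL].
have E : f \o shift x = cst (f x) + L +o_ 0 id.
  apply/eqaddoP => e e0; have := hL e e0; rewrite (near_shift 0) /= subr0.
  apply: filter_app; apply: nearW => y /=.
  by rewrite addrK opprD addrA.
have D : differentiable f x.
  by apply/diff_locallyP; rewrite (diff_unique cL E).
by split=> // v; rewrite deriveE// (diff_unique cL E).
Qed.

Lemma differentiable_has_diff (V W : normedModType R) (f : V -> W) x :
  differentiable f x -> has_diff f x ('d f x).
Proof.
move=> D; split; first exact: diff_continuous.
move=> e e0; rewrite (near_shift 0) subr0.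
have /diff_locallyP[_ /eqaddoP/(_ e e0)] := D.
apply: filter_app; apply: nearW => y /=.
by rewrite addrK opprD addrA.
Qed.

Lemma mx_norm_mulmx m n p (A : 'M[R]_(m, n)) (B : 'M[R]_(n, p)) :
  `|A *m B| <= n%:R * `|A| * `|B|.
Proof.
rewrite [leLHS]/Num.Def.normr/= mx_normrE (bigmax_le _ _)//.
move=> i _; rewrite mxE; apply: le_trans (ler_norm_sum _ _ _) _.
apply: le_trans (_ : \sum_(k < n) `|A| * `|B| <= _); last first.
  by rewrite sumr_const card_ord -mulrA mulr_natl.
apply: ler_sum => k _; rewrite normrM ler_pM//.
  by rewrite {2}/Num.Def.normr/= mx_normrE; apply/bigmax_geP; right; exists (i.1, k).
by rewrite {2}/Num.Def.normr/= mx_normrE; apply/bigmax_geP; right; exists (k, i.2).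
Qed.

(* Only continuity of [G] is needed since [H x = 0]. Applied to the
   identities [g y^-1 - g x^-1 = - g x^-1 (g y - g x) g y^-1] and
   [sqrt_diff], it turns continuity of the inverse and of the square root into
   differentiability. *)
Lemma has_diff_mul0 (V : normedModType R) m n p (H : V -> 'M[R]_(m, n))
    (G : V -> 'M[R]_(n, p)) x L :
  H x = 0 -> has_diff H x L -> {for x, continuous G} ->
  has_diff (fun y => H y *m G y) x (mulmxr (G x) \o L : {linear V -> 'M[R]_(m, p)}).
Proof.
move=> H0 [cL hL] cG; split.
  apply: continuous_filter => F a FF Fa /=.
  apply: cvg_mulmx; last exact: cvg_cst.
  by apply: cvg_trans (cL a); exact: cvg_app.
move=> e e0; have [k k0 Lk] := linear_lipschitz cL.
pose C := n%:R * (`|G x| + 1) + 1; pose C' := n%:R * k + 1.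
have C0 : 0 < C by rewrite ltr_wpDl// mulr_ge0// addr_ge0.
have C'0 : 0 < C' by rewrite ltr_wpDl// mulr_ge0// ltW.
have e1 : 0 < e / 2 / C by rewrite !divr_gt0.
have e2 : 0 < e / 2 / C' by rewrite !divr_gt0.
have := hL _ e1; apply: filter_app.
have /cvgrPdist_le/(_ _ e2) := cG; apply: filter_app.
have /cvgrPdist_le/(_ _ ltr01) := cG; apply: filter_app.
apply: nearW => y /= h1 h2 h3.
rewrite H0 mul0mx subr0; rewrite H0 subr0 in h3.
have -> : H y *m G y - L (y - x) *m G x =
    (H y - L (y - x)) *m G y + L (y - x) *m (G y - G x).
  by rewrite mulmxBl mulmxBr addrA subrK.
apply: le_trans (ler_normD _ _) _.
have hG : `|G y| <= `|G x| + 1.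
  by rewrite -lerBlDl; apply: le_trans (lerB_dist _ _) _; rewrite distrC.
rewrite [e]splitr mulrDl; apply: lerD.
  apply: le_trans (mx_norm_mulmx _ _) _.
  apply: le_trans (_ : n%:R * (e / 2 / C * `|y - x|) * (`|G x| + 1) <= _).
    by rewrite ler_pM ?mulr_ge0// ler_wpM2l.
  rewrite (_ : n%:R * _ * _ = (e / 2 * `|y - x|) * (n%:R * (`|G x| + 1) / C)); last by ring.
  rewrite ler_piMr ?mulr_ge0 ?divr_ge0 ?(ltW e0)//.
  by rewrite ler_pdivrMr// mul1r /C lerDl.
apply: le_trans (mx_norm_mulmx _ _) _.
apply: le_trans (_ : n%:R * (k * `|y - x|) * (e / 2 / C') <= _).
  by rewrite ler_pM ?mulr_ge0// ?ler_wpM2l// distrC.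
rewrite (_ : n%:R * _ * _ = (e / 2 * `|y - x|) * (n%:R * k / C')); last by ring.
rewrite ler_piMr ?mulr_ge0 ?divr_ge0 ?(ltW e0)//.
by rewrite ler_pdivrMr// mul1r /C' lerDl.
Qed.

Lemma has_diff_ext (V W : normedModType R) (f g : V -> W) x L :
  (\forall y \near x, f y = g y) -> has_diff f x L -> has_diff g x L.
Proof.
move=> fg [cL hL]; split=> // e e0; have := hL e e0; apply: filter_app.
have fgx : f x = g x by exact: nbhs_singleton fg.
by move: fg; apply: filter_app; apply: nearW => y ->; rewrite fgx.
Qed.

Lemma has_diff_comp_linear (V W W' : normedModType R) (f : V -> W) x L
    (T : {linear W -> W'}) : continuous T ->
  has_diff f x L -> has_diff (T \o f) x (T \o L : {linear V -> W'}).
Proof.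
move=> cT [cL hL]; split; first by move=> y; apply: continuous_comp; [exact: cL | exact: cT].
move=> e e0; have [k k0 Tk] := linear_lipschitz cT.
have := hL (e / k) (divr_gt0 e0 k0); apply: filter_app; apply: nearW => y h /=.
rewrite -!linearB; apply: le_trans (Tk _) _.
by rewrite mulrC -ler_pdivlMr// mulrAC.
Qed.

Lemma has_diff_add (V W : normedModType R) (f g : V -> W) x L M :
  has_diff f x L -> has_diff g x M ->
  has_diff (fun y => f y + g y) x (L \+ M : {linear V -> W}).
Proof.
move=> [cL hL] [cM hM]; split; first by move=> y; exact: (cvgD (cL y) (cM y)).
move=> e e0; have e2 : 0 < e / 2 by rewrite divr_gt0.
have := hL _ e2; apply: filter_app; have := hM _ e2; apply: filter_app.
apply: nearW => y h1 h2 /=.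
rewrite (_ : _ - _ = (f y - f x - L (y - x)) + (g y - g x - M (y - x))); last first.
  by rewrite [RHS]addrACA [X in _ = X + _]addrACA -!opprD.
by rewrite (le_trans (ler_normD _ _))// [e]splitr mulrDl lerD.
Qed.

Lemma has_diff_cst (V W : normedModType R) (c : W) (x : V) :
  has_diff (fun=> c) x (\0 : {linear V -> W}).
Proof.
split; first by move=> y; exact: cvg_cst.
by move=> e e0; apply: nearW => y; rewrite subrr subr0 normr0 mulr_ge0// ltW.
Qed.

Lemma has_diff_addr_cst (V W : normedModType R) (f : V -> W) c x L :
  has_diff f x L -> has_diff (fun y => f y + c) x L.
Proof.
move=> [cL hL]; split=> // e e0; have := hL _ e0; apply: filter_app; apply: nearW => y.
by rewrite opprD addrACA subrr addr0.
Qed.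

Lemma has_diff_linear (V W : normedModType R) (T : {linear V -> W}) x :
  continuous T -> has_diff T x T.
Proof.
move=> cT; split=> // e e0; apply: nearW => y.
by rewrite -linearB subrr normr0 mulr_ge0// ltW.
Qed.

Lemma has_diff_continuous (V W : normedModType R) (f : V -> W) x L :
  has_diff f x L -> {for x, continuous f}.
Proof. by move=> /has_diff_differentiable[D _]; exact: differentiable_continuous. Qed.

End ClassC.

Section ClassCCalculus.
Variable R : realType.

Lemma class_C_ext r (V W : normedModType R) (U : set V) (f g : V -> W) :
  open U -> (forall x, U x -> f x = g x) -> class_C r U f -> class_C r U g.
Proof.
move=> oU; elim: r f g => [|r IH] f g fg.
  move=> cf x Ux; apply: cvg_trans (_ : f y @[y --> x] --> _).
    by apply: near_eq_cvg; move: (oU); rewrite openE => /(_ x Ux); apply: filter_app; apply: nearW.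
  by rewrite -fg//; exact: cf.
move=> /= [df cf].
have h x : U x -> differentiable g x /\ forall v, 'D_v g x = 'D_v f x.
  move=> Ux; have := differentiable_has_diff (df x Ux) => H.
  have [] := has_diff_differentiable (has_diff_ext (g := g) _ H).
    by move: (oU); rewrite openE => /(_ x Ux); apply: filter_app; apply: nearW.
  by move=> dg Dg; split=> // v; rewrite Dg deriveE//; exact: df.
split=> [x /h[]//|v]; apply: IH (cf v) => x Ux.
by rewrite (h x Ux).2.
Qed.

(** The inductive step for the closure properties below: a formula [F v x] for the directional
    derivatives that is itself of class $C^r$ suffices. *)
Lemma class_CS r (V W : normedModType R) (U : set V) (f : V -> W) (F : V -> V -> W) :
  open U ->
  (forall x, U x -> exists L : {linear V -> W}, has_diff f x L /\ forall v, L v = F v x) ->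
  (forall v, class_C r U (F v)) -> class_C r.+1 U f.
Proof.
move=> oU h cF; split=> [x /h[L [/has_diff_differentiable[]//]]|v].
apply: class_C_ext (cF v) => // x /h[L [/has_diff_differentiable[_ ->]]].
by move=> ->.
Qed.

Lemma class_C_has_diff r (V W : normedModType R) (U : set V) (f : V -> W) x :
  class_C r.+1 U f -> U x -> exists L : {linear V -> W}, has_diff f x L /\ forall v, L v = 'D_v f x.
Proof.
move=> [df _] /df D; exists ('d f x); split; first exact: differentiable_has_diff.
by move=> v; rewrite deriveE.
Qed.

Lemma class_C_le r (V W : normedModType R) (U : set V) (f : V -> W) :
  class_C r.+1 U f -> class_C r U f.
Proof.
elim: r f => [|r IH] f [df cf].
  by move=> x Ux; exact: differentiable_continuous (df x Ux).
by split=> // v; exact: IH.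
Qed.

Lemma class_C_cst r (V W : normedModType R) (U : set V) (c : W) :
  open U -> class_C r U (fun=> c).
Proof.
move=> oU; elim: r c => [|r IH] c; first by move=> x _; exact: cvg_cst.
apply: (class_CS oU (F := fun _ _ => 0)) => // x Ux.
by exists (\0 : {linear V -> W}); split=> //; exact: has_diff_cst.
Qed.

Lemma class_C_linear r (V W : normedModType R) (U : set V) (T : {linear V -> W}) :
  open U -> continuous T -> class_C r U T.
Proof.
move=> oU cT; case: r => [|r]; first by move=> x _; exact: cT.
apply: (class_CS oU (F := fun v _ => T v)) => [x Ux|v].
  by exists T; split=> //; exact: has_diff_linear.
exact: class_C_cst.
Qed.

Lemma class_C_comp_linear r (V W W' : normedModType R) (U : set V) (f : V -> W)
    (T : {linear W -> W'}) :
  open U -> continuous T -> class_C r U f -> class_C r U (T \o f).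
Proof.
move=> oU cT; elim: r f => [|r IH] f cf.
  by move=> x /cf fx; apply: continuous_comp; [exact: fx | exact: cT].
apply: (class_CS oU (F := fun v => T \o (fun x => 'D_v f x))) => [x Ux|v].
  have [L [hL Lv]] := class_C_has_diff cf Ux.
  exists (T \o L : {linear V -> W'}); split; first exact: has_diff_comp_linear.
  by move=> v /=; rewrite Lv.
by apply: IH; exact: cf.2.
Qed.

Lemma class_CD r (V W : normedModType R) (U : set V) (f g : V -> W) :
  open U -> class_C r U f -> class_C r U g -> class_C r U (fun x => f x + g x).
Proof.
move=> oU; elim: r f g => [|r IH] f g cf cg.
  by move=> x Ux; exact: cvgD (cf x Ux) (cg x Ux).
apply: (class_CS oU (F := fun v x => 'D_v f x + 'D_v g x)) => [x Ux|v].
  have [L [hL Lv]] := class_C_has_diff cf Ux.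
  have [M [hM Mv]] := class_C_has_diff cg Ux.
  exists (L \+ M : {linear V -> W}); split; first exact: has_diff_add.
  by move=> v /=; rewrite Lv Mv.
by apply: IH; [exact: cf.2 | exact: cg.2].
Qed.

Lemma linear_mulmx_continuous m n p (B : 'M[R]_(m, n)) :
  continuous (mulmx B : 'M[R]_(n, p) -> 'M[R]_(m, p)).
Proof.
by apply: continuous_filter => F a FF Fa; apply: cvg_mulmx => //; exact: cvg_cst.
Qed.

(** The Leibniz rule, from $fg = (f - f(x))g + f(x)g$: the first factor vanishes at $x$, and the
    second term is linear in $g$. *)
Lemma has_diff_mulmx (V : normedModType R) m n p (f : V -> 'M[R]_(m, n))
    (g : V -> 'M[R]_(n, p)) x L M :
  has_diff f x L -> has_diff g x M ->
  has_diff (fun y => f y *m g y) x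
    ((mulmxr (g x) \o L) \+ (mulmx (f x) \o M) : {linear V -> 'M[R]_(m, p)}).
Proof.
move=> hL hM.
have h1 : has_diff (fun y => (f y + - f x) *m g y) x (mulmxr (g x) \o L : {linear V -> 'M[R]_(m, p)}).
  apply: has_diff_mul0; first by rewrite subrr.
    exact: has_diff_addr_cst.
  exact: has_diff_continuous hM.
have h2 : has_diff (mulmx (f x) \o g) x (mulmx (f x) \o M : {linear V -> 'M[R]_(m, p)}).
  by apply: has_diff_comp_linear => //; exact: linear_mulmx_continuous.
apply: has_diff_ext (has_diff_add h1 h2); apply: nearW => y /=.
by rewrite mulmxBl subrK.
Qed.

Lemma class_C_mulmx r (V : normedModType R) (U : set V) m n p (f : V -> 'M[R]_(m, n))
    (g : V -> 'M[R]_(n, p)) :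
  open U -> class_C r U f -> class_C r U g -> class_C r U (fun x => f x *m g x).
Proof.
move=> oU; elim: r f g => [|r IH] f g cf cg.
  move=> x Ux; have ff : Filter (nbhs x) by exact: nbhs_filter.
  by apply: cvg_mulmx; [exact: cf | exact: cg].
apply: (class_CS oU (F := fun v x => 'D_v f x *m g x + f x *m 'D_v g x)) => [x Ux|v].
  have [L [hL Lv]] := class_C_has_diff cf Ux.
  have [M [hM Mv]] := class_C_has_diff cg Ux.
  eexists; split; first exact: (has_diff_mulmx hL hM).
  by move=> v /=; rewrite Lv Mv.
by apply: class_CD => //; apply: IH; first [exact: cf.2 | exact: cg.2 | exact: class_C_le].
Qed.

Lemma class_C_invmx r (V : normedModType R) (U : set V) n (f : V -> 'M[R]_n) :
  open U -> (forall x, U x -> f x \in unitmx) ->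
  class_C r U f -> class_C r U (fun x => invmx (f x)).
Proof.
move=> oU uf; elim: r f uf => [|r IH] f uf cf.
  move=> x Ux; have ff : Filter (nbhs x) by exact: nbhs_filter.
  apply: cvg_invmx; [exact: uf | | exact: cf].
  by move: (oU); rewrite openE => /(_ x Ux); apply: filter_app; apply: nearW => y /uf.
pose F v x : 'M[R]_n := - (invmx (f x) *m 'D_v f x *m invmx (f x)).
have cf0 := class_C_le cf; have ci := IH f uf cf0.
apply: (class_CS oU (F := F)) => [x Ux|v]; last first.
  rewrite /F; apply: (class_C_comp_linear (T := -%R : {linear 'M[R]_n -> 'M[R]_n}) oU).
    by move=> y; exact: opp_continuous.
  by apply: class_C_mulmx => //; apply: class_C_mulmx => //; exact: cf.2.
have [L [hL Lv]] := class_C_has_diff cf Ux.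
have ic : {for x, continuous (fun y => invmx (f y))}.
  have ff : Filter (nbhs x) by exact: nbhs_filter.
  apply: cvg_invmx; [exact: uf | | exact: has_diff_continuous hL].
  by move: (oU); rewrite openE => /(_ x Ux); apply: filter_app; apply: nearW => y /uf.
have h0 := has_diff_comp_linear (T := mulmx (- invmx (f x)) : {linear 'M[R]_n -> 'M[R]_n})
   (@linear_mulmx_continuous _ _ _ _) (has_diff_addr_cst (- f x) hL).
have h1 := has_diff_mul0 _ h0 ic.
have {h1} := h1 _; rewrite /= subrr mulmx0 => /(_ erefl)/(has_diff_addr_cst (invmx (f x))) h1.
eexists; split.
  apply: has_diff_ext h1.
  move: (oU); rewrite openE => /(_ x Ux); apply: filter_app; apply: nearW => y /uf uy.
  rewrite mulmxBr mulmxBl !mulNmx (mulVmx (uf x Ux)) -(mulmxA _ (f y)) mulmxV// mulmx1 mul1mx.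
  by rewrite opprK addrAC addNr add0r.
by move=> v /=; rewrite Lv /F !mulNmx.
Qed.

End ClassCCalculus.

(** * Smoothness of the positive square root *)

Section SmoothSquareRoot.
Variable R : realType.

Lemma mx_linear_continuous m n (W : normedModType R) (T : {linear 'M[R]_(m, n) -> W}) :
  continuous T.
Proof.
apply: continuous_filter => F a FF Fa.
have E A : T A = \sum_i \sum_j A i j *: T (delta_mx i j).
  rewrite {1}[A]matrix_sum_delta linear_sum; apply: eq_bigr => i _.
  by rewrite linear_sum; apply: eq_bigr => j _; rewrite linearZZ.
rewrite E (eq_fun E); apply: cvg_big => [|i _]; first exact: add_continuous.
apply: cvg_big => [|j _]; first exact: add_continuous.
by apply: cvgZr_tmp; exact: cvg_coord.
Qed.

(* The matrix, on row vectors, of the Sylvester operator [E |-> A E + E B]. *)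
Definition sylv n (A B : 'M[R]_n) : 'M[R]_(n * n) := lin_mulmx A + lin_mulmxr B.

Lemma mul_sylv n (A B E : 'M[R]_n) : mxvec E *m sylv A B = mxvec (A *m E + E *m B).
Proof. by rewrite mulmxDr !mul_vec_lin linearD. Qed.

Lemma sylv_unit n (A B : 'M[R]_n) : posdef A -> posdef B -> sylv A B \in unitmx.
Proof.
move=> pA pB; rewrite -row_free_unit -kermx_eq0; apply/rowV0P => u /sub_kermxP uA.
rewrite -[u]vec_mxK mul_sylv in uA.
have h : vec_mx u = 0.
  by apply: (sylvester_uniq pA pB); apply: (can_inj mxvecK); rewrite uA linear0.
by rewrite -[u]vec_mxK h linear0.
Qed.

Lemma sqrt_diff n (A B : 'M[R]_n) :
  A *m (A - B) + (A - B) *m B = A *m A - B *m B.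
Proof. by rewrite mulmxBr mulmxBl addrA subrK. Qed.

(** With $E = A - B$, $P = A^2 - B^2$ and $B = C^2$, pairing $AE + EB = P$ with $E$ gives $|EC|^2
    \le \langle P, E\rangle$, whence $|E|^2 \le k\langle P, E\rangle$ for $k = |C^{-1}|^2$.
    Cauchy-Schwarz then yields the constant $k^2$, which does not depend on $A$. *)
Lemma sqrt_lipschitz n (B : 'M[R]_n) : posdef B -> exists2 c : R, 0 <= c & forall A, posdef A ->
  frob (A - B) (A - B) <= c * frob (A *m A - B *m B) (A *m A - B *m B).
Proof.
move=> pB; have [C pC EC] := posdef_sqrt pB.
pose k := frob (invmx C) (invmx C).
have k0 : 0 <= k by exact: frob_ge0.
exists (k ^+ 2); first exact: sqr_ge0.
move=> A pA; have := sqrt_diff A B; move: (A - B) (A *m A - B *m B) => E P EP.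
have h1 : frob E E <= k * frob P E.
  apply: le_trans (_ : frob (E *m C) (E *m C) * k <= _).
    by have := frob_mulmx_le (E *m C) (invmx C); rewrite mulmxK// posdef_unit.
  rewrite mulrC ler_wpM2l// -EP frobDl -EC mulmxA [X in _ + X]frob_mulr pC.1.
  by rewrite lerDr posdef_frob_ge0.
have h2 : frob P E ^+ 2 <= frob P P * frob E E.
  rewrite (frobE P E) (frobE P P) (frobE E E) !pair_bigA/=.
  apply: le_trans (cauchy_schwarz _ _) _.
  by rewrite !(eq_bigr _ (fun _ _ => expr2 _)).
have e0 := frob_ge0 E; have p0 := frob_ge0 P.
have [e1|] := eqVneq (frob E E) 0; first by rewrite e1 mulr_ge0// sqr_ge0.
move=> en; have e1 : 0 < frob E E by rewrite lt_neqAle eq_sym en.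
rewrite -(ler_pM2r e1) -mulrA; apply: le_trans (_ : (k * frob P E) ^+ 2 <= _).
  by rewrite -expr2 ler_pXn2r// ?nnegrE// (le_trans _ h1).
by rewrite exprMn ler_wpM2l ?sqr_ge0.
Qed.

Lemma posdef_sqrt_continuous (V : normedModType R) n (U : set V) (s : V -> 'M[R]_n) :
  open U -> (forall x, U x -> posdef (s x)) ->
  (forall x, U x -> {for x, continuous (fun y => s y *m s y)}) ->
  forall x, U x -> {for x, continuous s}.
Proof.
move=> oU ps cs x Ux; have ff : Filter (nbhs x) by exact: nbhs_filter.
have [c c0 hc] := sqrt_lipschitz (ps x Ux).
have h : frob (s y - s x) (s y - s x) @[y --> x] --> 0.
  apply: (@squeeze_cvgr _ _ _ _ (fun=> 0) (fun y => c * frob (s y *m s y - s x *m s x) (s y *m s y - s x *m s x))).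
  - move: (oU); rewrite openE => /(_ x Ux); apply: filter_app; apply: nearW => y Uy.
    by rewrite frob_ge0 hc//; exact: ps.
  - exact: cvg_cst.
  - rewrite -[X in _ --> X](mulr0 c); apply: cvgM; first exact: cvg_cst.
    rewrite -[X in _ --> X](@frob0l _ n n 0).
    have h : s y *m s y - s x *m s x @[y --> x] --> (0 : 'M[R]_n).
      rewrite -[X in _ --> X](subrr (s x *m s x)).
      by apply: cvgB; [exact: cs | exact: cvg_cst].
    by apply: cvg_frob.
apply: cvg_mx => i j; apply/cvgrPdist_le => e e0.
have e2 : 0 < e ^+ 2 by rewrite exprn_gt0.
have /cvgrPdist_le/(_ _ e2) := h; apply: filter_app; apply: nearW => y.
rewrite sub0r normrN ger0_norm ?frob_ge0// => h1.
rewrite -[_ - _]opprB normrN -(ler_pXn2r (_ : 0 < 2)%N) ?nnegrE ?(ltW e0)// real_normK ?num_real//.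
apply: le_trans h1; apply: le_trans (frob_coord _ i j).
by rewrite !mxE.
Qed.

(** Inverting the Sylvester matrix expresses $s(y) - s(x)$ through $s(y)^2 - s(x)^2$ and a factor
    that is merely continuous in $y$, which is enough for differentiability. The resulting
    derivative [F] involves $s$ itself, of class $C^r$ by induction. *)
Lemma class_C_sqrt r (V : normedModType R) (U : set V) n (s : V -> 'M[R]_n) :
  open U -> (forall x, U x -> posdef (s x)) ->
  class_C r U (fun y => s y *m s y) -> class_C r U s.
Proof.
move=> oU ps; elim: r => [|r IH] cP; first exact: posdef_sqrt_continuous.
have cs := IH (class_C_le cP).
have cP0 x : U x -> {for x, continuous (fun y => s y *m s y)}.
  by move=> Ux; have [L [/has_diff_continuous h _]] := class_C_has_diff cP Ux.
have cs0 := posdef_sqrt_continuous oU ps cP0.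
pose P y := s y *m s y; pose mv : {linear 'M[R]_n -> 'rV[R]_(n * n)} := mxvec.
pose vm : {linear 'rV[R]_(n * n) -> 'M[R]_n} := vec_mx.
pose F v x := vm (mv ('D_v P x) *m invmx (sylv (s x) (s x))).
apply: (class_CS oU (F := F)) => [x Ux|v]; last first.
  apply: (class_C_comp_linear (T := vm) oU); first exact: mx_linear_continuous.
  apply: class_C_mulmx => //.
    by apply: (class_C_comp_linear (T := mv) oU); [exact: mx_linear_continuous | exact: cP.2].
  apply: class_C_invmx => //; first by move=> x Ux; apply: sylv_unit; exact: ps.
  pose l1 : {linear 'M[R]_n -> 'M[R]_(n * n)} := lin_mulmx.
  pose l2 : {linear 'M[R]_n -> 'M[R]_(n * n)} := lin_mulmxr.
  by apply: class_CD => //; [apply: (class_C_comp_linear (T := l1) oU) |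
    apply: (class_C_comp_linear (T := l2) oU)] => //; exact: mx_linear_continuous.
have ff : Filter (nbhs x) by exact: nbhs_filter.
have nU : \forall y \near x, U y by move: (oU); rewrite openE => /(_ x Ux).
have [L [hL Lv]] := class_C_has_diff cP Ux.
have cG : {for x, continuous (fun y => invmx (sylv (s y) (s x)))}.
  apply: cvg_invmx; first by apply: sylv_unit; exact: ps.
    by move: nU; apply: filter_app; apply: nearW => y Uy; apply: sylv_unit; exact: ps.
  apply: cvgD; last exact: cvg_cst.
  pose l1 : {linear 'M[R]_n -> 'M[R]_(n * n)} := lin_mulmx.
  by apply: (@continuous_cvg _ _ _ _ _ _ l1); [exact: mx_linear_continuous | exact: cs0].
have h0 := has_diff_comp_linear (@mx_linear_continuous _ _ _ mv) (has_diff_addr_cst (- P x) hL).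
have h1 := has_diff_mul0 _ h0 cG.
have {h1} := h1 _; rewrite /= subrr linear0 => /(_ erefl).
move=> /(has_diff_comp_linear (@mx_linear_continuous _ _ _ vm))/(has_diff_addr_cst (s x)) h1.
exists (vm \o (mulmxr (invmx (sylv (s x) (s x))) \o (mv \o L))).
split; last by move=> v /=; rewrite Lv.
apply: has_diff_ext h1; move: nU; apply: filter_app; apply: nearW => y Uy /=.
rewrite -sqrt_diff -mul_sylv mulmxK; last by apply: sylv_unit; exact: ps.
by rewrite mxvecK subrK.
Qed.

Definition sqrtmx n (A : 'M[R]_n) : 'M[R]_n := xget 0 [set B | posdef B /\ B *m B = A].

Lemma sqrtmxP n (A : 'M[R]_n) : posdef A -> posdef (sqrtmx A) /\ sqrtmx A *m sqrtmx A = A.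
Proof.
move=> /posdef_sqrt[B pB BA]; rewrite /sqrtmx; case: xgetP => [_ _ //|h].
by case: (h B).
Qed.

Lemma sqrtmx_sqr n (A : 'M[R]_n) : posdef A -> sqrtmx (A *m A) = A.
Proof.
move=> pA; have [pB BB] : posdef (sqrtmx (A *m A)) /\ sqrtmx (A *m A) *m sqrtmx (A *m A) = A *m A.
  by apply: sqrtmxP; rewrite -{1}pA.1; apply: posdef_gram; exact: posdef_unit.
have h := sqrt_intertwine (Z := 1%:M) pB pA.
by rewrite !mulmx1 !mul1mx in h; exact: h.
Qed.

End SmoothSquareRoot.

Section PolarDecomposition.
Variables (R : realType) (n : nat).
Local Notation MM := 'M[R]_n.

Lemma open_unitmx : open [set M : MM | M \in unitmx].
Proof.
rewrite (_ : [set M | _] = (fun M => \det M) @^-1` [set x : R | x != 0]); last first.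
  by apply/seteqP; split => M /=; rewrite unitmxE unitfE.
apply: open_comp; last exact: open_neq.
move=> x _; have ff : Filter (nbhs x) by exact: nbhs_filter.
exact: cvg_det.
Qed.

Lemma class_C_pair r (V W W' : normedModType R) (U : set V) (f : V -> W) (g : V -> W') :
  open U -> class_C r U f -> class_C r U g -> class_C r U (fun x => (f x, g x)).
Proof.
move=> oU; elim: r f g => [|r IH] f g cf cg.
  by move=> x Ux; apply: cvg_pair; [exact: cf | exact: cg].
split=> [x Ux|v]; first by apply: differentiable_pair; [exact: cf.1 | exact: cg.1].
apply: (@class_C_ext _ r _ _ U (fun x => ('D_v f x, 'D_v g x))) => // [x Ux|]; last first.
  by apply: IH; [exact: cf.2 | exact: cg.2].
have df := cf.1 x Ux; have dg := cg.1 x Ux.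
rewrite !deriveE//; last exact: differentiable_pair.
by rewrite diff_pair.
Qed.

(** Conjugation by [S] makes [K] orthogonal and [P] positive definite, so the positive part is the
    explicit root [r g]. This formula is smooth on the whole open set of invertible matrices and
    thus provides the extension that [smooth_on] asks for. *)
Lemma polar_diffeomorphism (S : MM) (K P G : set MM) : S \in unitmx ->
  (forall k, K k -> (S *m k *m invmx S)^T *m (S *m k *m invmx S) = 1%:M) ->
  (forall p, P p -> posdef (S *m p *m invmx S)) ->
  (forall k p, K k -> P p -> G (k *m p)) ->
  (forall g, G g -> g \in unitmx /\ exists k p, [/\ K k, P p & g = k *m p]) ->
  diffeomorphism (K `*` P) G (fun u : MM * MM => u.1 *m u.2).
Proof.
move=> uS hK hP KP hG; pose c (g : MM) := S *m g *m invmx S.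
have cM g g' : c (g *m g') = c g *m c g'.
  by rewrite /c !mulmxA mulmxKV.
pose r g := invmx S *m sqrtmx ((c g)^T *m c g) *m S.
have rE k p : K k -> P p -> r (k *m p) = p.
  move=> Kk Pp; have pp := hP p Pp.
  have E : (c (k *m p))^T *m c (k *m p) = c p *m c p.
    rewrite cM trmx_mul; have := hK k Kk; have := pp.1; rewrite -/(c k) -/(c p).
    by move: (c k) (c p) => a b -> h; rewrite -mulmxA (mulmxA _ a) h mul1mx.
  rewrite /r E sqrtmx_sqr//.
  by rewrite /c !mulmxA mulVmx// mul1mx mulmxKV.
have pu p : P p -> p \in unitmx.
  move=> /hP/posdef_unit; rewrite !unitmx_mul unitmx_inv uS/=.
  by rewrite andbT.
exists (fun g => (g *m invmx (r g), r g)); split.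
- move=> [k p] [/= Kk Pp]; split; first exact: KP.
  by rewrite rE// mulmxK// pu.
- move=> g /hG[_ [k [p [Kk Pp ->]]]]; rewrite rE// mulmxK ?pu//.
- move=> x _; exists setT, (fun u => u.1 *m u.2); split=> //; first exact: openT.
  pose p1 : {linear (MM * MM)%type -> MM} := fst; pose p2 : {linear (MM * MM)%type -> MM} := snd.
  move=> i; apply: class_C_mulmx; first exact: openT.
    apply: (@class_C_linear R i _ _ _ p1); first exact: openT.
    by move=> y; exact: cvg_fst.
  apply: (@class_C_linear R i _ _ _ p2); first exact: openT.
  by move=> y; exact: cvg_snd.
move=> g /hG[ug _]; exists [set M | M \in unitmx], (fun g => (g *m invmx (r g), r g)); split=> //.
  exact: open_unitmx.
have cu M : M \in unitmx -> c M \in unitmx by move=> uM; rewrite !unitmx_mul unitmx_inv uS uM.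
have pc M : M \in unitmx -> posdef ((c M)^T *m c M) by move=> /cu; exact: posdef_gram.
move=> i; have oU := open_unitmx.
have ccst (A : MM) : class_C i [set M : MM | M \in unitmx] (fun=> A) by exact: class_C_cst.
have cid : class_C i [set M : MM | M \in unitmx] id.
  by apply: (@class_C_linear R i _ _ _ idfun) => // y.
have cc : class_C i [set M : MM | M \in unitmx] c by do 2!apply: class_C_mulmx => //.
have cct : class_C i [set M : MM | M \in unitmx] (fun M => (c M)^T).
  by apply: (class_C_comp_linear (T := trmx : {linear MM -> MM})) => //; exact: mx_linear_continuous.
have cr : class_C i [set M : MM | M \in unitmx] r.
  do 2!apply: class_C_mulmx => //.
  apply: class_C_sqrt => // [x /pc/sqrtmxP[]//|].
  apply: (@class_C_ext _ i _ _ _ (fun M => (c M)^T *m c M)) => // [x /pc/sqrtmxP[]//|].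
  exact: class_C_mulmx.
apply: class_C_pair => //; apply: class_C_mulmx => //; apply: class_C_invmx => // x /pc/sqrtmxP[/posdef_unit ps _].
by rewrite !unitmx_mul unitmx_inv uS ps.
Qed.

End PolarDecomposition.

(** * Reductivity of star-stable groups *)

Section StarOperation.
Variables (F : comUnitRingType) (n : nat) (S : 'M[F]_n).
Hypothesis uS : S \in unitmx.
Implicit Types (X Y : 'M[F]_n).

(** Over a general ring because it is used for real matrices and, with [mxC S], for complex ones;
    there it is the C-linear extension, without conjugation. *)
Definition star X : 'M[F]_n := invmx S *m (S *m X *m invmx S)^T *m S.

Lemma star_linear a X Y : star (a *: X + Y) = a *: star X + star Y.
Proof.
rewrite /star mulmxDr mulmxDl linearD/= mulmxDr mulmxDl -!scalemxAr -!scalemxAl.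
by rewrite linearZ/= -scalemxAr -scalemxAl.
Qed.

Lemma starD X Y : star (X + Y) = star X + star Y.
Proof. by rewrite -[X]scale1r star_linear !scale1r. Qed.

Lemma star0 : star 0 = 0.
Proof. by rewrite /star mulmx0 mul0mx trmx0 mulmx0 mul0mx. Qed.

Lemma starZ a X : star (a *: X) = a *: star X.
Proof. by rewrite -[a *: X]addr0 star_linear star0 addr0. Qed.

Lemma starN X : star (- X) = - star X.
Proof. by rewrite -scaleN1r starZ scaleN1r. Qed.

Lemma conj_star X : S *m star X *m invmx S = (S *m X *m invmx S)^T.
Proof. by rewrite /star !mulmxA mulmxV// mul1mx mulmxK. Qed.

Lemma starK X : star (star X) = X.
Proof. by rewrite /star -/(star X) conj_star trmxK !mulmxA mulVmx// mul1mx mulmxKV. Qed.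

Lemma starM X Y : star (X *m Y) = star Y *m star X.
Proof.
rewrite /star.
have -> : S *m (X *m Y) *m invmx S = S *m X *m invmx S *m (S *m Y *m invmx S).
  by rewrite !mulmxA mulmxKV.
rewrite trmx_mul !mulmxA; congr (_ *m _ *m _).
by rewrite -(mulmxA _ S) mulmxV// mulmx1.
Qed.

Lemma star1 : star 1%:M = 1%:M.
Proof. by rewrite /star mulmx1 mulmxV// trmx1 mulmx1 mulVmx. Qed.

End StarOperation.

Section StarReductive.
Variables (R : realType) (n : nat) (S : 'M[R]_n).
Hypothesis uS : S \in unitmx.
Local Notation MM := 'M[R]_n.
Local Notation star := (star S).
Implicit Types (X Y Z : MM) (L J D : {vspace MM}).

Lemma mexp_conjV Q X : Q \in unitmx -> mexp (Q *m X *m invmx Q) = Q *m mexp X *m invmx Q.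
Proof.
by move=> uQ; have := @mexp_conj _ _ (invmx Q) X; rewrite invmxK unitmx_inv; apply.
Qed.

Lemma mexp_star X : mexp (star X) = star (mexp X).
Proof. by rewrite /star mexp_conj// mexp_tr mexp_conjV. Qed.

Lemma star_commutator X Y : star (commutator X Y) = commutator (star Y) (star X).
Proof. by rewrite /commutator starD starN !starM. Qed.

(** The Frobenius product in the coordinates given by [S]; for it the bracket with [star X] is
    adjoint to the bracket with [X]. *)
Definition sip X Y := \tr (X *m star Y).

Lemma sip_frob X Y : sip X Y = frob (S *m X *m invmx S) (S *m Y *m invmx S).
Proof.
rewrite /frob /sip /star !mulmxA -[LHS](mxtrace_mulC S) !mulmxA.
by rewrite mxtrace_mulC !mulmxA.
Qed.

Lemma sip_ge0 X : 0 <= sip X X.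
Proof. by rewrite sip_frob frob_ge0. Qed.

Lemma sip_eq0 X : sip X X = 0 -> X = 0.
Proof.
rewrite sip_frob => /frob_eq0 h.
by rewrite -(mulKmx uS X) -[S *m X](mulmxK (_ : invmx S \in unitmx)) ?unitmx_inv// h mul0mx mulmx0.
Qed.

Lemma sip_gt0 X : X != 0 -> 0 < sip X X.
Proof.
move=> X0; rewrite lt_neqAle sip_ge0 andbT eq_sym.
by apply: contra_neq X0; exact: sip_eq0.
Qed.

Lemma sipC X Y : sip X Y = sip Y X.
Proof. by rewrite !sip_frob frobC. Qed.

Lemma sip_linl a X Y Z : sip (a *: X + Y) Z = a * sip X Z + sip Y Z.
Proof. by rewrite /sip mulmxDl -scalemxAl linearD/= linearZ. Qed.

Lemma sip_linr a X Y Z : sip Z (a *: X + Y) = a * sip Z X + sip Z Y.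
Proof. by rewrite sipC sip_linl sipC (sipC Y). Qed.

Lemma sip0l X : sip 0 X = 0.
Proof. by rewrite /sip mul0mx mxtrace0. Qed.

Lemma sip0r X : sip X 0 = 0.
Proof. by rewrite sipC sip0l. Qed.

Lemma sip_adjoint X Y Z : sip (commutator X Y) Z = sip Y (commutator (star X) Z).
Proof.
rewrite /sip /commutator mulmxBl starD starN (starM uS (star X)) (starM uS Z) starK// mulmxBr !raddfB/=.
by rewrite -(mulmxA X) (mxtrace_mulC X) !mulmxA.
Qed.

Lemma commutator_bracket : lie_bracket (@commutator R n).
Proof.
split; rewrite /commutator.
- move=> a x y z; rewrite mulmxDl mulmxDr -scalemxAl -scalemxAr.
  by rewrite opprD addrACA scalerBr.
- move=> a x y z; rewrite mulmxDl mulmxDr -scalemxAl -scalemxAr.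
  by rewrite opprD addrACA scalerBr.
- by move=> x; rewrite subrr.
- move=> x y z; rewrite !mulmxBl !mulmxBr !mulmxA.
  move: (x *m y *m z) (x *m z *m y) (y *m x *m z) (y *m z *m x) (z *m x *m y) (z *m y *m x).
  by move=> a b c d e f; apply/matrixP => i j; rewrite !mxE; ring.
Qed.
Local Notation hb := commutator_bracket.

Lemma sip_projection D X : exists2 U, U \in D & forall Y, Y \in D -> sip (X - U) Y = 0.
Proof.
have mem (i : 'I_(\dim D)) : (vbasis D)`_i \in D.
  by apply: vbasis_mem; apply: mem_nth; rewrite size_tuple.
have pos (u : 'rV[R]_(\dim D)) : sip (\sum_i u 0 i *: (vbasis D)`_i) (\sum_i u 0 i *: (vbasis D)`_i) = 0 -> u = 0.
  have /freeP fr := basis_free (vbasisP D).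
  by move=> /sip_eq0 /fr h; apply/rowP => i; rewrite h mxE.
have [u hu] := orthogonal_projection sip_linl sip_linr pos X.
exists (\sum_i u 0 i *: (vbasis D)`_i); first by apply: memv_suml => i _; exact: memvZ.
move=> Y YD; rewrite (coord_vbasis YD).
move: (X - _) hu => T hu; elim/big_rec: _ => [|i Z _ IH]; first exact: sip0r.
by rewrite sip_linr hu mulr0 add0r.
Qed.

Section Reductive.
Variable L : {vspace MM}.
Hypothesis starL : forall X, X \in L -> star X \in L.
Hypothesis brL : forall X Y, X \in L -> Y \in L -> commutator X Y \in L.
Local Notation D := (lie_prod (@commutator R n) L L).

Let DL : (D <= L)%VS.
Proof. by apply/(lie_prod_subP hb). Qed.

Let starD' X : X \in D -> star X \in D.
Proof.
have [U hU] : exists U : {vspace MM}, forall X, X \in U <-> star X \in D.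
  apply: vspace_of_pred; first by rewrite star0 mem0v.
  by move=> a x y hx hy; rewrite star_linear memvD// memvZ.
move=> XD; apply/hU; apply: subvP XD; apply/(lie_prod_subP hb) => x y xL yL.
by apply/hU; rewrite star_commutator; apply: (mem_lie_prod hb); exact: starL.
Qed.

(** With [X] also [star X] is central, and adjointness moves one factor of any bracket onto [X],
    giving 0. So [X] is orthogonal to [D], which contains it. *)
Lemma star_center_derived X : X \in D ->
  (forall Y, Y \in L -> commutator X Y = 0) -> X = 0.
Proof.
move=> XD cX; apply: sip_eq0.
have cX' Y : Y \in L -> commutator (star X) Y = 0.
  by move=> YL; rewrite -[Y](starK uS) -star_commutator (brC hb) cX ?oppr0 ?star0// starL.
have [U hU] : exists U : {vspace MM}, forall Y, Y \in U <-> sip Y X = 0.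
  apply: vspace_of_pred; first exact: sip0l.
  by move=> a x y hx hy; rewrite sip_linl hx hy mulr0 addr0.
apply/hU; apply: subvP XD; apply/(lie_prod_subP hb) => x y xL yL; apply/hU.
rewrite sip_adjoint (brC hb) cX ?oppr0; last exact: starL.
by exact: sip0r.
Qed.

(** For $W = [X, Y]$, adjointness turns $|W|^2$ into the product of $X$ with an element of [D], up
    to sign. *)
Lemma star_orthogonal_center X : X \in L -> (forall Y, Y \in D -> sip X Y = 0) ->
  forall Y, Y \in L -> commutator X Y = 0.
Proof.
move=> XL hX Y YL; apply: sip_eq0; set W := commutator X Y.
have WL : W \in L by exact: brL.
rewrite {1}/W (brC hb) -scaleN1r -[_ *: _]addr0 sip_linl sip_adjoint hX.
  by rewrite mulr0 add0r sip0l.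
by apply: (mem_lie_prod hb) => //; exact: starL.
Qed.

(* If [X] lies in an abelian ideal [J], then [X, X^*] is in [J] and commutes
   with [X]; a trace computation gives [X, X^*] = 0. So ad X is a normal
   operator of square 0 on the derived algebra, i.e. ad X = 0 there. *)
Lemma star_derived_semisimple : lie_semisimple (@commutator R n) D.
Proof.
move=> I [ID iI] [k solI]; pose dr := fun U => lie_prod (@commutator R n) U U.
have idr j : (iter j dr I <= D)%VS /\ forall Y X, Y \in D -> X \in iter j dr I ->
    commutator Y X \in iter j dr I.
  elim: j => [|j [IH1 IH2]] /=; first by split=> //; exact/(lie_prod_subP hb).
  split.
    apply/(lie_prod_subP hb) => x y xI yI; apply: (mem_lie_prod hb);
      by apply: (subvP DL); exact: (subvP IH1).
  move=> Y X YD; have [U hU] : exists U : {vspace MM}, forall X,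
      X \in U <-> commutator Y X \in dr (iter j dr I).
    apply: vspace_of_pred; first by rewrite (br0r hb) mem0v.
    by move=> a x y hx hy; rewrite (brPr hb) memvD// memvZ.
  move=> XI; apply/hU; apply: subvP XI; apply/(lie_prod_subP hb) => x y xI yI; apply/hU.
  by rewrite (br_jacobi hb); apply: memvD; apply: (mem_lie_prod hb) => //; exact: IH2.
(* It is enough to show that the last term of the derived series before 0, an abelian ideal of [D],
   is already 0. *)
elim: k solI => [//|k IH] solI; apply: IH.
have [JD Jid] := idr k; rewrite /= -/(dr (iter k dr I)) in solI *.
move: (iter k dr I) JD Jid solI => J JD Jid abJ.
have abJ' x y : x \in J -> y \in J -> commutator x y = 0.
  by move=> xJ yJ; apply/eqP; rewrite -memv0 -abJ; exact: (mem_lie_prod hb).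
apply/eqP; rewrite -subv0; apply/subvP => X XJ; rewrite memv0; apply/eqP.
have XD := subvP JD X XJ.
have XX : commutator X (star X) \in J by rewrite (brC hb) memvN Jid ?starD'.
(* By adjointness the squared norm involves only the bracket of [star X] with this self-adjoint
   element. Its image under star is, up to sign, a bracket of two elements of the abelian [J]. *)
have nX : commutator X (star X) = 0.
  apply: sip_eq0; rewrite sip_adjoint.
  suff h : commutator (star X) (commutator X (star X)) = 0.
    by rewrite h sip0r.
  rewrite -[LHS](starK uS) (star_commutator (star X)) (star_commutator X) (starK uS X) (brC hb).
  by rewrite abJ' ?oppr0 ?star0//.
apply: star_center_derived => //.
have cD Z : Z \in D -> commutator X Z = 0.
  move=> ZD; set W := commutator X Z.
  have WJ : W \in J by rewrite /W (brC hb) memvN Jid.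
  have XW : commutator X W = 0 by exact: abJ'.
  have sXW : commutator (star X) W = 0.
    apply: sip_eq0; rewrite sip_adjoint (starK uS X) (br_jacobi hb) nX (br0l hb) add0r XW (br0r hb).
    exact: sip0r.
  by apply: sip_eq0; rewrite {1}/W sip_adjoint sXW sip0r.
move=> Y YL; have [U UD hU] := sip_projection D Y.
have cZ : commutator X (Y - U) = 0.
  have UL := subvP DL U UD.
  have zL : Y - U \in L by exact: memvB.
  by rewrite (brC hb) (star_orthogonal_center zL hU) ?oppr0//; exact: (subvP DL).
by have := brDr hb (Y - U) U X; rewrite subrK cZ (cD _ UD) addr0.
Qed.

Lemma star_reductive : lie_reductive (@commutator R n) L.
Proof.
have [Z hZ] : exists Z : {vspace MM}, forall X, X \in Z <->
    (X \in L /\ forall Y, Y \in L -> commutator X Y = 0).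
  apply: vspace_of_pred; first by rewrite mem0v; split=> // Y _; rewrite (br0l hb).
  move=> a x y [xL hx] [yL hy]; rewrite memvD ?memvZ//; split=> // Y YL.
  by rewrite (brPl hb) hx// hy// scaler0 addr0.
exists Z; split=> //; first exact: star_derived_semisimple.
- apply/eqP; rewrite eqEsubv; apply/andP; split.
    by rewrite subv_add DL; apply/subvP => X /hZ[].
  apply/subvP => X XL; have [U UD hU] := sip_projection D X.
  have UL := subvP DL U UD; rewrite -(subrK U X) addrC memv_add//.
  apply/hZ; split; first by rewrite memvB.
  by apply: star_orthogonal_center => //; rewrite memvB.
- apply/eqP; rewrite -subv0; apply/subvP => X; rewrite memv_cap => /andP[XD /hZ[_ cX]].
  by rewrite memv0; apply/eqP; exact: star_center_derived.
Qed.

End Reductive.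
End StarReductive.

Lemma memv_leigenspace (F : fieldType) (V : vectType F) (f : 'End(V)) a x :
  (x \in passmx.leigenspace f a) = (f x == a *: x).
Proof. by rewrite memv_ker add_lfunE opp_lfunE scale_lfunE id_lfunE subr_eq0. Qed.

(** * Cartan decomposition of a star-stable closed linear group *)

Section ReductiveGroup.
Variables (R : realType) (n : nat) (S : 'M[R]_n).
Hypothesis uS : S \in unitmx.
Local Notation MM := 'M[R]_n.
Local Notation star := (star S).
Implicit Types (X Y Z : MM).

Definition eta_star : 'End('M[R]_n) :=
  linfun (-%R \o (mulmxr S \o (mulmx (invmx S) \o (trmx \o (mulmxr (invmx S) \o mulmx S)))) :
    {linear MM -> MM}).

Lemma eta_starE X : eta_star X = - star X.
Proof. by rewrite lfunE. Qed.

Lemma mexp_posdef X : X^T = X -> posdef (mexp X).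
Proof.
move=> sX; have -> : X = 2^-1 *: X + 2^-1 *: X.
  by rewrite -scalerDl [2^-1 + _](_ : _ = 1) ?scale1r//; field.
rewrite mexpD// -[X in posdef (X *m _)](_ : (mexp (2^-1 *: X))^T = _); last first.
  by rewrite -mexp_tr linearZ/= sX.
by apply: posdef_gram; exact: mexp_unit.
Qed.

(** The difference of the two curves is a matrix coefficient of the exponential of a block diagonal
    matrix, and its first moment is $X - Y$. *)
Lemma mexp_curve_inj X Y : (forall t, mexp (t *: X) = mexp (t *: Y)) -> X = Y.
Proof.
move=> h; pose A := block_mx X 0 0 Y; pose U := row_mx 1%:M (- 1%:M) : 'M[R]_(n, n + n).
pose V1 := col_mx 1%:M 0 : 'M[R]_(n + n, n); pose V2 := col_mx 0 1%:M : 'M[R]_(n + n, n).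
have e1 t : (t *: A) *m V1 = V1 *m (t *: X).
  by rewrite -scalemxAl -scalemxAr mul_block_col mul_col_mx !(mulmx0, mul0mx, mulmx1, mul1mx, addr0).
have e2 t : (t *: A) *m V2 = V2 *m (t *: Y).
  by rewrite -scalemxAl -scalemxAr mul_block_col mul_col_mx !(mulmx0, mul0mx, mulmx1, mul1mx, add0r).
have key t : U *m mexp (t *: A) *m (V1 + V2) = 0.
  rewrite mulmxDr -!mulmxA (mexp_intertwine (e1 t)) (mexp_intertwine (e2 t)) h.
  by rewrite !mul_col_mx !mul0mx !mul1mx !mul_row_col !mulNmx !mulmx0 !mul1mx subr0 add0r subrr.
have := mexp_deriv_vanish key 1; rewrite expr1 mulmxDr -!mulmxA -[A]scale1r e1 e2 !scale1r.
rewrite !mul_col_mx !mul0mx !mul1mx !mul_row_col !mulNmx !mulmx0 !mul1mx subr0 add0r.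
by move/eqP; rewrite subr_eq0 => /eqP.
Qed.

Lemma invmxM (A B : MM) : A \in unitmx -> B \in unitmx -> invmx (A *m B) = invmx B *m invmx A.
Proof.
move=> uA uB; have uAB : A *m B \in unitmx by rewrite unitmx_mul uA.
by rewrite -[RHS]mulmx1 -(mulmxV uAB) !mulmxA mulmxKV// mulVmx// mul1mx.
Qed.

Lemma mxtrace_star X : \tr (star X) = \tr X.
Proof. by rewrite mxtrace_mulC mulKVmx// mxtrace_tr mxtrace_mulC mulKmx. Qed.

Variables (G : set MM) (L : {vspace MM}).
Hypothesis closedG : closed_linear_group G.
Hypothesis lieG : is_lie_algebra_of G L.
Hypothesis brL : forall X Y, X \in L -> Y \in L -> commutator X Y \in L.
Hypothesis starG : forall g, G g -> G (star g).
(** The form in which algebraicity of the group enters the polar decomposition. *)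
Hypothesis powG : forall (Q : MM) d, Q \in unitmx ->
  (forall k : nat, G (mexp (k%:R *: (invmx Q *m diag_mx d *m Q)))) ->
  forall t, G (mexp (t *: (invmx Q *m diag_mx d *m Q))).
Hypothesis innerG : forall g, G g ->
  exp_ad_group (@commutator R n) (vbasis L) L (mxC (mx_in (vbasis L) (Ad g))).

Let starL X : X \in L -> star X \in L.
Proof.
move=> /lieG XG; apply/lieG => t; rewrite -starZ mexp_star//; exact: starG.
Qed.

Let K : set MM := [set k | G k /\ star k *m k = 1%:M].

Let groupG : matrix_group G.
Proof. by case: closedG. Qed.

Let unitG g : G g -> g \in unitmx.
Proof. by case: groupG => s _ _ _; exact: s. Qed.

Lemma group_pow g k : G g -> G (g ^+ k).
Proof.
move=> Gg; case: groupG => _ G1 GM _; elim: k => [//|k IH].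
by rewrite exprS -mulmxE; exact: GM.
Qed.

Lemma group_polar g : G g -> exists X, [/\ X \in L, star X = X & mexp (X + X) = star g *m g].
Proof.
move=> Gg; pose c := S *m g *m invmx S.
have uc : c \in unitmx by rewrite !unitmx_mul unitmx_inv uS unitG.
have pP := posdef_gram uc.
have [U [d [UU U'U E]]] := spectral_symmetric pP.1.
have dp i : 0 < d 0 i by move: i; apply/(posdef_diag _ UU); rewrite -E.
(* Half the logarithm, so that $\exp X$, and not its square, becomes the positive part of $g$. *)
pose e : 'rV[R]_n := \row_i (ln (d 0 i) / 2).
have uU : U \in unitmx by case/mulmx1_unit: UU.
have iU : invmx U = U^T by rewrite -[RHS]mul1mx -(mulVmx uU) -mulmxA UU mulmx1.
pose Y := U^T *m diag_mx e *m U.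
have sY : Y^T = Y by rewrite /Y !trmx_mul trmxK tr_diag_mx mulmxA.
pose Q := U *m S; have uQ : Q \in unitmx by rewrite unitmx_mul uU.
pose X := invmx Q *m diag_mx e *m Q.
have XY : X = invmx S *m Y *m S by rewrite /X /Q invmxM// iU /Y !mulmxA.
have sX : star X = X.
  have c1 : S *m X *m invmx S = Y by rewrite XY !mulmxA mulmxV// mul1mx mulmxK.
  by rewrite -[LHS]/(invmx S *m (S *m X *m invmx S)^T *m S) c1 sY.
have XX : mexp (X + X) = star g *m g.
  have -> : X + X = invmx Q *m diag_mx (e + e) *m Q by rewrite linearD/= mulmxDr mulmxDl.
  rewrite mexp_conj// mexp_diag.
  have -> : map_mx expR (e + e) = d.
    apply/rowP => i; rewrite !mxE -splitr lnK// posrE//.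
  rewrite /Q invmxM// iU !mulmxA -(mulmxA (invmx S)) -(mulmxA (invmx S)) -E /c /star.
  by rewrite !mulmxA mulmxKV.
have h2 t : 2 *: (t *: X) = t *: (invmx Q *m diag_mx (e + e) *m Q).
  by rewrite linearD/= mulmxDr mulmxDl -/X !scalerDr scalerA mulrC -scalerA scaler_nat mulr2n scalerDr.
have Gt t : G (mexp (t *: (invmx Q *m diag_mx (e + e) *m Q))).
  apply: powG => // k; have -> : k%:R *: (invmx Q *m diag_mx (e + e) *m Q) = (X + X) *+ k.
    by rewrite scaler_nat linearD/= mulmxDr mulmxDl.
  have -> : mexp ((X + X) *+ k) = (star g *m g) ^+ k.
    elim: k => [|k IH]; first by rewrite mulr0n mexp0 expr0.
    rewrite mulrS mexpD ?IH ?XX ?exprS//.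
    by rewrite -scaler_nat -scalemxAl -scalemxAr.
  by apply: group_pow; case: groupG => _ _ GM _; apply: GM => //; exact: starG.
exists X; split=> //; apply/lieG => t.
have := Gt (t / 2); rewrite -h2 scalerA.
by rewrite mulrC divfK.
Qed.

Let kk := (L :&: passmx.leigenspace eta_star 1)%VS.
Let pp := (L :&: passmx.leigenspace eta_star (-1))%VS.

Let kkP X : reflect (X \in L /\ star X = - X) (X \in kk).
Proof.
rewrite memv_cap memv_leigenspace eta_starE scale1r.
by apply: (iffP andP) => [[XL /eqP h]|[XL h]]; split=> //; [rewrite -[X in RHS]h opprK | rewrite h opprK].
Qed.

Let ppP X : reflect (X \in L /\ star X = X) (X \in pp).
Proof.
rewrite memv_cap memv_leigenspace eta_starE scaleN1r.
by apply: (iffP andP) => [[XL /eqP h]|[XL h]]; split=> //; [exact: oppr_inj | rewrite h].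
Qed.

Lemma polar_unitary k : star k *m k = 1%:M <->
  (S *m k *m invmx S)^T *m (S *m k *m invmx S) = 1%:M.
Proof.
rewrite -conj_star//; have -> : S *m star k *m invmx S *m (S *m k *m invmx S) =
    S *m (star k *m k) *m invmx S by rewrite !mulmxA mulmxKV.
split=> [->|h]; first by rewrite mulmx1 mulmxV.
have : invmx S *m (S *m (star k *m k) *m invmx S) *m S = 1%:M by rewrite h mulmx1 mulVmx.
by rewrite !mulmxA mulVmx// mul1mx mulmxKV.
Qed.

Lemma star_continuous : continuous star.
Proof.
apply: continuous_filter => F a FF Fa; rewrite /star.
apply: cvg_mulmx; last exact: cvg_cst.
apply: cvg_mulmx; first exact: cvg_cst.
apply: cvg_trmx; apply: cvg_mulmx; last exact: cvg_cst.
by apply: cvg_mulmx; first exact: cvg_cst.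
Qed.

Lemma compact_group_unitary : compact K.
Proof.
case: closedG => _ [A cA GA].
have KA : K = A `&` [set k | star k *m k = 1%:M].
  apply/seteqP; split => k [Gk k1]; split=> //; first by move: Gk; rewrite {1}GA => -[].
  by rewrite GA; split=> //; case/mulmx1_unit: k1.
have cK : closed K.
  rewrite KA; apply: closedI => //.
  rewrite (_ : [set k | _] = (fun k => star k *m k) @^-1` [set (1%:M : MM)])//.
  apply: closed_comp; last first.
    by apply: accessible_closed_set1; apply: hausdorff_accessible; exact: norm_hausdorff.
  move=> x _; have ff : Filter (nbhs x) by exact: nbhs_filter.
  by apply: cvg_mulmx => //; exact: star_continuous.
(* [n] is the squared norm of an orthogonal matrix. [C] bounds the squared entries, so the entries
   are bounded by [C + 1]. *)
pose C := frob (invmx S) (invmx S) * n%:R * frob S S.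
apply: (@closed_bounded_compact_mx R n n K (C + 1)) => // k [_ /polar_unitary].
set c := S *m k *m invmx S => hc i j.
have kc : k = invmx S *m c *m S by rewrite /c !mulmxA mulVmx// mul1mx mulmxKV.
have fc : frob c c = n%:R by rewrite /frob mxtrace_mulC hc mxtrace1.
have h : frob k k <= C.
  rewrite kc; apply: le_trans (frob_mulmx_le _ _) _; rewrite /C ler_wpM2r ?frob_ge0//.
  by rewrite -fc frob_mulmx_le.
have C0 : 0 <= C by apply: le_trans h; exact: frob_ge0.
rewrite -(ler_pXn2r (_ : 0 < 2)%N) ?nnegrE ?addr_ge0// real_normK ?num_real//.
apply: le_trans (frob_coord _ _ _) _; apply: le_trans h _.
by move: (C) C0 => D D0; nra.
Qed.

Lemma star_reductive_group : reductive_Lie_group G.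
Proof.
have hb := @commutator_bracket R n.
case: (groupG) => Gu G1 GM GV.
split; first exact: closedG.
(* The trace form is invariant by cyclicity of the trace. Positivity of the trace of [X *m star X]
   gives its nondegeneracy on the star-stable [L], and its two signs on the antisymmetric and
   symmetric parts. *)
exists L, K, eta_star, (fun X Y => \tr (X *m Y)); move=> kk0 pp0.
have kP : forall X, reflect (X \in L /\ star X = - X) (X \in kk0) := kkP.
have pP : forall X, reflect (X \in L /\ star X = X) (X \in pp0) := ppP.
clearbody kk0 pp0; split=> //.
- split; [by move=> k [] | split | exact: compact_group_unitary].
  + by move=> k [/unitG].
  + by split=> //; rewrite star1// mulmx1.
  + move=> M N [GM1 M1] [GN N1]; split; first exact: GM.
    by rewrite starM// mulmxA -(mulmxA _ (star M)) M1 mulmx1.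
  + move=> M [Gm M1]; split; first exact: GV.
    have uM := unitG Gm.
    have -> : invmx M = star M by rewrite -[RHS]mulmx1 -(mulmxV uM) mulmxA M1 mul1mx.
    rewrite starK//; exact: mulmx1C.
- split.
  + by move=> X XL; rewrite eta_starE memvN starL.
  + by move=> X XL; rewrite !eta_starE starN// opprK starK.
  + move=> X Y XL YL; rewrite !eta_starE star_commutator// (brNl hb) (brNr hb) opprK.
    by rewrite [in RHS](brC hb).
- split.
  + by move=> a X Y Z _ _ _; rewrite mulmxDl -scalemxAl linearD/= linearZ.
  + by move=> X Y _ _; rewrite mxtrace_mulC.
  + by move=> X XL h; apply: (sip_eq0 uS); exact: h (starL XL).
  + move=> g X Y /unitG ug _ _; rewrite /Ad !mulmxA mulmxKV// mxtrace_mulC !mulmxA mulVmx// mul1mx//.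
  + by move=> X Y _ _; rewrite !eta_starE mulNmx mulmxN opprK -starM// mxtrace_star mxtrace_mulC.
split=> //.
- exact: (star_reductive uS starL brL).
- split.
  + apply/eqP; rewrite eqEsubv subv_add; apply/andP; split.
      by apply/andP; split; apply/subvP => X; [move/kP=> [] | move/pP=> []].
    apply/subvP => X XL.
    have -> : X = 2^-1 *: (X - star X) + 2^-1 *: (X + star X).
      by move: (star X) => Y; apply/matrixP => i j; rewrite !mxE; field.
    apply: memv_add; [apply/kP | apply/pP].
      split; first by rewrite memvZ// memvB// starL.
      by rewrite starZ// starD// starN// starK// -scalerN opprB.
    split; first by rewrite memvZ// memvD// starL.
    by rewrite starZ// starD// starK// addrC.
  + apply/eqP; rewrite -subv0; apply/subvP => X; rewrite memv_cap memv0.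
    move=> /andP[/kP[_ h1] /pP[_ h2]]; move: h1; rewrite h2 => /eqP.
    by rewrite -addr_eq0 -mulr2n -scaler_nat scaler_eq0 pnatr_eq0.
  + move=> X; split=> [/kP[XL sX] t|h].
      split; first by move: t; apply/lieG.
      by rewrite -mexp_star// starZ// sX scalerN; apply: mulmx1C; exact: mexpNK.
    apply/kP; have XL : X \in L by apply/lieG => t; case: (h t).
    (* Unitarity of the whole curve says that the exponentials of $t\,$[star X] and of $-tX$ agree
       for all $t$. *)
    split=> //; apply: mexp_curve_inj => t; rewrite -starZ mexp_star// scalerN mexpN.
    case: (h t) => /unitG um m1.
    by rewrite -[RHS]mul1mx -m1 mulmxK.
- split.
  + move=> X Y /kP[XL sX] /pP[YL sY]; apply/eqP.
    have : \tr (X *m Y) = - \tr (X *m Y).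
      by rewrite -{1}mxtrace_star starM// sX sY mulmxN linearN/= mxtrace_mulC.
    by move/eqP; rewrite -addr_eq0 -mulr2n mulrn_eq0.
  + move=> X /kP[XL sX] X0; have := sip_gt0 uS X0.
    by rewrite /sip sX mulmxN linearN/= oppr_gt0.
  + move=> X /pP[XL sX] X0; have := sip_gt0 uS X0.
    by rewrite /sip sX.
- apply: (@polar_diffeomorphism R n S) => //.
  + by move=> k [_ /polar_unitary].
  + move=> _ [X /pP[_ sX] <-]; rewrite -mexp_conjV//; apply: mexp_posdef.
    by rewrite -conj_star// sX.
  + by move=> k _ [Gk _] [X /pP[XL _] <-]; apply: GM => //; rewrite -[X]scale1r; move: (1); apply/lieG.
  + move=> g Gg; split; first exact: unitG.
    have [X [XL sX XX]] := group_polar Gg.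
    have GX t : G (mexp (t *: X)) by move: t; apply/lieG.
    have XN : mexp (- X) *m mexp X = 1%:M by apply: mulmx1C; exact: mexpNK.
    exists (g *m mexp (- X)), (mexp X); split.
    * split; first by apply: GM => //; rewrite -scaleN1r.
      rewrite starM// -mexp_star// starN// sX mulmxA -(mulmxA _ (star g)) -XX mexpD//.
      by rewrite mulmxA XN mul1mx mexpNK.
    * by exists X => //; apply/pP.
    * by rewrite -mulmxA XN mulmx1.
Qed.

End ReductiveGroup.

(** * Inner automorphisms *)

Section BigRow.
Variables (F : comNzRingType) (n m : nat).

(** The matrices [l j] side by side, so that a relation required for every [j] becomes one matrix
    equation, to which intertwining of exponentials applies. *)
Definition bigrow (l : 'I_m -> 'M[F]_n) : 'M[F]_(n, m * n) :=
  \matrix_(i, q) l (mxtens_unindex q).1 i (mxtens_unindex q).2.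

Lemma mulmx_bigrow l (M : 'M[F]_n) : M *m bigrow l = bigrow (fun j => M *m l j).
Proof. by apply/matrixP => i q; rewrite !mxE; apply: eq_bigr => k _; rewrite mxE. Qed.

Lemma bigrow_tens l (T : 'M[F]_m) (M : 'M[F]_n) :
  bigrow l *m (T *t M) = bigrow (fun j => \sum_k T k j *: (l k *m M)).
Proof.
apply/matrixP => i q; case: (mxtens_indexP q) => j p; rewrite !mxE mxtens_indexK /= summxE.
rewrite (reindex (@mxtens_index m n)) /=; last first.
  by exists (@mxtens_unindex m n) => ? _; rewrite ?mxtens_indexK ?mxtens_unindexK.
rewrite (eq_bigr (fun u => T u.1 j * (l u.1 i u.2 * M u.2 p))); last first.
  by move=> [k r] _; rewrite tensmxE mxE mxtens_indexK /=; ring.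
rewrite -(pair_bigA _ (fun k r => T k j * (l k i r * M r p))) /=.
by apply: eq_bigr => k _; rewrite -mulr_sumr !mxE.
Qed.

Lemma bigrow_ext l l' : bigrow l = bigrow l' -> forall j, l j = l' j.
Proof.
move=> h j; apply/matrixP => i p.
by have := congr1 (fun M : 'M[F]_(n, (m * n)%N) => M i (mxtens_index (j, p))) h; rewrite !mxE mxtens_indexK.
Qed.

(* With [M = N], this says that conjugation by [M] stabilises the span of the
   [l j] and has matrix [T] there, a condition which is multiplicative in
   [(M, T)]. *)
Lemma bigrow_tensP l (M : 'M[F]_n) (T : 'M[F]_m) (N : 'M[F]_n) :
  M *m bigrow l = bigrow l *m (T *t N) <-> forall j, M *m l j = \sum_k T k j *: (l k *m N).
Proof.
rewrite mulmx_bigrow bigrow_tens; split=> [/bigrow_ext//|h].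
by congr bigrow; apply/funext.
Qed.

Lemma bigrowD l l' : bigrow l + bigrow l' = bigrow (fun j => l j + l' j).
Proof. by apply/matrixP => i q; rewrite !mxE. Qed.

End BigRow.

Section InnerAdjoint.
Variables (R : realType) (n : nat) (L : {vspace 'M[R]_n}).
Local Notation C := R[i].
Local Notation m := (\dim L).
Local Notation co := (@commutator R n).
Local Notation hb := (@commutator_bracket R n).
Hypothesis brL : forall X Y, X \in L -> Y \in L -> commutator X Y \in L.

Let lR (j : 'I_m) : 'M[R]_n := tnth (vbasis L) j.
Let lC (j : 'I_m) : 'M[C]_n := mxC (lR j).
Let P := bigrow lC.

Let lRL j : lR j \in L.
Proof. by apply: vbasis_mem; exact: mem_tnth. Qed.

Lemma mx_in_vbasis (f : 'M[R]_n -> 'M[R]_n) j : (forall X, X \in L -> f X \in L) ->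
  f (tnth (vbasis L) j) = \sum_k mx_in (vbasis L) f k j *: tnth (vbasis L) k.
Proof.
move=> fL; rewrite {1}(coord_vbasis (fL _ (lRL j))).
by apply: eq_bigr => k _; rewrite (tnth_nth 0) mxE.
Qed.

Let H := exp_ad_group co (vbasis L) L.

Lemma exp_ad_group_group : matrix_group H.
Proof.
split.
- move=> M hM; apply: (hM [set M | M \in unitmx]).
    split=> [//| |A B /= uA uB|A /= uA]; first exact: unitmx1.
      by rewrite unitmx_mul uA.
    by rewrite unitmx_inv.
  by move=> _ [X _ <-] /=; exact: mexpC_unit.
- by move=> K [_ K1 _ _] _.
- by move=> A B hA hB K gK sK; case: (gK) => _ _ KM _; apply: KM; [exact: hA | exact: hB].
- by move=> A hA K gK sK; case: (gK) => _ _ _; apply; exact: hA.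
Qed.

Let rel (M : 'M[C]_n) (T : 'M[C]_m) := M *m P = P *m (T *t M).

(** The invertible [M] whose conjugation action on the complexified [L] lies in the inner group;
    being a group, it need only be tested on exponentials. *)
Lemma rel_group : matrix_group [set M | M \in unitmx /\ exists2 T, H T & rel M T].
Proof.
have [Hu H1 HM HV] := exp_ad_group_group.
have tens_unit (T : 'M[C]_m) (M : 'M[C]_n) : T \in unitmx -> M \in unitmx ->
    (T *t M) *m (invmx T *t invmx M) = 1%:M.
  by move=> uT uM; rewrite tensmx_mul !mulmxV// tens11.
split.
- by move=> M [].
- split; first exact: unitmx1.
  by exists 1%:M => //; rewrite /rel tens11 mul1mx mulmx1.
- move=> M N [uM [T hT rT]] [uN [T' hT' rT']]; split; first by rewrite unitmx_mul uM.
  exists (T *m T'); first exact: HM.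
  by rewrite /rel -mulmxA rT' mulmxA rT -mulmxA tensmx_mul.
move=> M [uM [T hT rT]]; split; first by rewrite unitmx_inv.
exists (invmx T); first exact: HV.
have uT : T \in unitmx by exact: Hu.
rewrite /rel -[P in LHS]mulmx1 -(tens_unit T M uT uM) mulmxA mulmxA.
by rewrite -(mulmxA (invmx M)) -[P *m (T *t M)]rT mulKmx.
Qed.

(** This is $\mathrm{Ad}(\exp X) = \exp(\mathrm{ad} X)$. The bracket relations read $XP = P(a
    \otimes 1 + 1 \otimes X)$, and the two summands commute, so exponentiating gives $\exp(a)
    \otimes \exp(X)$. *)
Lemma rel_mexpC A B : A \in L -> B \in L ->
  rel (mexpC (mxC A + 'i *: mxC B)) (mexpC (adC co (vbasis L) A B)).
Proof.
move=> AL BL; set X := mxC A + _; set a := adC _ _ _ _.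
have mxC_comm (Y : 'M[R]_n) j : Y \in L -> mxC Y *m lC j - lC j *m mxC Y =
    \sum_k (mx_in (vbasis L) (co Y) k j)%:C%C *: lC k.
  move=> YL; rewrite /lC -!mxCM -raddfB/= -/(co Y (lR j)) mx_in_vbasis => [|Z ZL]; last exact: brL.
  rewrite raddf_sum; apply: eq_bigr => k _; apply/matrixP => p q; rewrite !mxE.
  by rewrite -rmorphM.
have key j : X *m lC j - lC j *m X = \sum_k a k j *: lC k.
  rewrite mulmxDl mulmxDr -scalemxAl -scalemxAr opprD addrACA -scalerBr !mxC_comm//.
  rewrite scaler_sumr -big_split; apply: eq_bigr => k _ /=.
  by rewrite scalerA -scalerDl; congr (_ *: _); rewrite !mxE.
have XP : X *m P = P *m (a *t 1%:M + 1%:M *t X).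
  rewrite mulmx_bigrow mulmxDr !bigrow_tens bigrowD; congr bigrow; apply/funext => j.
  rewrite (eq_bigr (fun k => a k j *: lC k)) => [|k _]; last by rewrite mulmx1.
  rewrite -key [X in _ = _ + X](bigD1 j)//= big1 => [|k kj]; last first.
    by rewrite mxE (negbTE kj) scale0r.
  by rewrite mxE eqxx scale1r addr0 subrK.
have := mexpC_intertwine XP; rewrite /rel => ->; congr (_ *m _).
have c : (a *t 1%:M) *m (1%:M *t X) = (1%:M *t X) *m (a *t 1%:M).
  by rewrite !tensmx_mul !mulmx1 !mul1mx.
rewrite (mexpCD c) (mexpC_tensl n a) (mexpC_tensr m X) tensmx_mul.
by rewrite (mulmx1 (mexpC a)) (mul1mx (mexpC X)).
Qed.

(** A real basis of [L] remains independent over the complex numbers, as is seen on real and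
    imaginary parts separately. *)
Lemma bigrow_inj (T T' : 'M[C]_m) (M : 'M[C]_n) : M \in unitmx ->
  P *m (T *t M) = P *m (T' *t M) -> T = T'.
Proof.
move=> uM; rewrite /P !bigrow_tens => /bigrow_ext h.
have h1 j : \sum_k T k j *: lC k = \sum_k T' k j *: lC k.
  have := congr1 (fun N => N *m invmx M) (h j); rewrite /= !mulmx_suml.
  rewrite (eq_bigr (fun k => T k j *: lC k)) => [|k _]; last by rewrite -scalemxAl mulmxK.
  move=> ->; apply: eq_bigr => k _; by rewrite -scalemxAl mulmxK.
have /freeP fr := basis_free (vbasisP L).
have fr' (u v : 'I_m -> R) : \sum_k u k *: lR k = \sum_k v k *: lR k -> u =1 v.
  move=> /eqP; rewrite -subr_eq0 -sumrB => /eqP uv k; apply/eqP; rewrite -subr_eq0; apply/eqP.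
  apply: (fr (fun k => u k - v k)); rewrite -[RHS]uv; apply: eq_bigr => i _.
  by rewrite scalerBl /lR (tnth_nth 0).
apply/matrixP => k j; apply: complex_ext.
- apply: (fr' (fun k => complex.Re (T k j)) (fun k => complex.Re (T' k j))).
  apply/matrixP => p q; have := congr1 (fun N : 'M[C]_n => complex.Re (N p q)) (h1 j).
  rewrite /= !summxE !Re_sum => E; rewrite (eq_bigr (fun k => complex.Re ((T k j *: lC k) p q))).
    rewrite E; apply: eq_bigr => i _; by rewrite !mxE Re_realM.
  by move=> i _; rewrite !mxE Re_realM.
- apply: (fr' (fun k => complex.Im (T k j)) (fun k => complex.Im (T' k j))).
  apply/matrixP => p q; have := congr1 (fun N : 'M[C]_n => complex.Im (N p q)) (h1 j).
  rewrite /= !summxE !Im_sum => E; rewrite (eq_bigr (fun k => complex.Im ((T k j *: lC k) p q))).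
    rewrite E; apply: eq_bigr => i _; by rewrite !mxE Im_realM.
  by move=> i _; rewrite !mxE Im_realM.
Qed.

(** The condition over all [K] says that $g$ lies in the group generated by the exponentials of the
    complexified [L]. Applied to [rel_group] it produces an inner [T], which must be the matrix of
    Ad g. *)
Lemma inner_Ad (g : 'M[R]_n) : g \in unitmx ->
  (forall X, X \in L -> Ad g X \in L) ->
  (forall K, matrix_group K ->
     (forall A B, A \in L -> B \in L -> K (mexpC (mxC A + 'i *: mxC B))) -> K (mxC g)) ->
  H (mxC (mx_in (vbasis L) (Ad g))).
Proof.
move=> ug gL hg.
have [] := hg _ rel_group.
  move=> A B AL BL; split; first exact: mexpC_unit.
  exists (mexpC (adC co (vbasis L) A B)); last exact: rel_mexpC.
  by move=> K gK sK; apply: sK; exists (adC co (vbasis L) A B) => //; exists A, B.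
move=> uC [T HT rT]; suff -> : mxC (mx_in (vbasis L) (Ad g)) = T by [].
apply: (bigrow_inj uC); rewrite -rT; symmetry; apply/bigrow_tensP => j.
rewrite /lC -mxCM.
have -> : g *m lR j = Ad g (lR j) *m g by rewrite /Ad mulmxKV.
rewrite (mx_in_vbasis _ gL) mulmx_suml raddf_sum; apply: eq_bigr => k _.
rewrite -mxCM -scalemxAl; apply/matrixP => p q; rewrite !mxE.
by rewrite -rmorphM.
Qed.

End InnerAdjoint.

(** * The group of real points *)

Section CoordinateMatrix.
Variables (R : realType) (g : vectType R) (n : nat) (e : n.-tuple g).
Hypothesis he : basis_of fullv e.

Definition coordc (x : g) : 'cV[R]_n := \col_k coord e k x.

Lemma coordc_frame : frame coordc.
Proof.
split; first by move=> a x y; apply/matrixP => i j; rewrite !mxE linearP.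
exists (fun v : 'cV[R]_n => \sum_(k < n) v k 0 *: e`_k); split=> [x|v].
  rewrite [RHS](coord_basis he (memvf x)); apply: eq_bigr => k _; by rewrite mxE.
by apply/matrixP => i j; rewrite ord1 mxE coord_sum_free//; exact: basis_free he.
Qed.

Lemma mx_in_coordc (f : g -> g) x : (forall a x y, f (a *: x + y) = a *: f x + f y) ->
  mx_in e f *m coordc x = coordc (f x).
Proof.
move=> lf; have f0 : f 0 = 0 by have := lf (-1) 0 0; rewrite scaler0 addr0 scaleN1r addNr.
apply/matrixP => i j; rewrite ord1 !mxE [in RHS](coord_basis he (memvf x)).
have -> : f (\sum_k coord e k x *: e`_k) = \sum_k coord e k x *: f e`_k.
  by elim/big_rec2: _ => // k a b _ <-; rewrite lf.
rewrite linear_sum; apply: eq_bigr => k _; rewrite linearZ/= !mxE (tnth_nth 0).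
by rewrite mulrC.
Qed.

End CoordinateMatrix.

Section RealForm.
Variables (R : realType).
Local Notation C := R[i].

Definition mxconj k (M : 'M[C]_k) : 'M[C]_k := map_mx (@conjc R) M.

Lemma regular_conj k (f : 'M[C]_k -> C) M : regular (@realC R) f ->
  f (mxconj M) = conjc (f M).
Proof.
elim=> [c [a _ <-]|i j||f1 f2 _ h1 _ h2|f1 f2 _ h1 _ h2].
- by rewrite /= oppr0.
- by rewrite mxE.
- by rewrite det_map_mx fmorphV.
- by rewrite h1 h2 rmorphD.
- by rewrite h1 h2 rmorphM.
Qed.

Lemma mxconj_fixed k (M : 'M[C]_k) : mxconj M = M -> exists A : 'M[R]_k, M = mxC A.
Proof.
move=> h; exists (Rmx M); apply/matrixP => i j; rewrite !mxE.
apply: complex_ext => //=; have := congr1 (fun N : 'M[C]_k => complex.Im (N i j)) h.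
by rewrite mxE; case: (M i j) => a b /=; lra.
Qed.

Lemma mxconj_mxC k (A : 'M[R]_k) : mxconj (mxC A) = mxC A.
Proof. by apply/matrixP => i j; rewrite !mxE /= oppr0. Qed.

Lemma zariski_closed_conj k (Z : set 'M[C]_k) M : zariski_closed (@realC R) Z -> Z M -> Z (mxconj M).
Proof.
move=> [S SA ->] [/= uM fM]; split=> [|f Sf]; last first.
  by rewrite (regular_conj _ (SA _ Sf)) fM// conjc0.
by rewrite /= unitmxE det_map_mx rmorph_unit// -unitmxE.
Qed.

Lemma real_points_iso k n (Gt : set 'M[C]_k) (G : set 'M[C]_n) (Rc : 'M[C]_k -> 'M[C]_n) :
  zariski_closed (@realC R) Gt -> algebraic_group_iso (@realC R) Gt G Rc ->
  [set A | exists2 M, real_points Gt M & mxC A = Rc (mxC M)] = real_points G.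
Proof.
move=> cG [reg _ [h [_ hG hH]]]; apply/seteqP; split=> [A [M GM AM]|A GA] /=.
  by rewrite /real_points/= AM; case: (hG _ GM).
have [GN RN] := hH _ GA; set N := h (mxC A) in GN RN.
have conjR M : Gt M -> Rc (mxconj M) = mxconj (Rc M).
  move=> GM; apply/matrixP => i j; have [f rf fE] := reg i j.
  by rewrite mxE !fE ?(regular_conj _ rf)//; exact: zariski_closed_conj.
(* The conjugate of [N] has the same image, and [Rc] is injective. *)
have cN : mxconj N = N.
  have [_ <-] := hG _ (zariski_closed_conj cG GN).
  by rewrite conjR// RN mxconj_mxC.
have [M NM] := mxconj_fixed cN.
by exists M; rewrite /real_points/= -?NM.
Qed.

Lemma regular_mxC_cvg (A : set C) k (f : 'M[C]_k -> C) (T : Type) (F : set_system T)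
    (FF : Filter F) (u : T -> 'M[R]_k) (B : 'M[R]_k) : B \in unitmx -> u x @[x --> F] --> B ->
  regular A f ->
  complex.Re (f (mxC (u x))) @[x --> F] --> complex.Re (f (mxC B)) /\
  complex.Im (f (mxC (u x))) @[x --> F] --> complex.Im (f (mxC B)).
Proof.
move=> uB cu; elim=> [c _|i j||f1 f2 _ [h1 h1'] _ [h2 h2']|f1 f2 _ [h1 h1'] _ [h2 h2']].
- by split; exact: cvg_cst.
- split.
    rewrite mxE /=; under eq_fun do rewrite mxE /=.
    exact: cvg_coord.
  rewrite mxE /=; under eq_fun do rewrite mxE /=.
  exact: cvg_cst.
- have E (M : 'M[R]_k) : (\det (mxC M))^-1 = ((\det M)^-1)%:C%C.
    by rewrite /mxC det_map_mx fmorphV.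
  split; rewrite E; under eq_fun do rewrite E; last exact: cvg_cst.
  apply: cvgV; last exact: cvg_det.
  by rewrite -unitfE -unitmxE.
- split; rewrite raddfD /=; under eq_fun do rewrite raddfD /=; exact: cvgD.
- split; [rewrite ReM | rewrite ImM].
    by under eq_fun do rewrite ReM; apply: cvgB; exact: cvgM.
  by under eq_fun do rewrite ImM; apply: cvgD; exact: cvgM.
Qed.

Lemma real_points_group n (G : set 'M[C]_n) : matrix_group G -> matrix_group (real_points G).
Proof.
move=> [Gu G1 GM GV]; split; rewrite /real_points.
- by move=> M /= /Gu /=; rewrite !unitmxE !unitfE /mxC det_map_mx fmorph_eq0.
- by rewrite /= /mxC map_mx1.
- by move=> M N /= hM hN; rewrite /mxC mxCM; exact: GM.
- by move=> M /= hM; rewrite /mxC map_invmx; exact: GV.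
Qed.

(** Regular functions involve the inverse determinant, so their continuity is available at
    invertible matrices. The closed set is therefore taken to be the closure, whose invertible
    points satisfy the equations in the limit. *)
Lemma real_points_closed (A : set C) n (G : set 'M[C]_n) : matrix_group G -> zariski_closed A G ->
  closed_linear_group (real_points G).
Proof.
move=> gG [S SA GS]; have gR := real_points_group gG; split=> //.
exists (closure (real_points G)); first exact: closed_closure.
apply/seteqP; split=> [M GM|B [cB /= uB]].
  by split; [exact: subset_closure | case: gR => h _ _ _; exact: h].
rewrite /real_points /= GS; split.
  by rewrite /= /mxC unitmxE det_map_mx rmorph_unit// -unitmxE.
move=> f Sf.
have [hR hI] := regular_mxC_cvg (nbhs_filter B) uB (@cvg_id _ (nbhs B)) (SA _ Sf).
have z (h : 'M[R]_n -> R) : h x @[x --> B] --> h B -> (forall M, real_points G M -> h M = 0) -> h B = 0.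
  move=> ch h0; apply/eqP; apply: contraT => hB.
  have : nbhs B [set x | h x != 0].
    by apply: (ch [set y | y != 0]); apply: open_nbhs_nbhs; split=> //; exact: open_neq.
  by move=> /cB[M [/h0 hM /=]]; rewrite hM eqxx.
have f0 M : real_points G M -> f (mxC M) = 0.
  by rewrite /real_points/= GS => -[_]; apply.
apply: complex_ext.
  by apply: (z (fun M => complex.Re (f (mxC M)))) => // M /f0 ->.
by apply: (z (fun M => complex.Im (f (mxC M)))) => // M /f0 ->.
Qed.

End RealForm.

Local Opaque mexp mexpC.

Lemma mexpC_star (R : realType) n (S X : 'M[R[i]]_n) : S \in unitmx ->
  mexpC (star S X) = star S (mexpC X).
Proof.
move=> uS; have cj (Y : 'M[R[i]]_n) : S *m mexpC (invmx S *m Y *m S) = mexpC Y *m S.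
  by symmetry; apply: mexpC_intertwine; rewrite !mulmxA mulmxV// mul1mx.
have cj' : mexpC (S *m X *m invmx S) = S *m mexpC X *m invmx S.
  rewrite -[LHS]mulmx1 -(mulmxV uS) mulmxA; congr (_ *m _).
  by apply: mexpC_intertwine; rewrite mulmxKV.
pose T := (S *m X *m invmx S)^T.
have e1 : mexpC (invmx S *m T *m S) = invmx S *m (mexpC T *m S).
  by rewrite -(cj T) (mulKmx uS).
by rewrite /star -/T e1 (mexpC_tr (S *m X *m invmx S)) cj' mulmxA.
Qed.

Lemma star_mxC (R : realType) n (S X : 'M[R]_n) : star (mxC S) (mxC X) = mxC (star S X).
Proof. by rewrite /star /mxC !map_mxM -map_trmx !map_mxM !map_invmx. Qed.

(** * The fixed subalgebra and its group are star-stable *)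

Section RealFormGroup.
Local Open Scope complex_scope.
Variables (R : realType) (g : vectType R) (br : g -> g -> g).
Hypothesis hbr : lie_bracket br.
Hypothesis hss : lie_semisimple br fullv.
Variable phi : 'End(g).
Hypothesis phi_br : forall x y, phi (br x y) = br (phi x) (phi y).
Hypothesis phiK : forall x, phi (phi x) = x.
Variables (g0 : {vspace g}) (n : nat) (e : n.-tuple g).
Hypothesis g0P : forall x, (x \in g0) = (phi x == x).
Hypothesis he : basis_of fullv e.

Let a x := mx_in e (br x).
Let C := coordc e.

Let aE x y : a x *m C y = C (br x y).
Proof. by apply: (mx_in_coordc he) => s u v; rewrite (brPr hbr). Qed.

Let fC : frame C := coordc_frame he.

Let a_linear s x y : a (s *: x + y) = s *: a x + a y.
Proof.
apply: (frame_mx_ext fC) => z; rewrite mulmxDl -scalemxAl !aE (brPl hbr).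
by case: fC => -> _.
Qed.

Let a_br x y : a (br x y) = commutator (a x) (a y).
Proof.
apply: (frame_mx_ext fC) => z; rewrite mulmxBl -!mulmxA !aE.
have lC s u v : C (s *: u + v) = s *: C u + C v by case: fC.
have -> : br x (br y z) = 1 *: br (br x y) z + br y (br x z) by rewrite scale1r (br_jacobi hbr).
by rewrite lC scale1r addrK.
Qed.

(** An orthogonal involution is self-adjoint, so star fixes [Phi] and reverses the relation that
    [a x] commutes with it. Hence ad of [phi x'] and of [x'] coincide, and the centre of g is 0. *)
Lemma fixed_star_metric : exists2 S : 'M[R]_n, S \in unitmx &
  forall x, x \in g0 -> exists2 x', x' \in g0 & star S (a x) = a x'.
Proof.
have phiD s x y : phi (s *: x + y) = s *: phi x + phi y by rewrite linearP.
have [S uS [hS hphi]] := invariant_metric hbr hss phiD phi_br phiK fC.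
exists S => // x xg0.
have adj (A B : 'M[R]_n) : (forall y z, frob (S *m (A *m C y)) (S *m C z) =
    frob (S *m C y) (S *m (B *m C z))) -> star S A = B.
  move=> h; have fS := frame_mul uS fC.
  have : (S *m A *m invmx S)^T = S *m B *m invmx S.
    apply: frob_adjoint => u v; have [y <-] := frame_surj fS u; have [z <-] := frame_surj fS v.
    by rewrite -!mulmxA !mulKmx.
  by rewrite /star => ->; rewrite !mulmxA mulVmx// mul1mx mulmxKV.
have [x' hx'] := hS x.
have sx : star S (a x) = a x' by apply: adj => y z; rewrite !aE.
exists x' => //; rewrite g0P.
pose Phi := mx_in e phi.
have PhiE y : Phi *m C y = C (phi y) by exact: (mx_in_coordc he).
have sPhi : star S Phi = Phi.
  by apply: adj => y z; rewrite !PhiE -(hphi y) phiK.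
have comm : Phi *m a x = a x *m Phi.
  apply: (frame_mx_ext fC) => y; rewrite -!mulmxA PhiE !aE PhiE phi_br.
  by move: xg0; rewrite g0P => /eqP ->.
have comm' : a x' *m Phi = Phi *m a x'.
  by rewrite -sx -{1}sPhi -starM// comm starM// sPhi.
rewrite -subr_eq0; apply/eqP; apply: (center_free hbr hss) => y.
rewrite (brDl hbr) (brNl hbr); apply/eqP; rewrite subr_eq0; apply/eqP.
apply: (frame_inj fC); rewrite -[y in LHS]phiK -phi_br -PhiE -(aE x' (phi y)) -PhiE.
by rewrite mulmxA -comm' -!mulmxA !PhiE phiK aE.
Qed.

Variable Gc0 : set 'M[R[i]]_n.
Hypothesis groupGc0 : matrix_group Gc0.
Hypothesis closedGc0 : zariski_closed setT Gc0.
Hypothesis lieGc0 : complex_lie_algebra Gc0 = ad_complexified br e g0.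
Hypothesis genGc0 : Gc0 = exp_ad_group br e g0.

Let Gc0_star S : S \in unitmx ->
  (forall x, x \in g0 -> exists2 x', x' \in g0 & star S (a x) = a x') ->
  forall M, Gc0 M -> Gc0 (star (mxC S) M).
Proof.
move=> uS hS; have uSC : mxC S \in unitmx by rewrite /mxC unitmxE det_map_mx rmorph_unit// -unitmxE.
have [Gu G1 GM GV] := groupGc0.
(* The preimage of a group under an anti-automorphism is a group, so only the generators remain to
   be checked. *)
have gH : matrix_group [set M | M \in unitmx /\ Gc0 (star (mxC S) M)].
  split.
  - by move=> M [].
  - by split; [exact: unitmx1 | rewrite star1].
  - move=> M N [uM hM] [uN hN]; split; first by rewrite unitmx_mul uM.
    by rewrite starM//; exact: GM.
  - move=> M [uM hM]; split; first by rewrite unitmx_inv.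
    have -> : star (mxC S) (invmx M) = invmx (star (mxC S) M).
      have h : star (mxC S) (invmx M) *m star (mxC S) M = 1%:M by rewrite -starM// mulmxV// star1.
      by rewrite -[RHS]mul1mx -h mulmxK// Gu.
    exact: GV.
move=> M; rewrite {1}genGc0 => /(_ _ gH) [] // _ [X [x [y [xg yg ->]]] <-].
split; first exact: mexpC_unit.
have [x' x'g ex] := hS x xg; have [y' y'g ey] := hS y yg.
have -> : star (mxC S) (mexpC (adC br e x y)) = mexpC (adC br e x' y').
  rewrite -(mexpC_star (adC br e x y) uSC); congr mexpC.
  by rewrite /adC starD starZ !star_mxC ex ey.
rewrite genGc0 => K gK sK; apply: sK; exists (adC br e x' y') => //.
by exists x', y'.
Qed.

Let G0 := real_points Gc0.

Lemma real_form_reductive : reductive_Lie_group G0.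
Proof.
have [S uS hS] := fixed_star_metric.
have [L hL] : exists L : {vspace 'M[R]_n}, forall X, X \in L <-> exists2 x, x \in g0 & X = a x.
  apply: vspace_of_pred.
    exists 0; first exact: mem0v.
    by have := a_linear (-1) 0 0; rewrite scaler0 addr0 scaleN1r addNr.
  move=> s X Y [x xg ->] [y yg ->]; exists (s *: x + y); first by rewrite memvD// memvZ.
  by rewrite a_linear.
have brg x y : x \in g0 -> y \in g0 -> br x y \in g0.
  by rewrite !g0P phi_br => /eqP -> /eqP ->.
have brL X Y : X \in L -> Y \in L -> commutator X Y \in L.
  by move=> /hL[x xg ->] /hL[y yg ->]; apply/hL; exists (br x y); [exact: brg | rewrite a_br].
have a0 : a 0 = 0 by have := a_linear (-1) 0 0; rewrite scaler0 addr0 scaleN1r addNr.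
have adR x : adC br e x 0 = mxC (a x).
  by rewrite /adC -/(a 0) a0 /mxC map_mx0 scaler0 addr0.
have lieG : is_lie_algebra_of G0 L.
  move=> X; split=> [/hL[x xg ->] t|h].
    have : complex_lie_algebra Gc0 (mxC (a x)).
      by rewrite lieGc0 -adR; exists x, 0; split=> //; exact: mem0v.
    move=> /(_ t%:C); rewrite (_ : t%:C *: mxC (a x) = mxC (t *: a x)).
      by rewrite (mexpC_real (t *: a x)).
    by apply/matrixP => i j; rewrite !mxE rmorphM.
  have : complex_lie_algebra Gc0 (mxC X).
    move=> z; apply: (zariski_closed_mexpC closedGc0) => t.
    have := h t; rewrite /G0/real_points/=.
    rewrite -(mexpC_real (t *: X)) (_ : mxC (t *: X) = t%:C *: mxC X)//.
    by apply/matrixP => i j; rewrite !mxE rmorphM.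
  (* [X] is real, so comparing real parts in $X = \mathrm{ad}(x) + i\,\mathrm{ad}(y)$ leaves
     $\mathrm{ad}(x)$. *)
  rewrite lieGc0 => -[x [y [xg yg E]]]; apply/hL; exists x => //.
  apply/matrixP => i j; have := congr1 (fun M : 'M[R[i]]_n => complex.Re (M i j)) E.
  by rewrite /= !mxE /= => ->; rewrite mul0r mulr0 subrr addr0.
have GS X : G0 X -> G0 (star S X).
  by rewrite /G0/real_points/= -star_mxC; exact: Gc0_star.
have gG0 := real_points_group groupGc0.
have [GU G1 GM GV] := gG0.
apply: (@star_reductive_group R n S uS G0 L) => //.
- exact: (real_points_closed groupGc0 closedGc0).
- move=> Q d uQ h t; apply: (zariski_closed_powers uQ closedGc0) => k.
  exact: h.
move=> x Gx; have ux : x \in unitmx by exact: GU.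
apply: (inner_Ad brL ux).
  move=> X /lieG hX; apply/lieG => t.
  have -> : mexp (t *: Ad x X) = x *m mexp (t *: X) *m invmx x.
    by rewrite -(mexp_conjV _ ux); congr mexp; rewrite /Ad -scalemxAr -scalemxAl.
  exact: GM _ _ (GM _ _ Gx (hX t)) (GV _ Gx).
move=> K gK hK; have := Gx; rewrite /G0/real_points/= genGc0; apply=> // _ [X [u [v [ug vg ->]]] <-].
by apply: hK; apply/hL; [exists u | exists v].
Qed.

End RealFormGroup.

Local Open Scope complex_scope.

Theorem proposition3 (R : realType)
  (* the split real semisimple Lie algebra g *)
  (g : vectType R) (br : g -> g -> g)
  (hbr : lie_bracket br)
  (hss : lie_semisimple br fullv)
  (hsplit : lie_split br fullv)
  (* the automorphism of order 2 *)
  (phi : 'End(g))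
  (hphi_br : forall x y, phi (br x y) = br (phi x) (phi y))
  (hphi_inv : (phi \o phi)%VF = \1%VF)
  (hphi_neq : phi <> \1%VF)
  (g0 : {vspace g}) (hg0 : g0 = passmx.leigenspace phi 1)
  (* a basis of g, giving the real structure *)
  (n : nat) (e : n.-tuple g) (he : basis_of fullv e)
  (* the adjoint group G^c and its subgroup G_0^c *)
  (Gc : set 'M[R[i]]_n)
  (hGc : connected_algebraic_group setT Gc)
  (hGc_lie : complex_lie_algebra Gc = ad_complexified br e fullv)
  (Gc0 : set 'M[R[i]]_n)
  (hGc0_sub : Gc0 `<=` Gc)
  (hGc0 : connected_algebraic_group setT Gc0)
  (hGc0_lie : complex_lie_algebra Gc0 = ad_complexified br e g0)
  (hGc0_gen : Gc0 = exp_ad_group br e g0)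
  (* the isomorphism R^c, defined over the reals *)
  (k : nat) (Gt : set 'M[R[i]]_k)
  (hGt : connected_algebraic_group (@realC R) Gt)
  (Rc : 'M[R[i]]_k -> 'M[R[i]]_n)
  (hRc : algebraic_group_iso (@realC R) Gt Gc0 Rc)
  (* the group G_0 = R^c(Gt(R)), as a group of real matrices *)
  (G0 : set 'M[R]_n)
  (hG0 : G0 = [set A | exists2 M, real_points Gt M & mxC A = Rc (mxC M)]) :
  reductive_Lie_group G0.
Proof.
have phiK x : phi (phi x) = x by rewrite -comp_lfunE hphi_inv id_lfunE.
have g0P x : (x \in g0) = (phi x == x) by rewrite hg0 memv_leigenspace scale1r.
have [gG _ _] := hGc0; have [_ cG _] := hGc0; have [_ cGt _] := hGt.
rewrite hG0 (real_points_iso cGt hRc).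
exact: (real_form_reductive hbr hss hphi_br phiK g0P he gG cG hGc0_lie hGc0_gen).
Qed.
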